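(* Let $A$ be either a simplicial complex whose vertex set is totally ordered or a small category, with a chosen base vertex $a_0\in V(A)$, and let $S=S(A)$ be the associated pointed simplicial set. Let $G$ be a simplicial group and let $\delta\colon V(A)\to \mathrm{End}(G)$ be a non-singular twisted structure on $A$ with coefficients in $G$. Let $\bar W(G)$ be equipped with the induced non-singular reduced twisted structure $v\mapsto \bar W(\delta_v)$ of $A$ in the pointed simplicial set $\bar W(G)$, and let $\bar W(G)\wedge_{\delta}S$ be the resulting $\delta$-twisted smash product. Then there is a natural simplicial map $$\theta\colon \bar W(G)\wedge_{\delta} S\longrightarrow \bar W(F^G_{\delta}[S])$$ which is a homotopy equivalence after geometric realization.
   Context: **The simplicial set $S(A)$.** $V(A)$ denotes the set of vertices of $A$ (if $A$ is a simplicial complex) or the set of objects of $A$ (if $A$ is a small category). - If $A=K$ is a simplicial complex with totally ordered vertex set, $S(K)_n$ is the set of sequences $(v_0,\dots,v_n)$ of vertices with $v_0\le v_1\le\cdots\le v_n$ such that $\{v_0,\dots,v_n\}$ is a simplex of $K$. The face $d_i$ deletes $v_i$, and the degeneracy $s_i$ repeats $v_i$. - If $A=\mathcal C$ is a small category, $S(\mathcal C)$ is its nerve. Thus $S_0=V(\mathcal C)$ and $S_n$ ($n\geq 1$) is the set of $n$-paths $v_0\alpha_1v_1\cdots\alpha_nv_n$ with $\alpha_i\colon v_{i-1}\to v_i$ morphisms. The face $d_i$ deletes $v_i$ and composes $\alpha_{i+1}\circ\alpha_i$ (and $d_0$, $d_n$ delete the first, respectively last, vertex together with its arrow). The degeneracy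 $s_i$ repeats $v_i$, inserting the identity of $v_i$. In both cases an $n$-simplex $x$ has vertices $v_0,\dots,v_n$. The basepoint of $S_n$ is the constant simplex $a_0^n$ at $a_0$ (that is, $s_0^n a_0$). **Twisted structure in a simplicial group.** $\mathrm{End}(G)$ is the monoid of simplicial endomorphisms of $G$ (graded group endomorphisms commuting with all faces and degeneracies). A twisted structure on $A$ with coefficients in $G$ is a function $\delta\colon V(A)\to\mathrm{End}(G)$, $v\mapsto\delta_v$, such that $\delta_v\circ\delta_w=\delta_w\circ\delta_v$ whenever there is an edge joining $v$ and $w$ (simplicial complex case) or an arrow from $v$ to $w$ or from $w$ to $v$ (category case). It is non-singular if every $\delta_v$ is a simplicial automorphism. **The simplicial group $F^G_\delta[S]$** (also written $F^G_\delta[A]$), for $\delta$ non-singular. In degree $n$ it is the group $F^G[A]_n$, the quotient of the free product $\ast_{x\in S_n}(G_n)_x$ of copies $(G_n)_x$ of $G_n$ by the relations $(G_n)_{a_0^n}=\{1\}$. Write $g_x$ for the element $g\in G_n$ in the copy $(G_n)_x$. For $x\in S_n$ with vertices $v_0,\dots,v_n$, the faces and degeneracies are the group homomorphisms determined by $$d_i^\delta(g_x)=(\delta_{v_i}(d_ig))_{d_ix},\qquad s_i^\delta(g_x)=(\delta_{v_i}^{-1}(s_ig))_{s_ix},\qquad 0\le i\le n.$$ **The functor $\bar W$.** For a (discrete) group $H$, $W(H)$ is the nerve of the one-object category whose morphisms are the elements of $H$ with composition given by the multiplication of $H$. For a simplicial group $G$, $\{W(G_n)\}_{n\ge0}$ is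 a bisimplicial set, and $\bar W(G)$ denotes its diagonal simplicial set. It is pointed by the unique vertex and its degeneracies. **Twisted smash product.** Let $Y$ be a pointed simplicial set. A reduced twisted structure on $A$ in $Y$ is a function $\delta\colon V(A)\to\mathrm{End}_*(Y)$ to the monoid of basepoint-preserving simplicial self-maps satisfying the same commuting rule. It is non-singular if every $\delta_v$ is an isomorphism. For a non-singular one, $Y\times_\delta S$ is the simplicial set with $n$-simplices $Y_n\times S_n$ and $$d_i(y,x)=(\delta_{v_i}(d_iy),d_ix),\qquad s_i(y,x)=(\delta_{v_i}^{-1}(s_iy),s_ix)$$ for $x\in S_n$ with vertices $v_0,\dots,v_n$. Then $$Y\wedge_\delta S:=(Y\times_\delta S)/\big((Y\times_\delta a_0)\cup(\ast\times_\delta S)\big),$$ where $Y\times_\delta a_0$ is the simplicial subset with $n$-simplices $Y_n\times\{a_0^n\}$ and $\ast\times_\delta S$ is the simplicial subset with $n$-simplices $\{\ast\}\times S_n$. **Naturality** is with respect to the data $(A,a_0,G,\delta)$. A morphism $(A,a_0,G,\delta)\to(A',a_0',G',\delta')$ consists of a basepoint-preserving map $f\colon A\to A'$ (a weakly order-preserving simplicial map, or a functor) and a homomorphism of simplicial groups $\varphi\colon G\to G'$ with $\varphi\circ\delta_v=\delta'_{f(v)}\circ\varphi$ for all $v\in V(A)$. *)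

(* Defs.v *)
From HB Require Import structures.
From Stdlib Require Import Relation_Operators.
From mathcomp Require Import all_boot all_order all_algebra finmap zify.
From mathcomp Require Import all_classical all_reals topology normedtype.

Set Implicit Arguments.
Unset Strict Implicit.
Unset Printing Implicit Defensive.

Import Order.TTheory GRing.Theory Num.Theory.
Import numFieldNormedType.Exports.

Local Open Scope ring_scope.
Local Open Scope quotient_scope.

Section GeneratedQuotient.
Variables (T : choiceType) (step : T -> T -> Prop).

Definition gen_rel (x y : T) : bool := `[< clos_refl_sym_trans T step x y >].

Lemma gen_rel_refl : reflexive gen_rel.
Proof. by move=> x; apply/asboolP; exact: rst_refl. Qed.

Lemma gen_rel_sym : symmetric gen_rel.
Proof. by move=> x y; apply/asboolP/asboolP; exact: rst_sym. Qed.

Lemma gen_rel_trans : transitive gen_rel.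
Proof. by move=> y x z /asboolP xy /asboolP yz; apply/asboolP; exact: rst_trans xy yz. Qed.

Definition gen_equiv := EquivRel gen_rel gen_rel_refl gen_rel_sym gen_rel_trans.

Definition gen_quot := {eq_quot gen_equiv}.

Definition gen_pi (x : T) : gen_quot := \pi x.

Lemma gen_piP (x y : T) :
  gen_pi x = gen_pi y <-> clos_refl_sym_trans T step x y.
Proof. by split=> [/eqmodP/asboolP|h]; last exact/eqmodP/asboolP. Qed.

Lemma gen_quotW (P : gen_quot -> Prop) : (forall x, P (gen_pi x)) -> forall q, P q.
Proof. by move=> h q; rewrite -[q]reprK; exact: h. Qed.

Definition gen_lift (U : Type) (f : T -> U) (q : gen_quot) : U := f (repr q).

Lemma gen_lift_pi (U : Type) (f : T -> U) :
  (forall x y, step x y -> f x = f y) ->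
  forall x, gen_lift f (gen_pi x) = f x.
Proof.
move=> hf x; rewrite /gen_lift.
have /gen_piP : gen_pi (repr (gen_pi x)) = gen_pi x by exact: reprK.
by move: (repr _) => y; elim=> {x y} [a b /hf|a|a b _ ->|a b c _ -> _ ->].
Qed.

End GeneratedQuotient.

(* The identities for i < j (and i > j + 1) are shifted by one, so that every index
   stays a natural number; all indices given to [inord] are within bounds. *)
Definition simplicial_identities (X : nat -> Type)
    (face : forall n, 'I_n.+2 -> X n.+1 -> X n)
    (degen : forall n, 'I_n.+1 -> X n -> X n.+1) : Prop :=
  let d n i := face n (inord i) in
  let s n i := degen n (inord i) in
  [/\ forall n i j (x : X n.+2), i <= j <= n.+1 ->
        d n i (d n.+1 j.+1 x) = d n j (d n.+1 i x),
      forall n i j (x : X n.+1), i <= j <= n ->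
        d n.+1 i (s n.+1 j.+1 x) = s n j (d n i x),
      forall n j (x : X n), j <= n ->
        d n j (s n j x) = x /\ d n j.+1 (s n j x) = x,
      forall n i j (x : X n.+1), j < i <= n.+1 ->
        d n.+1 i.+1 (s n.+1 j x) = s n j (d n i x) &
      forall n i j (x : X n), i <= j <= n ->
        s n.+1 i (s n j x) = s n.+1 j.+1 (s n i x)]%N.

Record sset := SSet {
  simplex :> nat -> Type;
  face : forall n, 'I_n.+2 -> simplex n.+1 -> simplex n;
  degen : forall n, 'I_n.+1 -> simplex n -> simplex n.+1;
  sset_ids : simplicial_identities face degen }.

Record smap (X Y : sset) := SMap {
  smap_fun :> forall n, X n -> Y n;
  smap_face : forall n i (x : X n.+1), smap_fun (face i x) = face i (smap_fun x);
  smap_degen : forall n i (x : X n), smap_fun (degen i x) = degen i (smap_fun x) }.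

Record psset := PSSet { psset_sset :> sset; vtx_pt : psset_sset 0%N }.

Fixpoint pt (Y : psset) (n : nat) : Y n :=
  if n is m.+1 then degen ord0 (pt Y m) else vtx_pt Y.

Record psmap (X Y : psset) := PSMap {
  psmap_sset :> smap X Y;
  psmap_pt : psmap_sset 0%N (vtx_pt X) = vtx_pt Y }.

Lemma psmapE (X Y : psset) (f : psmap X Y) n : f n (pt X n) = pt Y n.
Proof. by elim: n => [|n ih] /=; [exact: psmap_pt|rewrite smap_degen ih]. Qed.

Lemma inord0 n : inord 0 = ord0 :> 'I_n.+1.
Proof. by apply: val_inj; rewrite /= inordK. Qed.

Lemma degen_pt (Y : psset) n (i : 'I_n.+1) : degen i (pt Y n) = pt Y n.+1.
Proof.
case: (sset_ids Y) => _ _ _ _ hss.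
elim: n i => [|n ih] i; first by rewrite (ord1 i).
have [->//|i0] := eqVneq i ord0.
have ip : (0 < i)%N by rewrite lt0n.
have hi : (0 <= i.-1 <= n)%N by have := ltn_ord i; lia.
have := hss n 0%N i.-1 (pt Y n) hi.
by rewrite prednK // inord_val !inord0 (ih (inord i.-1)) /= => <-.
Qed.

Lemma face_pt (Y : psset) n (i : 'I_n.+2) : face i (pt Y n.+1) = pt Y n.
Proof.
case: (sset_ids Y) => _ _ hds hds' _.
elim: n i => [|n ih] i /=.
  have [] := hds 0%N 0%N (vtx_pt Y) isT; rewrite !inord0.
  have [-> //|i0 _] := eqVneq i ord0; rewrite (_ : inord 1 = i) //.
  apply: val_inj; rewrite /= inordK //.
  by have := ltn_ord i; have : (i : nat) <> 0%N by [move/eqP: i0 => i0 e; apply: i0; exact: val_inj]; lia.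
have [->|i0] := eqVneq i ord0.
  by have [] := hds n.+1 0%N (pt Y n.+1) isT; rewrite !inord0.
have ip : (0 < i)%N by rewrite lt0n.
have [i1|i1] := eqVneq (i : nat) 1%N.
  have [_] := hds n.+1 0%N (pt Y n.+1) isT; rewrite -[in inord 1]i1 inord_val.
  by rewrite inord0.
have hi : (0 < i.-1 <= n.+1)%N by have := ltn_ord i; lia.
have := hds' n i.-1 0%N (pt Y n.+1) hi.
by rewrite prednK // inord_val !inord0 => ->; rewrite -[pt Y n.+1]/(degen ord0 (pt Y n)) ih.
Qed.

Record subsset (X : sset) := SubSSet {
  subsset_mem :> forall n, X n -> Prop;
  subsset_face : forall n i (x : X n.+1), subsset_mem x -> subsset_mem (face i x);
  subsset_degen : forall n i (x : X n), subsset_mem x -> subsset_mem (degen i x) }.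

Section Collapse.
Variables (X : sset) (A : subsset X).

Definition collapse_step n (x y : {classic X n}) : Prop := A n x /\ A n y.

(* This is X/A when every A n is nonempty; for empty A it does not add a point. *)
Definition collapse_obj n : Type := gen_quot (@collapse_step n).

Definition collapse_pi n (x : X n) : collapse_obj n :=
  gen_pi (@collapse_step n) x.

Lemma collapse_piE n (x y : X n) : A n x -> A n y ->
  collapse_pi x = collapse_pi y.
Proof. by move=> hx hy; apply/gen_piP; apply: rst_step. Qed.

Lemma collapse_piP n (x y : X n) :
  collapse_pi x = collapse_pi y <-> x = y \/ (A n x /\ A n y).
Proof.
split=> [/gen_piP|[-> //|[hx hy]]]; last exact: collapse_piE.
elim=> {x y} [x y h|x|x y _ [->|[]]|x y z _ [->|[hx hy]] _ [<-|[]]] //; by [left|right|tauto].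
Qed.

Definition collapse_face n (i : 'I_n.+2) : collapse_obj n.+1 -> collapse_obj n :=
  gen_lift (fun x : {classic X n.+1} => collapse_pi (face i (x : X n.+1))).

Definition collapse_degen n (i : 'I_n.+1) : collapse_obj n -> collapse_obj n.+1 :=
  gen_lift (fun x : {classic X n} => collapse_pi (degen i (x : X n))).

Lemma collapse_faceE n i (x : X n.+1) :
  collapse_face i (collapse_pi x) = collapse_pi (face i x).
Proof.
rewrite [LHS]gen_lift_pi // => a b [ha hb].
by apply: collapse_piE; exact: subsset_face.
Qed.

Lemma collapse_degenE n i (x : X n) :
  collapse_degen i (collapse_pi x) = collapse_pi (degen i x).
Proof.
rewrite [LHS]gen_lift_pi // => a b [ha hb].
by apply: collapse_piE; exact: subsset_degen.
Qed.

Lemma collapse_ids : simplicial_identities collapse_face collapse_degen.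
Proof.
have [h1 h2 h3 h4 h5] := sset_ids X.
split=> [n i j|n i j|n j|n i j|n i j] /=; elim/gen_quotW=> x hij;
  rewrite -/(collapse_pi x).
- by rewrite 4!collapse_faceE; congr collapse_pi; exact: h1.
- rewrite collapse_degenE !collapse_faceE collapse_degenE.
  by congr collapse_pi; exact: h2.
- by have [e1 e2] := h3 n j x hij; rewrite collapse_degenE !collapse_faceE e1 e2.
- rewrite collapse_degenE !collapse_faceE collapse_degenE.
  by congr collapse_pi; exact: h4.
- by rewrite 4!collapse_degenE; congr collapse_pi; exact: h5.
Qed.

Definition collapse : sset := SSet collapse_ids.

End Collapse.

Section CollapseMap.
Variables (X X' : sset) (A : subsset X) (A' : subsset X') (f : smap X X').
Hypothesis fA : forall n x, A n x -> A' n (f n x).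

Definition collapse_fun n : collapse A n -> collapse A' n :=
  gen_lift (fun x : {classic X n} => collapse_pi A' (f n x)).

Lemma collapse_funE n (x : X n) :
  collapse_fun (collapse_pi A x) = collapse_pi A' (f n x).
Proof.
rewrite [LHS]gen_lift_pi // => a b [ha hb].
by apply: collapse_piE; exact: fA.
Qed.

Lemma collapse_fun_face n i (x : collapse A n.+1) :
  collapse_fun (face i x) = face i (collapse_fun x).
Proof.
move: x; apply: gen_quotW => x; rewrite -/(collapse_pi _ _).
by rewrite /= collapse_faceE !collapse_funE collapse_faceE smap_face.
Qed.

Lemma collapse_fun_degen n i (x : collapse A n) :
  collapse_fun (degen i x) = degen i (collapse_fun x).
Proof.
move: x; apply: gen_quotW => x; rewrite -/(collapse_pi _ _).
by rewrite /= collapse_degenE !collapse_funE collapse_degenE smap_degen.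
Qed.

Definition collapse_map : smap (collapse A) (collapse A') :=
  SMap collapse_fun_face collapse_fun_degen.

End CollapseMap.

Record bisset := BiSSet {
  bi_obj :> nat -> sset;
  bi_face : forall n, 'I_n.+2 -> smap (bi_obj n.+1) (bi_obj n);
  bi_degen : forall n, 'I_n.+1 -> smap (bi_obj n) (bi_obj n.+1);
  bi_ids : forall m, simplicial_identities
    (fun n i => bi_face i m) (fun n i => bi_degen i m) }.

Section Diagonal.
Variable X : bisset.

Definition diag_obj n : Type := X n n.
Definition diag_face n (i : 'I_n.+2) (x : diag_obj n.+1) : diag_obj n :=
  face i (bi_face X i n.+1 x).
Definition diag_degen n (i : 'I_n.+1) (x : diag_obj n) : diag_obj n.+1 :=
  degen i (bi_degen X i n x).

Lemma diag_ids : simplicial_identities diag_face diag_degen.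
Proof.
rewrite /diag_face /diag_degen; split=> [n i j x h|n i j x h|n j x h|n i j x h|n i j x h] /=;
  rewrite ?smap_face ?smap_degen.
- have [e _ _ _ _] := sset_ids (X n).
  have [e' _ _ _ _] := bi_ids X n.+2.
  by rewrite e' //; exact: e.
- have [_ e _ _ _] := sset_ids (X n.+1).
  have [_ e' _ _ _] := bi_ids X n.+1.
  by rewrite e' //; exact: e.
- have [_ _ e _ _] := sset_ids (X n).
  have [_ _ e' _ _] := bi_ids X n.
  by have [e1 e2] := e' n j x h; rewrite e1 e2; exact: e.
- have [_ _ _ e _] := sset_ids (X n.+1).
  have [_ _ _ e' _] := bi_ids X n.+1.
  by rewrite e' //; exact: e.
- have [_ _ _ _ e] := sset_ids (X n.+2).
  have [_ _ _ _ e'] := bi_ids X n.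
  by rewrite e' //; exact: e.
Qed.

Definition diag : sset := SSet diag_ids.

End Diagonal.
Record ordered_complex := OrderedComplex {
  cpx_disp : Order.disp_t;
  cpx_vtx : orderType cpx_disp;
  is_simplex : {fset cpx_vtx} -> Prop;
  is_simplex0 : ~ is_simplex fset0;
  is_simplex1 : forall v, is_simplex [fset v]%fset;
  is_simplex_sub : forall s t : {fset cpx_vtx},
    (t `<=` s)%fset -> t != fset0 -> is_simplex s -> is_simplex t }.

Definition coface n (i : 'I_n.+2) : 'I_n.+1 -> 'I_n.+2 := lift i.

Definition codegen n (i : 'I_n.+1) (j : 'I_n.+2) : 'I_n.+1 := inord (unbump i j).

Lemma val_coface n (i : 'I_n.+2) j : coface i j = bump i j :> nat.
Proof. by []. Qed.

Lemma val_codegen n (i : 'I_n.+1) (j : 'I_n.+2) : codegen i j = unbump i j :> nat.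
Proof.
by rewrite inordK // /unbump; have := ltn_ord i; have := ltn_ord j; case: ltnP; lia.
Qed.

Section ComplexSSet.
Variable K : ordered_complex.

Definition vset n (v : 'I_n.+1 -> cpx_vtx K) : {fset cpx_vtx K} :=
  [fset v i | i in 'I_n.+1]%fset.

Definition cpx_obj n : Type :=
  {v : 'I_n.+1 -> cpx_vtx K |
     (forall i j : 'I_n.+1, (i <= j)%N -> (v i <= v j)%O) /\ is_simplex (vset v)}.

Lemma cpx_pullback_subproof m n (a : 'I_m.+1 -> 'I_n.+1) (x : cpx_obj n) :
  {homo a : i j / (i <= j)%N} ->
  (forall i j : 'I_m.+1, (i <= j)%N -> (sval x (a i) <= sval x (a j))%O) /\
  is_simplex (vset (sval x \o a)).
Proof.
case: x => v /= [vle vK] ale; split=> [i j ij|]; first exact/vle/ale.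
apply: is_simplex_sub vK.
  by apply/fsubsetP=> _ /imfsetP[i _ ->]; apply: in_imfset.
by apply/fset0Pn; exists (v (a ord0)); apply: (in_imfset _ (v \o a)).
Qed.

Definition cpx_pullback m n (a : 'I_m.+1 -> 'I_n.+1)
    (ale : {homo a : i j / (i <= j)%N}) (x : cpx_obj n) : cpx_obj m :=
  exist _ (sval x \o a) (cpx_pullback_subproof x ale).

Lemma coface_homo n (i : 'I_n.+2) : {homo coface i : j k / (j <= k)%N}.
Proof. by move=> j k jk; rewrite !val_coface leq_bump2. Qed.

Lemma codegen_homo n (i : 'I_n.+1) : {homo codegen i : j k / (j <= k)%N}.
Proof. by move=> j k jk; rewrite !val_codegen /unbump; do 2 case: ltnP; lia. Qed.

Definition cpx_face n (i : 'I_n.+2) : cpx_obj n.+1 -> cpx_obj n :=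
  cpx_pullback (@coface_homo n i).

Definition cpx_degen n (i : 'I_n.+1) : cpx_obj n -> cpx_obj n.+1 :=
  cpx_pullback (@codegen_homo n i).

Lemma cpx_obj_eq n (x y : cpx_obj n) : sval x = sval y -> x = y.
Proof. by case: x y => [x hx] [y hy] /= e; subst y; congr exist; exact: Prop_irrelevance. Qed.

Lemma cpx_ids : simplicial_identities cpx_face cpx_degen.
Proof.
have solve m n (y : cpx_obj m) (x : cpx_obj n) (a b : 'I_m.+1 -> 'I_n.+1) :
    sval y = sval x \o a -> (forall k, a k = b k :> nat) -> sval y = sval x \o b.
  by move=> -> ab; apply/funext=> k /=; congr (sval x); apply/val_inj/ab.
split=> [n i j x h|n i j x h|n j x h|n i j x h|n i j x h].
- apply/cpx_obj_eq/(@solve _ _ _ x (coface (inord j.+1) \o coface (inord i))) => // k.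
  rewrite /= /bump !inordK; try lia.
- apply/cpx_obj_eq/(@solve _ _ _ x (codegen (inord j.+1) \o coface (inord i))) => // k.
  rewrite [LHS]val_codegen [RHS]val_coface val_codegen val_coface /unbump /bump.
  by rewrite !inordK; lia.
- split; apply/cpx_obj_eq.
    apply: (@solve _ _ _ x (codegen (inord j) \o coface (inord j)) id) => // k.
    by rewrite [LHS]val_codegen val_coface /unbump /bump !inordK; lia.
  apply: (@solve _ _ _ x (codegen (inord j) \o coface (inord j.+1)) id) => // k.
  by rewrite [LHS]val_codegen val_coface /unbump /bump !inordK; lia.
- apply/cpx_obj_eq/(@solve _ _ _ x (codegen (inord j) \o coface (inord i.+1))) => // k.
  rewrite [LHS]val_codegen [RHS]val_coface val_codegen val_coface /unbump /bump.
  by rewrite !inordK; lia.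
- apply/cpx_obj_eq/(@solve _ _ _ x (codegen (inord j) \o codegen (inord i))) => // k.
  rewrite [LHS]val_codegen [RHS]val_codegen !val_codegen /unbump.
  by rewrite !inordK; lia.
Qed.

Definition cpx_sset : sset := SSet cpx_ids.

Lemma cpx_vertex_subproof (a : cpx_vtx K) :
  (forall i j : 'I_1, (i <= j)%N -> ((fun=> a) i <= (fun=> a) j)%O) /\
  is_simplex (vset (fun _ : 'I_1 => a)).
Proof.
split=> //; have -> : vset (fun _ : 'I_1 => a) = [fset a]%fset.
  apply/fsetP=> b; rewrite inE; apply/imfsetP/eqP => [[]//|->].
  by exists ord0.
exact: is_simplex1.
Qed.

Definition cpx_vertex (a : cpx_vtx K) : cpx_sset 0%N :=
  exist _ (fun=> a) (cpx_vertex_subproof a).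

End ComplexSSet.

Record complex_map (K L : ordered_complex) := ComplexMap {
  cmap_vtx :> cpx_vtx K -> cpx_vtx L;
  cmap_homo : {homo cmap_vtx : v w / (v <= w)%O};
  cmap_simplex : forall s, is_simplex s -> is_simplex [fset cmap_vtx v | v in s]%fset }.

Section ComplexMap.
Variables (K L : ordered_complex) (f : complex_map K L).

Lemma cpx_push_subproof n (x : cpx_sset K n) :
  (forall i j : 'I_n.+1, (i <= j)%N -> ((f \o sval x) i <= (f \o sval x) j)%O) /\
  is_simplex (vset (f \o sval x)).
Proof.
case: x => v [vle vK] /=; split=> [i j ij|]; first exact/cmap_homo/vle.
have -> : vset (f \o v) = [fset f w | w in vset v]%fset; last exact: cmap_simplex.
apply/fsetP=> b; apply/imfsetP/imfsetP => /= [[i _ ->]|[w /imfsetP[i _ ->] ->]].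
  by exists (v i) => //; exact: in_imfset.
by exists i.
Qed.

Definition cpx_push n (x : cpx_sset K n) : cpx_sset L n :=
  exist _ (f \o sval x) (cpx_push_subproof x).

Lemma cpx_push_face n i (x : cpx_sset K n.+1) :
  cpx_push (face i x) = face i (cpx_push x).
Proof. exact: cpx_obj_eq. Qed.

Lemma cpx_push_degen n i (x : cpx_sset K n) :
  cpx_push (degen i x) = degen i (cpx_push x).
Proof. exact: cpx_obj_eq. Qed.

Definition cpx_sset_map : smap (cpx_sset K) (cpx_sset L) :=
  SMap cpx_push_face cpx_push_degen.

End ComplexMap.

Record smallcat := SmallCat {
  obj :> Type;
  arr : obj -> obj -> Type;
  idm : forall a, arr a a;
  compm : forall a b c, arr b c -> arr a b -> arr a c;
  comp1m : forall a b (f : arr a b), compm (idm b) f = f;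
  compm1 : forall a b (f : arr a b), compm f (idm a) = f;
  compmA : forall a b c d (h : arr c d) (g : arr b c) (f : arr a b),
    compm h (compm g f) = compm (compm h g) f }.

Record catfun (C D : smallcat) := CatFun {
  fobj :> C -> D;
  farr : forall a b, arr a b -> arr (fobj a) (fobj b);
  farr1 : forall a, farr (idm a) = idm (fobj a);
  farrM : forall a b c (g : arr b c) (f : arr a b),
    farr (compm g f) = compm (farr g) (farr f) }.

Section Nerve.
Variable C : smallcat.

(* An n-path v_0 a_1 v_1 ... a_n v_n is a pair of v_0 and of an element
   a_1 v_1 ... a_n v_n of [tail n v_0]. *)
Fixpoint tail (n : nat) (v : C) : Type :=
  if n is m.+1 then {w : C & (arr v w * tail m w)%type} else unit.

Definition nerve_obj n : Type := {v : C & tail n v}.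

Definition tcons n (v w : C) (a : arr v w) (p : tail n w) : tail n.+1 v :=
  existT _ w (a, p).

(* Deletes v_{i+1} (not v_i), so that the starting vertex v_0 is kept; i <= n. *)
Fixpoint tail_face (n i : nat) {struct n} : forall v : C, tail n.+1 v -> tail n v :=
  match n return forall v : C, tail n.+1 v -> tail n v with
  | 0 => fun v _ => tt
  | m.+1 => fun v p =>
      let: existT w (a, q) := p in
      if i is j.+1 then tcons a (tail_face j q)
      else let: existT w' (b, r) := q in tcons (compm b a) r
  end.

(* Repeats v_i, for i <= n. *)
Fixpoint tail_degen (n i : nat) {struct n} : forall v : C, tail n v -> tail n.+1 v :=
  match n return forall v : C, tail n v -> tail n.+1 v with
  | 0 => fun v p => tcons (idm v) p
  | m.+1 => fun v p =>
      if i is j.+1 then let: existT w (a, q) := p in tcons a (tail_degen j q)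
      else tcons (idm v) p
  end.

(* v_i, for i <= n *)
Fixpoint tail_vertex (n i : nat) {struct n} : forall v : C, tail n v -> C :=
  match n return forall v : C, tail n v -> C with
  | 0 => fun v _ => v
  | m.+1 => fun v p =>
      if i is j.+1 then let: existT w (_, q) := p in tail_vertex j q else v
  end.

Definition nerve_face n (i : 'I_n.+2) (x : nerve_obj n.+1) : nerve_obj n :=
  let: existT v p := x in
  if i : nat is j.+1 then existT _ v (tail_face j p)
  else let: existT w (_, q) := p in existT _ w q.

Definition nerve_degen n (i : 'I_n.+1) (x : nerve_obj n) : nerve_obj n.+1 :=
  let: existT v p := x in existT _ v (tail_degen i p).

Definition nerve_vertex n (x : nerve_obj n) (i : nat) : C :=
  let: existT v p := x in tail_vertex i p.

Lemma tail0 v (p q : tail 0 v) : p = q.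
Proof. by case: p q => [] []. Qed.

Lemma tcons_eq n v w (a b : arr v w) (p : tail n w) : a = b -> tcons a p = tcons b p.
Proof. by move=> ->. Qed.

Lemma tail_face_face n i j v (p : tail n.+2 v) : (i <= j <= n)%N ->
  tail_face i (tail_face j.+1 p) = tail_face j (tail_face i p).
Proof.
elim: n i j v p => [|n ih] i j v; first by move=> p _; exact: tail0.
case=> w [a q]; case: i j => [|i] [|j] h //.
- by case: q => w' [b [w'' [c r]]]; exact/tcons_eq/esym/compmA.
- by case: q => w' [b r].
- exact: (f_equal (tcons a) (ih i j w q h)).
Qed.

Lemma tail_face_degen_lt n i j v (p : tail n.+1 v) : (i < j <= n)%N ->
  tail_face i (tail_degen j.+1 p) = tail_degen j (tail_face i p).
Proof.
elim: n i j v p => [|n ih] i j v p h; first by lia.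
case: j h => [|j] h; first by case/andP: h.
case: p => w [a q]; case: i h => [|i] h; first by case: q => w' [b r].
exact: (f_equal (tcons a) (ih i j w q h)).
Qed.

Lemma tail_face_degen_eq n i v (p : tail n v) : (i <= n)%N ->
  tail_face i (tail_degen i p) = p.
Proof.
elim: n i v p => [|n ih] i v; first by move=> p _; exact: tail0.
case=> w [a q]; case: i => [|i] h.
- exact/tcons_eq/compm1.
- exact: (f_equal (tcons a) (ih i w q h)).
Qed.

Lemma tail_face_degen_succ n i v (p : tail n v) : (i < n)%N ->
  tail_face i (tail_degen i.+1 p) = p.
Proof.
elim: n i v p => [|n ih] i v p h; first by lia.
case: p => w [a q]; case: i h => [|i] h.
- by case: n q {ih h} => [|n] q; exact/tcons_eq/comp1m.
- exact: (f_equal (tcons a) (ih i w q h)).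
Qed.

Lemma tail_face_degen_gt n i j v (p : tail n.+1 v) : (j <= i <= n)%N ->
  tail_face i.+1 (tail_degen j p) = tail_degen j (tail_face i p).
Proof.
elim: n i j v p => [|n ih] i j v [w [a q]] h.
  have [-> ->] : i = 0%N /\ j = 0%N by lia.
  by [].
case: i j h => [|i] [|j] h //.
exact: (f_equal (tcons a) (ih i j w q h)).
Qed.

Lemma tail_degen_degen n i j v (p : tail n v) : (i <= j <= n)%N ->
  tail_degen i (tail_degen j p) = tail_degen j.+1 (tail_degen i p).
Proof.
elim: n i j v p => [|n ih] i j v; first by case: i j => [|i] [|j].
case: i j => [|i] [|j] p h //; case: p => w [a q].
exact: (f_equal (tcons a) (ih i j w q h)).
Qed.

Lemma nerve_face0 n v w (a : arr v w) (p : tail n w) :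
  nerve_face (inord 0) (existT _ v (tcons a p)) = existT _ w p.
Proof. by rewrite /nerve_face inordK. Qed.

Lemma nerve_faceS n i v (p : tail n.+1 v) : (i <= n)%N ->
  nerve_face (inord i.+1) (existT _ v p) = existT _ v (tail_face i p).
Proof. by move=> h; rewrite /nerve_face inordK. Qed.

Lemma nerve_degenE n i v (p : tail n v) : (i <= n)%N ->
  nerve_degen (inord i) (existT _ v p) = existT _ v (tail_degen i p).
Proof. by move=> h; rewrite /nerve_degen inordK. Qed.

Lemma nerve_ids : simplicial_identities nerve_face nerve_degen.
Proof.
rewrite /simplicial_identities; cbv zeta.
split=> [n i j [v p] h|n i j [v p] h|n j [v p] h|n i j [v p] h|n i j [v p] h].
- rewrite nerve_faceS; last lia.
  case: i h => [|i] h; last first.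
    case: j h => // j h; rewrite !nerve_faceS; try lia.
    by congr existT; apply: tail_face_face.
  case: p => w [a p]; rewrite [in RHS]nerve_face0.
  case: j h => [|j] h; last by rewrite nerve_face0 nerve_faceS; last lia.
  by case: p => w' [b p]; rewrite !nerve_face0.
- rewrite nerve_degenE; last lia.
  case: i h => [|i] h.
    by case: p => w [a p]; rewrite !nerve_face0 nerve_degenE //; lia.
  case: j h => [|j] h; first by case/andP: h.
  rewrite !nerve_faceS; try lia.
  rewrite nerve_degenE; last lia.
  by congr existT; apply: tail_face_degen_lt.
- rewrite nerve_degenE // nerve_faceS // tail_face_degen_eq //; split=> //.
  case: j h => [|j] h; last by rewrite nerve_faceS ?tail_face_degen_succ //; lia.
  by case: n p h => [|n] p h; rewrite nerve_face0.
- rewrite nerve_degenE; last lia.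
  case: i h => // i h.
  rewrite !nerve_faceS; try lia.
  rewrite nerve_degenE; last lia.
  by congr existT; apply: tail_face_degen_gt.
- rewrite !nerve_degenE; try lia.
  by congr existT; apply: tail_degen_degen.
Qed.

Definition nerve : sset := SSet nerve_ids.

End Nerve.

Section NerveMap.
Variables (C D : smallcat) (F : catfun C D).

Fixpoint tail_map (n : nat) : forall v : C, tail n v -> tail n (F v) :=
  match n return forall v : C, tail n v -> tail n (F v) with
  | 0 => fun v _ => tt
  | m.+1 => fun v p => let: existT w (a, q) := p in tcons (farr F a) (tail_map q)
  end.

Definition nerve_map_fun n (x : nerve C n) : nerve D n :=
  let: existT v p := x in existT _ (F v) (tail_map p).

Lemma tail_map_face n i v (p : tail n.+1 v) : (i <= n)%N ->
  tail_map (tail_face i p) = tail_face i (tail_map p).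
Proof.
elim: n i v p => [|n ih] i v; first by move=> p _; exact: tail0.
case=> w [a q]; case: i => [|i] h.
- by case: q => w' [b r]; exact/tcons_eq/farrM.
- exact: (f_equal (tcons (farr F a)) (ih i w q h)).
Qed.

Lemma tail_map_degen n i v (p : tail n v) : (i <= n)%N ->
  tail_map (tail_degen i p) = tail_degen i (tail_map p).
Proof.
elim: n i v p => [|n ih] i v p h; first exact/tcons_eq/farr1.
case: i h => [|i] h; first exact/tcons_eq/farr1.
case: p => w [a q].
exact: (f_equal (tcons (farr F a)) (ih i w q h)).
Qed.

Lemma nerve_map_face n i (x : nerve C n.+1) :
  nerve_map_fun (face i x) = face i (nerve_map_fun x).
Proof.
case: x => v p; rewrite /= /nerve_face; case: (i : nat) (ltn_ord i) => [|j] h.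
  by case: p => w [a p].
by congr existT; exact: tail_map_face.
Qed.

Lemma nerve_map_degen n i (x : nerve C n) :
  nerve_map_fun (degen i x) = degen i (nerve_map_fun x).
Proof.
case: x => v p; rewrite /= /nerve_degen; congr existT.
by apply: tail_map_degen; rewrite -ltnS ltn_ord.
Qed.

Definition nerve_map : smap (nerve C) (nerve D) :=
  SMap nerve_map_face nerve_map_degen.

End NerveMap.
Local Open Scope group_scope.

Record sgroup := SGroup {
  sg_obj :> nat -> groupType;
  sg_face : forall n, 'I_n.+2 -> {multiplicative sg_obj n.+1 -> sg_obj n};
  sg_degen : forall n, 'I_n.+1 -> {multiplicative sg_obj n -> sg_obj n.+1};
  sg_ids : @simplicial_identities (fun n => sg_obj n) sg_face sg_degen }.

Record sghom (G H : sgroup) := SGHom {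
  sgh_fun :> forall n, {multiplicative G n -> H n};
  sgh_face : forall n i (g : G n.+1),
    sgh_fun n (sg_face G i g) = sg_face H i (sgh_fun n.+1 g);
  sgh_degen : forall n i (g : G n),
    sgh_fun n.+1 (sg_degen G i g) = sg_degen H i (sgh_fun n g) }.

Definition sg_sset (G : sgroup) : sset := SSet (sg_ids G).

Definition sg_smap (G H : sgroup) (f : sghom G H) : smap (sg_sset G) (sg_sset H) :=
  @SMap (sg_sset G) (sg_sset H) (fun n => f n) (@sgh_face _ _ f) (@sgh_degen _ _ f).

Lemma mulhom1 (G H : groupType) (f : {multiplicative G -> H}) : f 1 = 1.
Proof. by apply: (mulgI (f 1)); rewrite -gmulfM !mulg1. Qed.

Lemma mulhomV (G H : groupType) (f : {multiplicative G -> H}) x : f x^-1 = (f x)^-1.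
Proof. by apply: (mulgI (f x)); rewrite -gmulfM !mulgV mulhom1. Qed.

Definition onecat (H : groupType) : smallcat :=
  @SmallCat unit (fun _ _ => H) (fun=> 1) (fun _ _ _ b a => b * a)
    (fun _ _ => @mul1g H) (fun _ _ => @mulg1 H) (fun _ _ _ _ => @mulgA H).

Definition onecat_fun (H K : groupType) (f : {multiplicative H -> K}) :
    catfun (onecat H) (onecat K) :=
  @CatFun (onecat H) (onecat K) id (fun _ _ => f)
    (fun=> mulhom1 f) (fun _ _ _ g h => gmulfM (s := f) g h).

Definition Wgroup (H : groupType) : sset := nerve (onecat H).

Definition Wgroup_map (H K : groupType) (f : {multiplicative H -> K}) :
  smap (Wgroup H) (Wgroup K) := nerve_map (onecat_fun f).

Lemma Wgroup_map_comp (H K L M : groupType)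
    (f : {multiplicative H -> K}) (g : {multiplicative K -> M})
    (f' : {multiplicative H -> L}) (g' : {multiplicative L -> M}) :
  (forall x, g (f x) = g' (f' x)) ->
  forall n x, Wgroup_map g n (Wgroup_map f n x) = Wgroup_map g' n (Wgroup_map f' n x).
Proof.
move=> e n [v p]; congr existT.
elim: n v p => [|n ih] v // [w [a p]].
have ea : g (f a) = g' (f' a) :> @arr (onecat M) v w by exact: e.
exact: (etrans (tcons_eq _ ea) (f_equal (tcons _) (ih w p))).
Qed.

Lemma Wgroup_map_id (H K : groupType)
    (f : {multiplicative H -> K}) (g : {multiplicative K -> H}) :
  cancel f g ->
  forall n, cancel (Wgroup_map f n) (Wgroup_map g n).
Proof.
move=> e n [v p]; congr existT.
elim: n v p => [|n ih] v; first by case.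
case=> w [a p].
have ea : g (f a) = a :> @arr (onecat H) v w by exact: e.
exact: (etrans (tcons_eq _ ea) (f_equal (tcons _) (ih w p))).
Qed.

Section Wbar.
Variable G : sgroup.

Lemma Wbisset_ids m : simplicial_identities
  (fun n (i : 'I_n.+2) => Wgroup_map (sg_face G i) m)
  (fun n (i : 'I_n.+1) => Wgroup_map (sg_degen G i) m).
Proof.
have [h1 h2 h3 h4 h5] := sg_ids G.
rewrite /simplicial_identities; cbv zeta; split=> [n i j x h|n i j x h|n j x h|n i j x h|n i j x h].
- by apply: Wgroup_map_comp => y; exact: h1.
- by apply: Wgroup_map_comp => y; exact: h2.
- by split; apply: Wgroup_map_id => y; have [] := h3 n j y h.
- by apply: Wgroup_map_comp => y; exact: h4.
- by apply: Wgroup_map_comp => y; exact: h5.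
Qed.

Definition Wbisset : bisset := @BiSSet (fun n => Wgroup (G n)) _ _ Wbisset_ids.

Definition Wbar : psset :=
  @PSSet (diag Wbisset) (existT (tail (C := onecat (G 0%N)) 0) tt tt).

End Wbar.

Section WbarMap.
Variables (G H : sgroup) (f : sghom G H).

Definition Wbar_fun n (x : Wbar G n) : Wbar H n := Wgroup_map (f n) n x.

Lemma Wbar_fun_face n i (x : Wbar G n.+1) :
  Wbar_fun (face i x) = face i (Wbar_fun x).
Proof.
apply: (etrans (@smap_face _ _ (Wgroup_map (f n)) _ i _)).
by apply: (f_equal (@nerve_face _ _ i)); apply: Wgroup_map_comp => g; exact: sgh_face.
Qed.

Lemma Wbar_fun_degen n i (x : Wbar G n) :
  Wbar_fun (degen i x) = degen i (Wbar_fun x).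
Proof.
apply: (etrans (@smap_degen _ _ (Wgroup_map (f n.+1)) _ i _)).
by apply: (f_equal (@nerve_degen _ _ i)); apply: Wgroup_map_comp => g; exact: sgh_degen.
Qed.

Definition Wbar_map : psmap (Wbar G) (Wbar H) :=
  @PSMap (Wbar G) (Wbar H) (SMap Wbar_fun_face Wbar_fun_degen) erefl.

End WbarMap.

Inductive base :=
  | Complex of ordered_complex
  | Category of smallcat.

Definition vertices (A : base) : Type :=
  match A with Complex K => cpx_vtx K | Category C => C end.

Definition sset_of (A : base) : sset :=
  match A with Complex K => cpx_sset K | Category C => nerve C end.

Definition vertex (A : base) : forall n, sset_of A n -> 'I_n.+1 -> vertices A :=
  match A with
  | Complex K => fun n x i => sval x i
  | Category C => fun n x i => nerve_vertex x i
  end.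

Definition vertex_simplex (A : base) : vertices A -> sset_of A 0%N :=
  match A with
  | Complex K => fun a => cpx_vertex a
  | Category C => fun a => existT (tail (C := C) 0) a tt
  end.

Definition psset_of (A : base) (a0 : vertices A) : psset := PSSet (vertex_simplex a0).

Definition adjacent (A : base) : vertices A -> vertices A -> Prop :=
  match A with
  | Complex K => fun v w => v != w /\ is_simplex [fset v; w]%fset
  | Category C => fun v w => inhabited (arr v w) \/ inhabited (arr w v)
  end.

Definition base_map (A B : base) : Type :=
  match A, B with
  | Complex K, Complex L => complex_map K L
  | Category C, Category D => catfun C D
  | _, _ => void
  end.

Definition vertices_map (A B : base) : base_map A B -> vertices A -> vertices B :=
  match A, B with
  | Complex K, Complex L => fun f => f
  | Category C, Category D => fun f => f
  | _, _ => fun f => match f with end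
  end.

Definition sset_of_map (A B : base) : base_map A B -> smap (sset_of A) (sset_of B) :=
  match A, B with
  | Complex K, Complex L => fun f => cpx_sset_map f
  | Category C, Category D => fun f => nerve_map f
  | _, _ => fun f => match f with end
  end.

Lemma tail_vertex0 (C : smallcat) n (v : C) (p : tail n v) : tail_vertex 0 p = v.
Proof. by case: n p. Qed.

Lemma tail_vertex_face (C : smallcat) n i (v : C) (p : tail n.+1 v) j :
  (i <= n)%N -> (j <= n)%N ->
  tail_vertex j (tail_face i p) = tail_vertex (bump i.+1 j) p.
Proof.
elim: n i j v p => [|n ih] i [|j] v; rewrite // ?tail_vertex0 //.
case=> w [a q]; case: i => [|i] hi hj.
  by case: q => w' [b r] /=; rewrite /bump.
by rewrite [LHS](ih i j w q hi hj) /bump !ltnS; case: ltnP.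
Qed.

Lemma tail_vertex_degen (C : smallcat) n i (v : C) (p : tail n v) j :
  (i <= n)%N -> (j <= n.+1)%N ->
  tail_vertex j (tail_degen i p) = tail_vertex (unbump i j) p.
Proof.
elim: n i j v p => [|n ih] i j v p hi hj.
  by case: j hj => [|[|]].
case: i j hi hj => [|i] [|j] hi hj //.
  by rewrite /unbump /= subn1.
case: p => w [a q]; rewrite [LHS](ih i j w q hi hj).
rewrite /unbump ltnS; case: ltnP => h; last by rewrite !subn0.
by rewrite !subn1; case: j h {hj}.
Qed.

Lemma vertex_face (A : base) n i (x : sset_of A n.+1) (j : 'I_n.+1) :
  vertex (face i x) j = vertex x (coface i j).
Proof.
case: A x => [K|C] x //=; case: x => v p; rewrite /= /nerve_face.
case: (i : nat) (ltn_ord i) => [|k] h; first by case: p => w [a p].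
by rewrite /= tail_vertex_face // -ltnS.
Qed.

Lemma vertex_degen (A : base) n i (x : sset_of A n) (j : 'I_n.+2) :
  vertex (degen i x) j = vertex x (codegen i j).
Proof.
case: A x => [K|C] x //=; case: x => v p.
by rewrite val_codegen; apply: tail_vertex_degen; rewrite -ltnS.
Qed.

Lemma vertex_sset_of_map (A B : base) (f : base_map A B) n (x : sset_of A n) i :
  vertex (sset_of_map f n x) i = vertices_map f (vertex x i).
Proof.
case: A B f x => [K|C] [L|D] //= f [v p] //=.
move: (i : nat) => {i} i; elim: n i v p => [|n ih] [|i] v p //=; case: p => w [a p] //=.
Qed.

Lemma sset_of_map_vertex (A B : base) (f : base_map A B) (a : vertices A) :
  sset_of_map f 0%N (vertex_simplex a) = vertex_simplex (vertices_map f a).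
Proof. by case: A B f a => [K|C] [L|D] //= f a; exact: cpx_obj_eq. Qed.

Lemma tail_vertex_arr (C : smallcat) n i j (v : C) (p : tail n v) :
  (i <= j <= n)%N -> inhabited (arr (tail_vertex i p) (tail_vertex j p)).
Proof.
elim: n i j v p => [|n ih] i j v p h; first by exists; exact: idm.
case: i j h => [|i] [|j] h //; first by exists; exact: idm.
- case: p => w [a q]; have [b] := ih 0%N j w q h.
  by rewrite tail_vertex0 in b; exists; exact: compm b a.
- by case: p => w [a q]; exact: ih i j w q h.
Qed.

Lemma vertex_adjacent (A : base) n (x : sset_of A n) i j :
  vertex x i = vertex x j \/ adjacent (vertex x i) (vertex x j).
Proof.
case: A x => [K|C] x /=.
- case: eqVneq => [|ne]; [by left|right; split=> //].
  case: x ne => v [_ vK] /= ne; apply: is_simplex_sub vK.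
    apply/fsubsetP => b; rewrite !inE => /orP[]/eqP->; exact: in_imfset.
  by apply/fset0Pn; exists (v i); rewrite !inE eqxx.
- right; case: x => v p /=; have [h|h] := leqP i j.
    by left; apply: tail_vertex_arr; rewrite h -ltnS ltn_ord.
  by right; apply: tail_vertex_arr; rewrite (ltnW h) -ltnS ltn_ord.
Qed.
Section TwistedProduct.
Variables (A : base) (X : sset) (d e : vertices A -> smap X X).
Hypothesis dC : forall v w, adjacent v w ->
  forall n (y : X n), d v n (d w n y) = d w n (d v n y).
Hypothesis dK : forall v n, cancel (d v n) (e v n).
Hypothesis eK : forall v n, cancel (e v n) (d v n).

Definition twprod_obj n : Type := (X n * sset_of A n)%type.

Definition twprod_face n (i : 'I_n.+2) (p : twprod_obj n.+1) : twprod_obj n :=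
  (d (vertex p.2 i) n (face i p.1), face i p.2).

Definition twprod_degen n (i : 'I_n.+1) (p : twprod_obj n) : twprod_obj n.+1 :=
  (e (vertex p.2 i) n.+1 (degen i p.1), degen i p.2).

Lemma twprod_dd m (x : sset_of A m) i j n (y : X n) :
  d (vertex x i) n (d (vertex x j) n y) = d (vertex x j) n (d (vertex x i) n y).
Proof. by have [->|h] := vertex_adjacent x i j; last exact: dC. Qed.

Lemma twprod_de m (x : sset_of A m) i j n (y : X n) :
  d (vertex x i) n (e (vertex x j) n y) = e (vertex x j) n (d (vertex x i) n y).
Proof. by apply: (can_inj (@dK (vertex x j) n)); rewrite eK -twprod_dd eK. Qed.

Lemma twprod_ee m (x : sset_of A m) i j n (y : X n) :
  e (vertex x i) n (e (vertex x j) n y) = e (vertex x j) n (e (vertex x i) n y).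
Proof.
by apply: (can_inj (@dK (vertex x j) n)); rewrite eK twprod_de eK.
Qed.

Lemma twprod_ids : simplicial_identities twprod_face twprod_degen.
Proof.
have [X1 X2 X3 X4 X5] := sset_ids X.
have [S1 S2 S3 S4 S5] := sset_ids (sset_of A).
rewrite /simplicial_identities; cbv zeta.
split=> [n i j [y x] h|n i j [y x] h|n j [y x] h|n i j [y x] h|n i j [y x] h];
  rewrite /twprod_face /twprod_degen /=.
- congr pair; last exact: S1.
  rewrite !smap_face !vertex_face X1 // twprod_dd.
  have -> : coface (inord j.+1) (inord i) = inord i :> 'I_n.+3.
    by apply: ord_inj; rewrite ?val_coface ?val_codegen /bump /unbump !inordK; lia.
  have -> : coface (inord i) (inord j) = inord j.+1 :> 'I_n.+3.
    by apply: ord_inj; rewrite ?val_coface ?val_codegen /bump /unbump !inordK; lia.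
  by [].
- congr pair; last exact: S2.
  rewrite -smap_face -smap_degen vertex_face vertex_degen X2 // twprod_de.
  have -> : codegen (inord j.+1) (inord i) = inord i :> 'I_n.+2.
    by apply: ord_inj; rewrite ?val_coface ?val_codegen /bump /unbump !inordK; lia.
  have -> : coface (inord i) (inord j) = inord j.+1 :> 'I_n.+2.
    by apply: ord_inj; rewrite ?val_coface ?val_codegen /bump /unbump !inordK; lia.
  by [].
- have [e1 e2] := S3 n j x h; have [f1 f2] := X3 n j y h.
  split; congr pair => //.
    rewrite -smap_face f1 vertex_degen.
    have -> : codegen (inord j) (inord j) = inord j :> 'I_n.+1.
      by apply: ord_inj; rewrite ?val_coface ?val_codegen /bump /unbump !inordK; lia.
    exact: eK.
  rewrite -smap_face f2 vertex_degen.
  have -> : codegen (inord j) (inord j.+1) = inord j :> 'I_n.+1.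
    by apply: ord_inj; rewrite ?val_coface ?val_codegen /bump /unbump !inordK; lia.
  exact: eK.
- congr pair; last exact: S4.
  rewrite -smap_face -smap_degen vertex_face vertex_degen X4 // twprod_de.
  have -> : codegen (inord j) (inord i.+1) = inord i :> 'I_n.+2.
    by apply: ord_inj; rewrite ?val_coface ?val_codegen /bump /unbump !inordK; lia.
  have -> : coface (inord i) (inord j) = inord j :> 'I_n.+2.
    by apply: ord_inj; rewrite ?val_coface ?val_codegen /bump /unbump !inordK; lia.
  by [].
- congr pair; last exact: S5.
  rewrite !smap_degen !vertex_degen X5 // twprod_ee.
  have -> : codegen (inord j) (inord i) = inord i :> 'I_n.+1.
    by apply: ord_inj; rewrite ?val_coface ?val_codegen /bump /unbump !inordK; lia.
  have -> : codegen (inord i) (inord j.+1) = inord j :> 'I_n.+1.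
    by apply: ord_inj; rewrite ?val_coface ?val_codegen /bump /unbump !inordK; lia.
  by [].
Qed.

Definition twprod : sset := SSet twprod_ids.

End TwistedProduct.

Record twist (A : base) (G : sgroup) := Twist {
  tw :> vertices A -> sghom G G;
  tw_comm : forall v w, adjacent v w ->
    forall n (g : G n), tw v n (tw w n g) = tw w n (tw v n g) }.

Definition sg_automorphism (G : sgroup) (f : sghom G G) : Prop :=
  exists f' : sghom G G, forall n, cancel (f n) (f' n) /\ cancel (f' n) (f n).

Definition nonsingular (A : base) (G : sgroup) (delta : twist A G) : Prop :=
  forall v, sg_automorphism (delta v).

(* The inverse of delta_v, which is unique. *)
Definition tw_inv A G (delta : twist A G) (ns : nonsingular delta)
  (v : vertices A) : sghom G G := sval (cid (ns v)).

Record ps_twist (A : base) (Y : psset) := PSTwist {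
  ptw :> vertices A -> psmap Y Y;
  ptw_comm : forall v w, adjacent v w ->
    forall n (y : Y n), ptw v n (ptw w n y) = ptw w n (ptw v n y) }.

Definition ps_isomorphism (Y : psset) (f : psmap Y Y) : Prop :=
  exists f' : psmap Y Y, forall n, cancel (f n) (f' n) /\ cancel (f' n) (f n).

Definition ps_nonsingular (A : base) (Y : psset) (delta : ps_twist A Y) : Prop :=
  forall v, ps_isomorphism (delta v).

Definition ptw_inv A Y (delta : ps_twist A Y) (ns : ps_nonsingular delta)
  (v : vertices A) : psmap Y Y := sval (cid (ns v)).

Section TwInv.
Variables (A : base) (G : sgroup) (delta : twist A G) (ns : nonsingular delta).
Variables (Y : psset) (delta' : ps_twist A Y) (ns' : ps_nonsingular delta').

Lemma tw_invK v n : cancel (delta v n) (tw_inv ns v n).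
Proof. exact: (svalP (cid (ns v)) n).1. Qed.

Lemma tw_invVK v n : cancel (tw_inv ns v n) (delta v n).
Proof. exact: (svalP (cid (ns v)) n).2. Qed.

Lemma ptw_invK v n : cancel (delta' v n) (ptw_inv ns' v n).
Proof. exact: (svalP (cid (ns' v)) n).1. Qed.

Lemma ptw_invVK v n : cancel (ptw_inv ns' v n) (delta' v n).
Proof. exact: (svalP (cid (ns' v)) n).2. Qed.

End TwInv.

Section Smash.
Variables (A : base) (a0 : vertices A) (Y : psset) (delta : ps_twist A Y).
Hypothesis ns : ps_nonsingular delta.

Definition tw_times : sset :=
  twprod (@ptw_comm _ _ delta) (ptw_invK ns) (ptw_invVK ns).

Definition smash_mem n (p : tw_times n) : Prop :=
  p.2 = pt (psset_of a0) n \/ p.1 = pt Y n.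

Lemma smash_mem_face n i (p : tw_times n.+1) : smash_mem p -> smash_mem (face i p).
Proof.
case: p => y x [/= ->|/= ->].
  by left; exact: (face_pt (psset_of a0)).
by right; rewrite /= face_pt psmapE.
Qed.

Lemma smash_mem_degen n i (p : tw_times n) : smash_mem p -> smash_mem (degen i p).
Proof.
case: p => y x [/= ->|/= ->].
  by left; exact: (@degen_pt (psset_of a0)).
by right; rewrite /= degen_pt; exact: psmapE.
Qed.

Definition smash_sub : subsset tw_times := SubSSet smash_mem_face smash_mem_degen.

Definition tw_smash : sset := collapse smash_sub.

End Smash.

(* The group generated by the symbols g_x (g in G, x in X), subject to
   g_x h_x = (gh)_x, 1_x = 1 and g_x0 = 1: it is the quotient of the free product
   of copies G_x of G by the relation G_x0 = 1. *)

Section FreeProduct.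
Variables (G : groupType) (X : Type) (x0 : X).

Definition fp_word := {classic seq (G * X)}.

Inductive fp_step : fp_word -> fp_word -> Prop :=
  | FpMul (u v : seq (G * X)) g h x :
      fp_step (u ++ [:: (g, x); (h, x)] ++ v) (u ++ (g * h, x) :: v)
  | FpOne (u v : seq (G * X)) x : fp_step (u ++ (1, x) :: v) (u ++ v)
  | FpPt (u v : seq (G * X)) g : fp_step (u ++ (g, x0) :: v) (u ++ v).

Definition free_prod : Type := gen_quot fp_step.

HB.instance Definition _ := Choice.copy free_prod (gen_quot fp_step).

Let cl := clos_refl_sym_trans fp_word fp_step.
Let fpi (w : seq (G * X)) : free_prod := gen_pi fp_step w.

Lemma fp_step_cat (a b u v : seq (G * X)) :
  fp_step u v -> fp_step (a ++ u ++ b) (a ++ v ++ b).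
Proof.
case=> {u v} [u v g h x|u v x|u v g]; rewrite -!catA !(catA a u);
[exact: FpMul|exact: FpOne|exact: FpPt].
Qed.

Lemma fp_cl_cat (a b u v : seq (G * X)) : cl u v -> cl (a ++ u ++ b) (a ++ v ++ b).
Proof.
elim=> {u v} [u v h|u|u v _ h|u v w _ h _ h'].
- exact/rst_step/fp_step_cat.
- exact: rst_refl.
- exact: rst_sym.
- exact: rst_trans h h'.
Qed.

Lemma fpi_repr (w : seq (G * X)) : cl (repr (fpi w)) w.
Proof. by apply/gen_piP; exact: reprK. Qed.

Definition fp_mul (p q : free_prod) : free_prod := fpi (repr p ++ repr q).

Lemma fp_mulE u v : fp_mul (fpi u) (fpi v) = fpi (u ++ v).
Proof.
apply/gen_piP; apply: (@rst_trans _ _ _ (u ++ repr (fpi v))).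
  exact: (@fp_cl_cat [::] (repr (fpi v)) _ _ (fpi_repr u)).
by have := @fp_cl_cat u [::] _ _ (fpi_repr v); rewrite !cats0.
Qed.

Definition fp_winv (w : seq (G * X)) : seq (G * X) := rev [seq (p.1^-1, p.2) | p <- w].

Lemma fp_winvK : involutive fp_winv.
Proof.
move=> w; rewrite /fp_winv map_rev revK -map_comp -[RHS]map_id.
by apply: eq_map => -[g x] /=; rewrite invgK.
Qed.

Lemma fp_winv_cat u v : fp_winv (u ++ v) = fp_winv v ++ fp_winv u.
Proof. by rewrite /fp_winv map_cat rev_cat. Qed.

Definition fp_inv (p : free_prod) : free_prod := fpi (fp_winv (repr p)).

Lemma fp_cl_inv u v : cl u v -> cl (fp_winv u) (fp_winv v).
Proof.
elim=> {u v} [u v h|u|u v _ h|u v w _ h _ h'].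
- apply: rst_step; case: h => {u v} [u v g h x|u v x|u v g];
    rewrite !fp_winv_cat -1?[_ :: v]cat1s ?fp_winv_cat -?catA /=.
  + by rewrite invgM; exact: (@FpMul (fp_winv v) (fp_winv u)).
  + by rewrite invg1; exact: (@FpOne (fp_winv v) (fp_winv u)).
  + exact: (@FpPt (fp_winv v) (fp_winv u)).
- exact: rst_refl.
- exact: rst_sym.
- exact: rst_trans h h'.
Qed.

Lemma fp_invE u : fp_inv (fpi u) = fpi (fp_winv u).
Proof. apply/gen_piP; exact/fp_cl_inv/fpi_repr. Qed.

Lemma fp_mulA : associative fp_mul.
Proof.
elim/gen_quotW=> u; elim/gen_quotW=> v; elim/gen_quotW=> w.
by rewrite -!/(fpi _) !fp_mulE catA.
Qed.

Lemma fp_mul1 : left_id (fpi [::]) fp_mul.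
Proof. by elim/gen_quotW=> u; rewrite -!/(fpi _) fp_mulE. Qed.

Lemma fp_mulr1 : right_id (fpi [::]) fp_mul.
Proof. by elim/gen_quotW=> u; rewrite -!/(fpi _) fp_mulE cats0. Qed.

Lemma fp_winv_l u : cl (fp_winv u ++ u) [::].
Proof.
elim: u => [|[g x] u ih]; first exact: rst_refl.
rewrite -cat1s fp_winv_cat -catA.
apply: rst_trans ih; apply: (@rst_trans _ _ _ (fp_winv u ++ (1, x) :: u)).
  by apply: rst_step; rewrite -(mulVg g); exact: (@FpMul (fp_winv u) u).
by apply: rst_step; exact: FpOne.
Qed.

Lemma fp_mulV : left_inverse (fpi [::]) fp_inv fp_mul.
Proof.
elim/gen_quotW=> u; rewrite -!/(fpi _) fp_invE fp_mulE.
by apply/gen_piP; exact: fp_winv_l.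
Qed.

Lemma fp_mulrV : right_inverse (fpi [::]) fp_inv fp_mul.
Proof.
elim/gen_quotW=> u; rewrite -!/(fpi _) fp_invE fp_mulE.
by apply/gen_piP; have := fp_winv_l (fp_winv u); rewrite fp_winvK.
Qed.

HB.instance Definition _ :=
  isGroup.Build free_prod fp_mulA fp_mul1 fp_mulr1 fp_mulV fp_mulrV.

Definition fp_in (x : X) (g : G) : free_prod := fpi [:: (g, x)].

Lemma fp_inM x : {morph fp_in x : g h / g * h}.
Proof.
move=> g h; rewrite /fp_in [RHS]fp_mulE; apply/gen_piP/rst_sym/rst_step.
exact: (@FpMul [::] [::]).
Qed.

HB.instance Definition _ x := isMultiplicative.Build G free_prod (fp_in x) (@fp_inM x).

Lemma fp_in_pt g : fp_in x0 g = 1.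
Proof. by apply/gen_piP/rst_step; exact: (@FpPt [::] [::]). Qed.

Lemma fp_ind (P : free_prod -> Prop) :
  P 1 -> (forall x g u, P u -> P (fp_in x g * u)) -> forall u, P u.
Proof.
move=> P1 PM; elim/gen_quotW; elim=> [|[g x] w ih] //.
by have := PM x g _ ih; rewrite [_ * _]fp_mulE.
Qed.

Lemma fp_ext (H : groupType) (f f' : {multiplicative free_prod -> H}) :
  (forall x g, f (fp_in x g) = f' (fp_in x g)) -> f =1 f'.
Proof.
move=> e; elim/fp_ind => [|x g u ih]; first by rewrite !mulhom1.
by rewrite !gmulfM e ih.
Qed.

Section Lift.
Variables (H : groupType) (f : X -> {multiplicative G -> H}).
Hypothesis f_pt : forall g, f x0 g = 1.

Definition fp_eval (w : seq (G * X)) : H := \prod_(p <- w) f p.2 p.1.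

Definition fp_lift : free_prod -> H := gen_lift (fp_eval : fp_word -> H).

Lemma fp_lift_pi w : fp_lift (fpi w) = fp_eval w.
Proof.
apply: gen_lift_pi => _ _ [u v g h x|u v x|u v g];
  by rewrite /fp_eval !big_cat ?big_cons /= ?big_nil ?gmulfM ?mulhom1 ?f_pt
     ?mul1g ?mulgA ?mulg1.
Qed.

Lemma fp_liftM : {morph fp_lift : u v / u * v}.
Proof.
elim/gen_quotW=> u; elim/gen_quotW=> v; rewrite -!/(fpi _).
by rewrite [_ * _ in LHS]fp_mulE !fp_lift_pi /fp_eval big_cat.
Qed.

Lemma fp_lift_in x g : fp_lift (fp_in x g) = f x g.
Proof. by rewrite fp_lift_pi /fp_eval big_seq1. Qed.

Definition fp_hom : {multiplicative free_prod -> H} :=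
  HB.pack fp_lift (isMultiplicative.Build free_prod H fp_lift fp_liftM).

Lemma fp_homE x g : fp_hom (fp_in x g) = f x g.
Proof. exact: fp_lift_in. Qed.

End Lift.

End FreeProduct.
Section TwistedFree.
Variables (A : base) (a0 : vertices A) (G : sgroup) (delta : twist A G).
Hypothesis ns : nonsingular delta.

Definition FG_obj n : groupType := free_prod (G n) (pt (psset_of a0) n).

Definition FG_in n (x : sset_of A n) : {multiplicative G n -> FG_obj n} :=
  fp_in (pt (psset_of a0) n) x.

Lemma FG_in_pt n x g : x = pt (psset_of a0) n -> FG_in x g = 1.
Proof. by move=> ->; exact: fp_in_pt. Qed.

Definition FG_face_on n (i : 'I_n.+2) (x : sset_of A n.+1) :
    {multiplicative G n.+1 -> FG_obj n} :=
  FG_in (face i x) \o (delta (vertex x i) n \o sg_face G i).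

Definition FG_degen_on n (i : 'I_n.+1) (x : sset_of A n) :
    {multiplicative G n -> FG_obj n.+1} :=
  FG_in (degen i x) \o (tw_inv ns (vertex x i) n.+1 \o sg_degen G i).

Lemma FG_face_pt n (i : 'I_n.+2) g : FG_face_on i (pt (psset_of a0) n.+1) g = 1.
Proof. by apply: FG_in_pt; exact: (@face_pt (psset_of a0)). Qed.

Lemma FG_degen_pt n (i : 'I_n.+1) g : FG_degen_on i (pt (psset_of a0) n) g = 1.
Proof. by apply: FG_in_pt; exact: (@degen_pt (psset_of a0)). Qed.

Definition FG_face n (i : 'I_n.+2) : {multiplicative FG_obj n.+1 -> FG_obj n} :=
  fp_hom (FG_face_pt i).

Definition FG_degen n (i : 'I_n.+1) : {multiplicative FG_obj n -> FG_obj n.+1} :=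
  fp_hom (FG_degen_pt i).

Lemma FG_face_in n i x g :
  FG_face i (FG_in x g) = FG_in (face i x) (delta (vertex x i) n (sg_face G i g)).
Proof. exact: fp_homE. Qed.

Lemma FG_degen_in n i x g : FG_degen i (FG_in x g) =
  FG_in (degen i x) (tw_inv ns (vertex x i) n.+1 (sg_degen G i g)).
Proof. exact: fp_homE. Qed.

Let T : sset := @twprod A (sg_sset G) (fun v => sg_smap (delta v))
  (fun v => sg_smap (tw_inv ns v)) (@tw_comm _ _ delta) (tw_invK ns) (tw_invVK ns).

Let pin n (p : T n) : FG_obj n := FG_in p.2 p.1.

Let pin_face n i (p : T n.+1) : FG_face i (pin p) = pin (face i p).
Proof. exact: FG_face_in. Qed.

Let pin_degen n i (p : T n) : FG_degen i (pin p) = pin (degen i p).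
Proof. exact: FG_degen_in. Qed.

Lemma FG_ids : @simplicial_identities (fun n => FG_obj n) FG_face FG_degen.
Proof.
have [T1 T2 T3 T4 T5] := sset_ids T.
rewrite /simplicial_identities; cbv zeta.
split=> [n i j u h|n i j u h|n j u h|n i j u h|n i j u h].
- apply: (fp_ext (f := FG_face _ \o FG_face _) (f' := FG_face _ \o FG_face _)).
  by move=> x g; have := f_equal (@pin n) (T1 n i j (g, x) h); rewrite -!pin_face.
- apply: (fp_ext (f := FG_face _ \o FG_degen _) (f' := FG_degen _ \o FG_face _)).
  move=> x g; have := f_equal (@pin n.+1) (T2 n i j (g, x) h).
  by rewrite -pin_face -!pin_degen -pin_face.
- split.
    apply: (fp_ext (f := FG_face _ \o FG_degen _) (f' := idfun)) => x g.
    have := f_equal (@pin n) (T3 n j (g, x) h).1.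
    by rewrite -pin_face -pin_degen.
  apply: (fp_ext (f := FG_face _ \o FG_degen _) (f' := idfun)) => x g.
  have := f_equal (@pin n) (T3 n j (g, x) h).2.
  by rewrite -pin_face -pin_degen.
- apply: (fp_ext (f := FG_face _ \o FG_degen _) (f' := FG_degen _ \o FG_face _)).
  move=> x g; have := f_equal (@pin n.+1) (T4 n i j (g, x) h).
  by rewrite -pin_face -!pin_degen -pin_face.
- apply: (fp_ext (f := FG_degen _ \o FG_degen _) (f' := FG_degen _ \o FG_degen _)).
  by move=> x g; have := f_equal (@pin n.+2) (T5 n i j (g, x) h); rewrite -!pin_degen.
Qed.

Definition FG : sgroup := SGroup FG_ids.

End TwistedFree.

Section WbarTwist.
Variables (A : base) (G : sgroup) (delta : twist A G).

Lemma Wbar_twist_comm v w : adjacent v w -> forall n (y : Wbar G n),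
  Wbar_map (delta v) n (Wbar_map (delta w) n y) =
  Wbar_map (delta w) n (Wbar_map (delta v) n y).
Proof. by move=> h n y; apply: Wgroup_map_comp => g; exact: tw_comm. Qed.

Definition Wbar_twist : ps_twist A (Wbar G) :=
  @PSTwist A (Wbar G) (fun v => Wbar_map (delta v)) Wbar_twist_comm.

Lemma Wbar_nonsingular : nonsingular delta -> ps_nonsingular Wbar_twist.
Proof.
move=> ns v; have [f hf] := ns v; exists (Wbar_map f) => n.
by split; apply: Wgroup_map_id; have [] := hf n.
Qed.

End WbarTwist.

Record datum := Datum {
  dbase : base;
  dpt : vertices dbase;
  dgrp : sgroup;
  dtwist : twist dbase dgrp;
  dns : nonsingular dtwist }.

Record datum_map (D D' : datum) := DatumMap {
  dm_base : base_map (dbase D) (dbase D');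
  dm_pt : vertices_map dm_base (dpt D) = dpt D';
  dm_grp : sghom (dgrp D) (dgrp D');
  dm_twist : forall v n (g : dgrp D n),
    dm_grp n (dtwist D v n g) = dtwist D' (vertices_map dm_base v) n (dm_grp n g) }.

Definition Wsmash (D : datum) : sset :=
  tw_smash (dpt D) (Wbar_nonsingular (dns (d := D))).

Definition dFG (D : datum) : sgroup := FG (dpt D) (dns (d := D)).

Definition WF (D : datum) : sset := Wbar (dFG D).

Section DatumMap.
Variables (D D' : datum) (m : datum_map D D').
Let f := dm_base m.
Let phi := dm_grp m.

Definition dm_sset : psmap (psset_of (dpt D)) (psset_of (dpt D')) :=
  @PSMap (psset_of (dpt D)) (psset_of (dpt D')) (sset_of_map f)
    (etrans (sset_of_map_vertex f (dpt D)) (f_equal (@vertex_simplex _) (dm_pt m))).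

Let TD := tw_times (Wbar_nonsingular (dns (d := D))).
Let TD' := tw_times (Wbar_nonsingular (dns (d := D'))).

Definition dm_times_fun n (p : TD n) : TD' n :=
  (Wbar_map phi n p.1, sset_of_map f n p.2).

Lemma dm_Wbar_twist v n (y : Wbar (dgrp D) n) :
  Wbar_map phi n (Wbar_twist (dtwist D) v n y) =
  Wbar_twist (dtwist D') (vertices_map f v) n (Wbar_map phi n y).
Proof. by apply: Wgroup_map_comp => g; exact: dm_twist. Qed.

Lemma dm_Wbar_inv v n (y : Wbar (dgrp D) n) :
  Wbar_map phi n (ptw_inv (Wbar_nonsingular (dns (d := D))) v n y) =
  ptw_inv (Wbar_nonsingular (dns (d := D'))) (vertices_map f v) n (Wbar_map phi n y).
Proof.
apply: (canRL (@ptw_invK _ _ _ (Wbar_nonsingular (dns (d := D'))) _ n)).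
apply: (etrans (esym (dm_Wbar_twist _ _))); apply: (f_equal (Wbar_map phi n)).
exact: ptw_invVK.
Qed.

Lemma dm_times_face n i (p : TD n.+1) :
  dm_times_fun (face i p) = face i (dm_times_fun p).
Proof.
case: p => y x; apply: f_equal2; last exact: smap_face.
rewrite [in RHS]vertex_sset_of_map; apply: (etrans (dm_Wbar_twist _ _)).
exact: (f_equal (Wbar_map _ n) (smap_face (Wbar_map phi) i y)).
Qed.

Lemma dm_times_degen n i (p : TD n) :
  dm_times_fun (degen i p) = degen i (dm_times_fun p).
Proof.
case: p => y x; apply: f_equal2; last exact: smap_degen.
rewrite [in RHS]vertex_sset_of_map; apply: (etrans (dm_Wbar_inv _ _)).
exact: (f_equal (ptw_inv _ _ n.+1) (smap_degen (Wbar_map phi) i y)).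
Qed.

Definition dm_times : smap TD TD' := SMap dm_times_face dm_times_degen.

Lemma dm_times_sub n (p : TD n) :
  smash_sub (dpt D) (Wbar_nonsingular (dns (d := D))) n p ->
  smash_sub (dpt D') (Wbar_nonsingular (dns (d := D'))) n (dm_times n p).
Proof.
case: p => y x [/= ->|/= ->]; [left|right] => /=.
  exact: (psmapE dm_sset).
exact: (psmapE (Wbar_map phi)).
Qed.

Definition Wsmash_map : smap (Wsmash D) (Wsmash D') := collapse_map dm_times_sub.

Definition dFG_on n (x : sset_of (dbase D) n) : {multiplicative dgrp D n -> dFG D' n} :=
  FG_in (dpt D') (dgrp D') (sset_of_map f n x) \o phi n.

Lemma dFG_on_pt n g : dFG_on (pt (psset_of (dpt D)) n) g = 1.
Proof.
by apply: FG_in_pt; exact: (psmapE dm_sset).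
Qed.

Definition dFG_fun n : {multiplicative dFG D n -> dFG D' n} :=
  fp_hom (@dFG_on_pt n).

Lemma dFG_fun_in n x g :
  dFG_fun n (FG_in (dpt D) (dgrp D) x g) = FG_in (dpt D') (dgrp D') (sset_of_map f n x) (phi n g).
Proof. exact: fp_homE. Qed.

Lemma dm_tw_inv v n (g : dgrp D n) :
  phi n (tw_inv (dns (d := D)) v n g) =
  tw_inv (dns (d := D')) (vertices_map f v) n (phi n g).
Proof.
apply: (canRL (@tw_invK _ _ _ (dns (d := D')) _ n)).
by rewrite -[LHS]dm_twist tw_invVK.
Qed.

Lemma dFG_face n i (u : dFG D n.+1) :
  dFG_fun n (sg_face (dFG D) i u) = sg_face (dFG D') i (dFG_fun n.+1 u).
Proof.
move: u; apply: (fp_ext (f := dFG_fun n \o sg_face (dFG D) i)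
  (f' := sg_face (dFG D') i \o dFG_fun n.+1)) => x g.
apply: (etrans (f_equal (dFG_fun n) (@FG_face_in _ (dpt D) _ (dtwist D) n i x g))).
apply: (etrans (dFG_fun_in _ _)); apply: esym.
apply: (etrans (f_equal (sg_face (dFG D') i) (dFG_fun_in x g))).
apply: (etrans (@FG_face_in _ (dpt D') _ (dtwist D') n i _ _)).
by rewrite smap_face vertex_sset_of_map dm_twist -(sgh_face phi).
Qed.

Lemma dFG_degen n i (u : dFG D n) :
  dFG_fun n.+1 (sg_degen (dFG D) i u) = sg_degen (dFG D') i (dFG_fun n u).
Proof.
move: u; apply: (fp_ext (f := dFG_fun n.+1 \o sg_degen (dFG D) i)
  (f' := sg_degen (dFG D') i \o dFG_fun n)) => x g.
apply: (etrans (f_equal (dFG_fun n.+1) (@FG_degen_in _ (dpt D) _ _ (dns (d := D)) n i x g))).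
apply: (etrans (dFG_fun_in _ _)); apply: esym.
apply: (etrans (f_equal (sg_degen (dFG D') i) (dFG_fun_in x g))).
apply: (etrans (@FG_degen_in _ (dpt D') _ _ (dns (d := D')) n i _ _)).
by rewrite smap_degen vertex_sset_of_map dm_tw_inv -(sgh_degen phi).
Qed.

Definition dFG_map : sghom (dFG D) (dFG D') := SGHom dFG_face dFG_degen.

Definition WF_map : smap (WF D) (WF D') := Wbar_map dFG_map.

End DatumMap.

Local Open Scope ring_scope.
Local Open Scope classical_set_scope.

Section Realization.
Variable R : realType.

Definition std_simplex_set (n : nat) : set 'rV[R]_n.+1 :=
  [set t | (forall i, 0 <= t ord0 i) /\ \sum_i t ord0 i = 1].

Arguments std_simplex_set : clear implicits.

Definition std_simplex (n : nat) : topologicalType := std_simplex_set n.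

Lemma simplex_push_subproof m n (a : 'I_m.+1 -> 'I_n.+1) (t : std_simplex m) :
  (\row_j \sum_(i | a i == j) set_val t ord0 i) \in std_simplex_set n.
Proof.
have [t0 t1] := set_valP t.
apply/mem_set; split=> [j|]; first by rewrite mxE sumr_ge0.
under eq_bigr do rewrite mxE.
by rewrite -t1 [RHS](partition_big a predT).
Qed.

(* the affine map Delta^m -> Delta^n induced by a map of vertices *)
Definition simplex_push m n (a : 'I_m.+1 -> 'I_n.+1) (t : std_simplex m) :
  std_simplex n :=
  exist (fun u => u \in std_simplex_set n) _ (simplex_push_subproof a t).

Section OneSSet.
Variable X : sset.

(* the disjoint union of the X_n x Delta^n, with X_n discrete *)
Definition cells : topologicalType :=
  {s : {n : nat & {classic X n}} & std_simplex (tag s)}.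

Definition cell n (x : X n) (t : std_simplex n) : cells :=
  existT (fun s : {n : nat & {classic X n}} => std_simplex (tag s))
    (existT (fun n => {classic X n}) n x) t.

(* With coface i = lift i skipping i and codegen i repeating i, the generators of
   the equivalence relation are (d_i x, t) ~ (x, d^i t) and (s_i x, t) ~ (x, s^i t). *)
Inductive glue : cells -> cells -> Prop :=
  | GlueFace n i (x : X n.+1) (t : std_simplex n) :
      glue (cell (face i x) t) (cell x (simplex_push (coface i) t))
  | GlueDegen n i (x : X n) (t : std_simplex n.+1) :
      glue (cell (degen i x) t) (cell x (simplex_push (codegen i) t)).

Definition realization : topologicalType := quotient_topology (gen_quot glue).

Definition realize_pi (c : cells) : realization := gen_pi glue c.

End OneSSet.

Section RealizationMap.
Variables (X Y : sset) (f : smap X Y).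

Definition cells_map (c : cells X) : cells Y :=
  cell (f (tag (tag c)) (tagged (tag c))) (tagged c).

Definition realization_map : realization X -> realization Y :=
  gen_lift (fun c => realize_pi (cells_map c)).

Lemma realization_mapE c :
  realization_map (realize_pi c) = realize_pi (cells_map c).
Proof.
apply: gen_lift_pi => _ _ [n i x t|n i x t]; apply/gen_piP/rst_step;
  rewrite /cells_map /= ?smap_face ?smap_degen; [exact: GlueFace|exact: GlueDegen].
Qed.

End RealizationMap.

Definition homotopic (X Y : topologicalType) (f g : X -> Y) : Prop :=
  exists H : X * R -> Y,
    [/\ {within [set: X] `*` `[0, 1], continuous H},
        forall x, H (x, 0) = f x & forall x, H (x, 1) = g x].

Definition homotopy_equivalence (X Y : topologicalType) (f : X -> Y) : Prop :=
  continuous f /\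
  exists g : Y -> X,
    [/\ continuous g, homotopic (g \o f) idfun & homotopic (f \o g) idfun].

End Realization.

Arguments realization_map R {X Y} f.

(* Main.v *)
Require Import Defs.
From Stdlib Require Import Relation_Operators Eqdep_dec.
From mathcomp Require Import all_boot all_order all_algebra.
From mathcomp Require Import all_classical all_reals topology normedtype.
From mathcomp Require Import zify ring lra.

(* Degreewise, theta is the inclusion of the wedge of the nerves of the free factors
   into the nerve of their free product; in particular theta is injective, with image
   the simplices all of whose entries lie in one factor.  Its realization is a homotopy
   equivalence because maps from the image into horn-fillable targets extend: the
   nondegenerate simplices outside the image are matched in pairs (z, d_k z), splitting
   off the last letter of the first entry that leaves the factor of its predecessors.
   Degeneracies of the free product preserve reduced words, so this matching can be
   made on the diagonal, interleaved with the standard matching of the simplices of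
   a product with a prism.  The pairs are attached by horns, in the order of the cost
   (nondegenerate directions plus total word length), the dimension, and k.

   Extending the identity gives a retraction r of the realizations; extending the
   constant homotopy with prescribed ends gives theta r ~ id.  Both targets are sets of
   continuous maps from (simplex) x R, for which horns are filled by an explicit
   retraction. *)

Set Implicit Arguments.
Unset Strict Implicit.
Unset Printing Implicit Defensive.

Import Order.TTheory GRing.Theory Num.Theory.
Import numFieldNormedType.Exports.

Local Open Scope ring_scope.
Local Open Scope classical_set_scope.


(** * Gluing on simplices *)

(** Realizations are compared through an extension property instead of homotopy groups, so neither
    Whitehead's theorem nor a degreewise comparison of bisimplicial sets enters. The obstacle is
    that a splitting of words chosen in each degree does not commute with the faces of the group:
    these may shorten words, identify factors or kill letters. Two facts replace naturality. A face
    never raises the cost, and a face that keeps it has a neighbouring step that is constant in the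
    direction of the group, so that the words can be recovered from it. Degeneracies act letter by
    letter, because degeneracies of the base are injective and the twists are invertible. Hence the
    matching can be built from a few axioms on word length and last factor, and the twist is visible
    only through them. One extension statement with boundary conditions [G] then yields both the
    retraction and the homotopy. *)

Section Simplex.
Variable R : realType.

Definition bary n (t : std_simplex R n) (i : 'I_n.+1) : R := set_val t ord0 i.

Lemma bary_ge0 n (t : std_simplex R n) i : 0 <= bary t i.
Proof. by have [h _] := set_valP t; exact: h. Qed.

Lemma bary_sum n (t : std_simplex R n) : \sum_i bary t i = 1.
Proof. by have [_ h] := set_valP t. Qed.

Lemma bary_inj n (t t' : std_simplex R n) : bary t =1 bary t' -> t = t'.
Proof. by move=> e; apply: val_inj; apply/rowP => i; exact: e. Qed.

Lemma bary_continuous n i : continuous (fun t : std_simplex R n => bary t i).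
Proof.
move=> t; apply: (@continuous_comp _ _ _ (set_val : std_simplex R n -> 'rV[R]_n.+1)
  (fun M : 'rV[R]_n.+1 => M ord0 i)).
  exact: initial_continuous.
exact: coord_continuous.
Qed.

Lemma simplex_continuous (T : topologicalType) n (f : T -> std_simplex R n) :
  (forall i, continuous (fun x => bary (f x) i)) -> continuous f.
Proof.
move=> fc; apply: continuous_comp_initial => x A [P fP PA].
apply: (@filterS _ _ _ [set y | forall i, P ord0 i (bary (f y) i)]).
  by move=> y Py; apply: PA => i j; rewrite (ord1 i); exact: Py.
by apply: filter_forall => i; apply: (fc i x); exact: fP.
Qed.

Lemma mk_simplex_subproof n (b : 'I_n.+1 -> R) :
  (forall i, 0 <= b i) -> \sum_i b i = 1 ->
  (\row_i b i) \in @std_simplex_set R n.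
Proof.
move=> b0 b1; apply/mem_set; split=> [i|]; first by rewrite mxE.
by rewrite -[RHS]b1; apply: eq_bigr => i _; rewrite mxE.
Qed.

Definition mk_simplex n (b : 'I_n.+1 -> R) (b0 : forall i, 0 <= b i)
    (b1 : \sum_i b i = 1) : std_simplex R n :=
  exist (fun u => u \in @std_simplex_set R n) _ (mk_simplex_subproof b0 b1).

Lemma bary_mk n (b : 'I_n.+1 -> R) b0 b1 i : bary (@mk_simplex n b b0 b1) i = b i.
Proof. by rewrite /bary /set_val /= mxE. Qed.

Lemma bary_push m n (a : 'I_m.+1 -> 'I_n.+1) t j :
  bary (simplex_push a t) j = \sum_(i | a i == j) bary t i.
Proof. by rewrite /bary /set_val /= mxE. Qed.

Lemma simplex_push_continuous m n (a : 'I_m.+1 -> 'I_n.+1) :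
  continuous (@simplex_push R m n a).
Proof.
apply: simplex_continuous => j; under eq_fun do rewrite bary_push.
apply: (@continuous_big R) => [|i _]; last exact: bary_continuous.
exact: add_continuous.
Qed.

Lemma simplex_push_comp m n p (a : 'I_n.+1 -> 'I_p.+1) (b : 'I_m.+1 -> 'I_n.+1)
    (t : std_simplex R m) :
  simplex_push a (simplex_push b t) = simplex_push (a \o b) t.
Proof.
apply: bary_inj => j; rewrite !bary_push.
under eq_bigr do rewrite bary_push.
rewrite [RHS](partition_big b (fun i => a i == j)) //.
apply: eq_bigr => i /eqP aij; apply: eq_bigl => k /=.
by apply/eqP/andP => [->|[_ /eqP]]; rewrite ?aij ?eqxx.
Qed.

Lemma simplex_push_id n (t : std_simplex R n) : simplex_push id t = t.
Proof. by apply: bary_inj => j; rewrite bary_push big_pred1_eq. Qed.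

Lemma eq_simplex_push m n (a b : 'I_m.+1 -> 'I_n.+1) (t : std_simplex R m) :
  (forall i, a i = b i :> nat) -> simplex_push a t = simplex_push b t.
Proof. by move=> ab; congr simplex_push; apply/funext => i; exact/val_inj/ab. Qed.

Lemma bary_coface n (i : 'I_n.+2) (t : std_simplex R n) j :
  bary (simplex_push (coface i) t) (lift i j) = bary t j.
Proof.
by rewrite bary_push (big_pred1 j) // => k; rewrite (inj_eq (@lift_inj _ i)).
Qed.

Lemma bary_coface0 n (i : 'I_n.+2) (t : std_simplex R n) :
  bary (simplex_push (coface i) t) i = 0.
Proof.
rewrite bary_push big_pred0 // => k; apply/negbTE.
by rewrite eq_sym neq_lift.
Qed.

(** Merges vertex i with its predecessor, or with vertex 1 when i = 0, where [i.-1] is again 0.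
    Either choice is left inverse to [coface i]. *)
Definition retr n (i : 'I_n.+2) : std_simplex R n.+1 -> std_simplex R n :=
  simplex_push (codegen (inord i.-1)).

Lemma retrK n (i : 'I_n.+2) : cancel (simplex_push (coface i)) (@retr n i).
Proof.
move=> t; rewrite /retr simplex_push_comp -[RHS]simplex_push_id.
apply: eq_simplex_push => k; rewrite /= val_codegen val_coface /unbump /bump.
by move: (ltn_ord i) (ltn_ord k) => ? ?; rewrite inordK; lia.
Qed.

Lemma coface_retr n (i : 'I_n.+2) t :
  bary t i = 0 -> simplex_push (coface i) (@retr n i t) = t.
Proof.
move=> ti; apply: bary_inj => j.
case: (unliftP i j) => [k ->|->]; last by rewrite bary_coface0 ti.
rewrite bary_coface /retr bary_push.
rewrite (bigD1 (lift i k)) /=; last first.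
  apply/eqP/val_inj; rewrite /= val_codegen /= /unbump /bump.
  by move: (ltn_ord i) (ltn_ord k) => ? ?; rewrite inordK; lia.
rewrite big1 ?addr0 // => l /andP[/eqP lk nl].
(* The only other vertex that can be merged into this one is i, and its coordinate vanishes. *)
suff -> : l = i by [].
apply/val_inj; move/eqP: nl => nl; case: (ltngtP l i) => // h; case: nl;
  apply/val_inj; move/(f_equal val): lk; rewrite /= val_codegen /unbump /bump;
  by move: (ltn_ord i) (ltn_ord k) (ltn_ord l) => ? ? ?; rewrite inordK; lia.
Qed.

End Simplex.

Section Glue.

Lemma glue_closed_continuous (T Z : topologicalType) (I : finType)
    (C : I -> set T) (g : I -> T -> Z) (f : T -> Z) :
  (forall i, closed (C i)) -> (forall i, continuous (g i)) ->
  (forall i x, C i x -> f x = g i x) -> (forall x, exists i, C i x) ->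
  continuous f.
Proof.
move=> Cc gc fg cov; apply/continuous_closedP => A cA.
rewrite (_ : _ @^-1` _ = \bigcup_(i in [set: I]) (C i `&` g i @^-1` A)).
  apply: closed_bigcup => [|i _]; first exact: finite_finset.
  by apply: closedI => //; move/continuous_closedP: (gc i); exact.
apply/seteqP; split=> [x Ax|x [i _ [Cx Ax]]]; last by rewrite /preimage /= (fg _ _ Cx).
by have [i Cx] := cov x; exists i => //; split=> //; rewrite /preimage /= -(fg _ _ Cx).
Qed.

(** The pieces [g i] are continuous on all of S, which avoids subspace topologies; in the
    application [retr] makes each face map total. Only the image of [r] has to be covered. *)
Lemma glue_closed_exists (T S Z : topologicalType) (I : finType)
    (C : I -> set S) (g : I -> S -> Z) (r : T -> S) :
  (forall i, closed (C i)) -> (forall i, continuous (g i)) -> continuous r ->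
  (forall i j x, C i x -> C j x -> g i x = g j x) ->
  (forall x, exists i, C i (r x)) ->
  exists2 f : T -> Z, continuous f & forall i x, C i (r x) -> f x = g i (r x).
Proof.
move=> Cc gc rc gg /choice[a ha]; exists (fun x => g (a x) (r x)); last first.
  by move=> i x Cx; exact: gg (ha x) Cx.
apply: (@glue_closed_continuous T Z I (fun i => r @^-1` C i) (fun i => g i \o r)).
- by move=> i; move/continuous_closedP: rc; exact.
- by move=> i x; apply: continuous_comp; [exact: rc|exact: gc].
- by move=> i x Cx; exact: gg (ha x) Cx.
- by move=> x; exists (a x).
Qed.

End Glue.

(* A retraction of the product of a simplex with [R] onto the horn times [R], and for
   [flag = true] onto its union with the two ends [u <= 0] and [1 <= u].  The height
   of [t] above the horn is [hornmin t], pushing in the direction [hornpush] brings it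
   to 0, and [horn_retr] is the central projection from height 2 over [u = 1/2]:
   both [2 - height] and [u - 1/2] are multiplied by [stretch] until the height is 0
   or [|u - 1/2| = 1/2]. *)
Section HornRetraction.
Variables (R : realType) (n : nat) (k : 'I_n.+2) (flag : bool).
Let D := std_simplex R n.+1.

Let other : 'I_n.+2 := lift k ord0.

Let other_neq : other != k.
Proof. by rewrite eq_sym neq_lift. Qed.

Definition hornmin (t : D) : R := \big[Num.min/1]_(j | j != k) bary t j.

(** Each of the n + 1 vertices other than k gives up d and k receives the total. *)
Definition hornpush (t : D) (d : R) (i : 'I_n.+2) : R :=
  if i == k then bary t i + n.+1%:R * d else bary t i - d.

Definition rim (u : R) : R := if flag then Num.min 1 `|2 * u - 1| else 0.

(** Let h be the height. Scaling by s makes s (2 - h) reach 2 at s = 1 / (1 - h / 2), and |u - 1/2|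
    reach 1/2 at s = 1 / |2 u - 1|; the first hit is the inverse of the maximum. Truncating [rim] at
    1 gives s = 1 beyond the ends. *)
Definition stretch (x : D * R) : R := (Num.max (1 - hornmin x.1 / 2) (rim x.2))^-1.

(** The loss of height: h - (2 - s (2 - h)). *)
Definition shift (x : D * R) : R := (stretch x - 1) * (2 - hornmin x.1).

Lemma bary_le1 m (t : std_simplex R m) i : bary t i <= 1.
Proof.
rewrite -(bary_sum t) (bigD1 i) //= lerDl; apply: sumr_ge0 => j _.
exact: bary_ge0.
Qed.

Lemma hornmin_le (t : D) j : j != k -> hornmin t <= bary t j.
Proof. by move=> jk; exact: bigmin_le_cond. Qed.

(** The default 1 of the minimum bounds every coordinate and [other] shows that the range is
    inhabited, so the minimum is a genuine coordinate. *)
Lemma hornmin_attained (t : D) : exists2 j, j != k & hornmin t = bary t j.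
Proof.
have [j jk e] := @eq_bigmin _ R _ 1 other (fun j => j != k) (bary t) other_neq
  (fun i _ => bary_le1 t i).
by exists j.
Qed.

Lemma hornmin_ge0 (t : D) : 0 <= hornmin t.
Proof. by have [j _ ->] := hornmin_attained t; exact: bary_ge0. Qed.

Lemma hornmin_le1 (t : D) : hornmin t <= 1.
Proof. by have [j _ ->] := hornmin_attained t; exact: bary_le1. Qed.

Lemma rim_le1 u : rim u <= 1.
Proof. by rewrite /rim; case: flag; rewrite ?ge_min ?lexx ?ler01. Qed.

Lemma stretch_bounds x :
  [/\ 1 <= stretch x, stretch x * (1 - hornmin x.1 / 2) <= 1 &
      stretch x * rim x.2 <= 1].
Proof.
rewrite /stretch; set m := Num.max _ _.
have h0 := hornmin_ge0 x.1; have h1 := hornmin_le1 x.1; have r1 := rim_le1 x.2.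
have m1 : m <= 1 by rewrite /m ge_max r1 andbT; lra.
have m2 : 1 - hornmin x.1 / 2 <= m by rewrite /m le_max lexx.
have m3 : rim x.2 <= m by rewrite /m le_max lexx orbT.
have m0 : 0 < m by lra.
split; first by rewrite invf_ge1.
  by rewrite mulrC ler_pdivrMr // mul1r.
by rewrite mulrC ler_pdivrMr // mul1r.
Qed.

Lemma shift_ge0 x : 0 <= shift x.
Proof.
have [h _ _] := stretch_bounds x; have h1 := hornmin_le1 x.1.
by rewrite /shift mulr_ge0 //; lra.
Qed.

Lemma shift_le x : shift x <= hornmin x.1.
Proof.
have [_ h _] := stretch_bounds x; rewrite /shift; lra.
Qed.

Lemma hornpush_ge0 t d i : 0 <= d <= hornmin t -> 0 <= hornpush t d i.
Proof.
case/andP=> d0 dh; rewrite /hornpush; case: eqP => [->|/eqP ik].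
  by rewrite addr_ge0 ?bary_ge0 // mulr_ge0.
by rewrite subr_ge0 (le_trans dh) // hornmin_le.
Qed.

Lemma hornpush_sum t d : \sum_i hornpush t d i = 1.
Proof.
rewrite -(bary_sum t) (bigD1 k) //= [RHS](bigD1 k) //=.
rewrite {1}/hornpush eqxx -addrA; congr (_ + _).
rewrite (eq_bigr (fun i => bary t i - d)); last first.
  by move=> i /negbTE ik; rewrite /hornpush ik.
rewrite big_split /= sumrN sumr_const.
have -> : #|(fun i : 'I_n.+2 => i != k)| = n.+1.
  apply: (etrans (eq_card _) (etrans (cardC1 k) _)); last by rewrite card_ord.
  by move=> i; rewrite !inE.
by rewrite -[d *+ _]mulr_natl addrCA subrr addr0.
Qed.

Lemma shift_bounds x : 0 <= shift x <= hornmin x.1.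
Proof. by rewrite shift_ge0 shift_le. Qed.

Definition horn_retr1 (x : D * R) : D :=
  mk_simplex (fun i => hornpush_ge0 i (shift_bounds x)) (hornpush_sum x.1 (shift x)).

Definition horn_retr (x : D * R) : D * R :=
  (horn_retr1 x, 2^-1 + stretch x * (x.2 - 2^-1)).

Lemma hornmin_continuous : continuous hornmin.
Proof.
apply: (@continuous_big R) => [|i _]; last exact: bary_continuous.
exact: min_continuous.
Qed.

Lemma hornmin1_continuous : continuous (fun x : D * R => hornmin x.1).
Proof.
by move=> x; apply: continuous_comp; [exact: cvg_fst|exact: hornmin_continuous].
Qed.

Lemma rim_continuous : continuous rim.
Proof.
rewrite /rim; case: flag => u; last exact: cvg_cst.
apply: (@continuous_min R R (fun=> 1) (fun u => `|2 * u - 1|)).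
  exact: cvg_cst.
apply: cvg_norm; apply: cvgB; last exact: cvg_cst.
by apply: cvgM; [exact: cvg_cst|exact: cvg_id].
Qed.

Lemma stretch_continuous : continuous stretch.
Proof.
move=> x; apply: (@continuousV R _ (fun x => Num.max (1 - hornmin x.1 / 2) (rim x.2))).
  have h1 := hornmin_le1 x.1; apply: lt0r_neq0.
  by rewrite lt_max; apply/orP; left; lra.
apply: (@continuous_max R _ (fun x : D * R => 1 - hornmin x.1 / 2) (fun x => rim x.2)).
  apply: continuousB; first exact: cvg_cst.
  by apply: continuousM; [exact: hornmin1_continuous|exact: cvg_cst].
by apply: continuous_comp; [exact: cvg_snd|exact: rim_continuous].
Qed.

Lemma shift_continuous : continuous shift.
Proof.
move=> x; apply: (@continuousM R _ (fun x => stretch x - 1) (fun x => 2 - hornmin x.1)).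
  by apply: continuousB; [exact: stretch_continuous|exact: cvg_cst].
by apply: continuousB; [exact: cvg_cst|exact: hornmin1_continuous].
Qed.

Lemma horn_retr1_continuous : continuous horn_retr1.
Proof.
apply: simplex_continuous => i; under eq_fun do rewrite bary_mk /hornpush.
have bc : continuous (fun x : D * R => bary x.1 i).
  by move=> x; apply: (@continuous_comp _ _ _ fst (fun t : D => bary t i));
    [exact: cvg_fst|exact: bary_continuous].
case: (i == k) => x; last by apply: cvgB; [exact: bc|exact: shift_continuous].
by apply: cvgD; [exact: bc|apply: cvgM; [exact: cvg_cst|exact: shift_continuous]].
Qed.

Lemma horn_retr_continuous : continuous horn_retr.
Proof.
move=> x; apply: (@cvg_pair _ _ _ _ (nbhs _) (nbhs _)); first exact: horn_retr1_continuous.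
apply: cvgD; first exact: cvg_cst.
apply: cvgM; first exact: stretch_continuous.
by apply: cvgB; [exact: cvg_snd|exact: cvg_cst].
Qed.

Lemma stretch1_retr x : stretch x = 1 -> horn_retr x = x.
Proof.
case: x => t u s1; apply: f_equal2; last by rewrite s1 /=; lra.
apply: bary_inj => i; rewrite bary_mk /hornpush /shift s1 subrr mul0r mulr0.
by rewrite addr0 subr0; case: ifP.
Qed.

Lemma horn_retr_horn x j : j != k -> bary x.1 j = 0 -> horn_retr x = x.
Proof.
move=> jk xj; apply: stretch1_retr; rewrite /stretch.
have -> : hornmin x.1 = 0.
  by apply: le_anti; rewrite hornmin_ge0 -xj hornmin_le.
by rewrite mul0r subr0 max_l ?invr1 // rim_le1.
Qed.

Lemma horn_retr_rim x : flag -> x.2 <= 0 \/ 1 <= x.2 -> horn_retr x = x.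
Proof.
move=> f xu; apply: stretch1_retr; rewrite /stretch /rim f.
have -> : Num.min 1 `|2 * x.2 - 1| = 1.
  apply: min_l; case: xu => h; first by rewrite ler0_norm; lra.
  by rewrite ger0_norm; lra.
by rewrite max_r ?invr1 //; have := hornmin_ge0 x.1; lra.
Qed.

Lemma horn_retr_cover x :
  (exists2 j, j != k & bary (horn_retr x).1 j = 0) \/
  (flag /\ ((horn_retr x).2 <= 0 \/ 1 <= (horn_retr x).2)).
Proof.
have h1 := hornmin_le1 x.1; have h0 := hornmin_ge0 x.1.
(* The larger term of the maximum tells whether the ray meets the horn or an end first. *)
case: (leP (rim x.2) (1 - hornmin x.1 / 2)) => hr.
  left; have [j jk e] := hornmin_attained x.1; exists j => //.
  rewrite bary_mk /hornpush (negbTE jk) -e /shift /stretch max_l //.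
  by field; apply/eqP; lra.
right; move: hr; rewrite /= /stretch; set c := hornmin _ in h1 h0 *.
rewrite /rim; case: flag => hr; last by lra.
split=> //; rewrite max_r ?(ltW hr) //; move: hr.
set u := x.2; set N := `|2 * u - 1|.
(* If N >= 1 the point lies beyond an end already and stays; otherwise the factor 1 / N moves u
   exactly to 0 or 1. *)
have [N1 _|N1 hr] := leP 1 N.
  rewrite invr1 mul1r; move: N1; rewrite /N; case: (leP 0 (2 * u - 1)) => s.
    by rewrite ger0_norm // => h; right; lra.
  by rewrite ltr0_norm // => h; left; lra.
have N0 : 0 < N by lra.
move: N0; rewrite /N; case: (leP 0 (2 * u - 1)) => s.
  rewrite ger0_norm // => s0; right.
  rewrite le_eqVlt; apply/orP; left; apply/eqP; field; apply/eqP; lra.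
rewrite ltr0_norm // => s0; left.
rewrite le_eqVlt; apply/orP; left; apply/eqP; field; apply/eqP; lra.
Qed.

End HornRetraction.

(** * Singular sets and horn filling *)

Section Sing.
Variables (R : realType) (Z : topologicalType).

(** In effect the singular set of the space of maps from [R] to [Z], kept uncurried; using all of
    [R] avoids the subspace [0, 1]. *)
Definition sing_obj n : Type := {f : std_simplex R n * R -> Z | continuous f}.

Lemma sing_pull_subproof m n (a : 'I_m.+1 -> 'I_n.+1) (f : sing_obj n) :
  continuous (fun x : std_simplex R m * R => sval f (simplex_push a x.1, x.2)).
Proof.
move=> x; apply: (@continuous_comp _ _ _
  (fun x : std_simplex R m * R => (simplex_push a x.1, x.2)) (sval f)); last exact: (svalP f).
apply: (@cvg_pair _ _ _ _ (nbhs _) (nbhs _)); last exact: cvg_snd.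
apply: (@continuous_comp _ _ _ fst (@simplex_push R m n a)); first exact: cvg_fst.
exact: simplex_push_continuous.
Qed.

Definition sing_pull m n (a : 'I_m.+1 -> 'I_n.+1) (f : sing_obj n) : sing_obj m :=
  exist _ _ (@sing_pull_subproof m n a f).

Lemma sing_eq n (f g : sing_obj n) : sval f =1 sval g -> f = g.
Proof.
case: f g => [f fc] [g gc] /= /funext e; subst g; congr exist; exact: Prop_irrelevance.
Qed.

Definition sing_face n (i : 'I_n.+2) : sing_obj n.+1 -> sing_obj n := sing_pull (coface i).
Definition sing_degen n (i : 'I_n.+1) : sing_obj n -> sing_obj n.+1 := sing_pull (codegen i).

Lemma sing_ids : simplicial_identities sing_face sing_degen.
Proof.
have solve m n (f : sing_obj n) (a b : 'I_m.+1 -> 'I_n.+1) :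
    (forall k, a k = b k :> nat) -> sing_pull a f = sing_pull b f.
  by move=> ab; apply: sing_eq => x /=; rewrite (eq_simplex_push _ ab).
have comp p m n (f : sing_obj n) (a : 'I_m.+1 -> 'I_n.+1) (b : 'I_p.+1 -> 'I_m.+1) :
    sing_pull b (sing_pull a f) = sing_pull (a \o b) f.
  by apply: sing_eq => x /=; rewrite simplex_push_comp.
have id n (f : sing_obj n) : sing_pull id f = f.
  by apply: sing_eq => -[t u] /=; rewrite simplex_push_id.
rewrite /simplicial_identities; cbv zeta.
split=> [n i j x h|n i j x h|n j x h|n i j x h|n i j x h];
  rewrite /sing_face /sing_degen ?comp.
- by apply: solve => k; rewrite [LHS]val_coface [RHS]val_coface !val_coface /bump !inordK; lia.
- apply: solve => k.
  by rewrite [LHS]val_codegen [RHS]val_coface val_codegen val_coface /unbump /bump !inordK; lia.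
- split; rewrite -[RHS]id; apply: solve => k;
    by rewrite [LHS]val_codegen val_coface /unbump /bump !inordK; lia.
- apply: solve => k.
  by rewrite [LHS]val_codegen [RHS]val_coface val_codegen val_coface /unbump /bump !inordK; lia.
- apply: solve => k.
  by rewrite [LHS]val_codegen [RHS]val_codegen !val_codegen /unbump !inordK; lia.
Qed.

Definition sing : sset := SSet sing_ids.

End Sing.

(** A horn in an edge is a single vertex, which leaves nothing to match for n = 0. *)
Definition horn_compat (E : sset) (n : nat) :
    'I_n.+2 -> ('I_n.+2 -> E n) -> Prop :=
  match n return 'I_n.+2 -> ('I_n.+2 -> E n) -> Prop with
  | 0 => fun _ _ => True
  | m.+1 => fun k h => forall i j : nat, (i <= j <= m.+1)%N ->
      inord i != k -> inord j.+1 != k ->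
      face (inord i) (h (inord j.+1)) = face (inord j) (h (inord i))
  end.

Section SingFill.
Variables (R : realType) (Z : topologicalType).
Local Notation S := (sing R Z).

Definition ends (b : bool) (u : R) : Prop := if b then 1 <= u else u <= 0.

(** A point with two vanishing coordinates lies on a face of codimension 2; there both retractions
    pass through the common face on which [horn_compat] equates the data. *)
Lemma horn_overlap n (k : 'I_n.+2) (h : 'I_n.+2 -> S n) (i j : 'I_n.+2)
    (t : std_simplex R n.+1) u :
  horn_compat k h -> i != k -> j != k -> (i < j)%N ->
  bary t i = 0 -> bary t j = 0 ->
  sval (h i) (retr i t, u) = sval (h j) (retr j t, u).
Proof.
case: n k h i j t => [|m] k h i j t hc ik jk ij ti tj.
  have := ltn_ord i; have := ltn_ord j; have := ltn_ord k; move: ik jk.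
  by rewrite -!val_eqE /=; lia.
have hj : (0 < j)%N by lia.
have lj := ltn_ord j.
pose i' : 'I_m.+2 := inord i; pose j' : 'I_m.+2 := inord j.-1.
have vi : i' = i :> nat by rewrite inordK //; lia.
have vj : j' = j.-1 :> nat by rewrite inordK //; lia.
have lji : lift j i' = i.
  by apply: val_inj; rewrite /= /bump vi; case: leqP; lia.
have rj : bary (retr j t) i' = 0.
  by rewrite -(bary_coface j) lji coface_retr.
have := hc i j.-1; rewrite prednK // -[@inord m.+1 i]/i' -[@inord m.+1 j.-1]/j'.
rewrite !inord_val => /(_ _ ik jk) e.
have {e}e : face i' (h j) = face j' (h i) by apply: e; lia.
have := f_equal (fun f : S m => sval f (retr i' (retr j t), u)) e => /=.
rewrite coface_retr // => ->; congr (sval (h i) (_, u)).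
rewrite -[RHS](retrK i) simplex_push_comp; congr (retr i _).
rewrite -[LHS](coface_retr tj) -[in LHS](coface_retr rj) simplex_push_comp.
apply: eq_simplex_push => l; rewrite /= /bump vi vj.
by move: (ltn_ord l) => ?; lia.
Qed.

(** The faces other than k and, for [flag], the two ends form a finite closed family with compatible
    maps. [horn_retr] lands in their union and fixes each of them, so the glued map composed with it
    is a filler with the prescribed restrictions. At an end the map is prescribed by the slice of
    [w b] at parameter 0. *)
Lemma sing_fill n (k : 'I_n.+2) (flag : bool) (h : 'I_n.+2 -> S n) (w : bool -> S n.+1) :
  horn_compat k h ->
  (forall b j t u, flag -> j != k -> ends b u ->
     sval (h j) (t, u) = sval (w b) (simplex_push (coface j) t, 0)) ->
  exists e : S n.+1, (forall j, j != k -> face j e = h j) /\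
    (forall b t u, flag -> ends b u -> sval e (t, u) = sval (w b) (t, 0)).
Proof.
move=> hc hw.
pose T := (std_simplex R n.+1 * R)%type.
pose C (a : 'I_n.+2 + bool) : set T :=
  match a with
  | inl j => [set x | j != k /\ bary x.1 j = 0]
  | inr b => [set x | flag /\ ends b x.2]
  end.
pose g (a : 'I_n.+2 + bool) (x : T) : Z :=
  match a with
  | inl j => sval (h j) (retr j x.1, x.2)
  | inr b => sval (w b) (x.1, 0)
  end.
have bc j : continuous (fun x : T => bary x.1 j).
  move=> x; apply: (@continuous_comp _ _ _ fst (fun t : std_simplex R n.+1 => bary t j)).
    exact: cvg_fst.
  exact: bary_continuous.
have closedP (P : Prop) : closed [set _ : T | P].
  have [p|np] := pselect P.
    by rewrite (_ : [set _ | _] = setT) ?predeqE //; exact: closedT.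
  by rewrite (_ : [set _ | _] = set0) ?predeqE //; exact: closed0.
have Cc a : closed (C a).
  case: a => [j|b] /=.
    apply: (@closedI _ [set _ | j != k] [set x : T | bary x.1 j = 0]); first exact: closedP.
    by move/continuous_closedP: (bc j) => /(_ _ (@closed_eq R 0)).
  apply: (@closedI _ [set _ | is_true flag] [set x : T | ends b x.2]); first exact: closedP.
  have sc : continuous (snd : T -> R) by move=> x; exact: cvg_snd.
  move/continuous_closedP: sc => sc.
  by case: b; apply: sc; [exact: closed_ge|exact: closed_le].
have gc a : continuous (g a).
  case: a => [j|b] x /=; first exact: (@sing_pull_subproof R Z _ _ _ (h j)).
  apply: (@continuous_comp _ _ _ (fun x : T => (x.1, 0 : R)) (sval (w b))).
    by apply: (@cvg_pair _ _ _ _ (nbhs _) (nbhs _)); [exact: cvg_fst|exact: cvg_cst].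
  exact: (svalP (w b)).
have gg a b x : C a x -> C b x -> g a x = g b x.
  have ww (b' c' : bool) (u : R) : ends b' u -> ends c' u -> b' = c'.
    by rewrite /ends; case: b' c' => [] [] // h1 h2; exfalso; lra.
  have hw' j b' : C (inl j) x -> C (inr b') x -> g (inl j) x = g (inr b') x.
    by move=> /= [jk xj] [f xb]; rewrite (hw b') // coface_retr.
  case: a b => [i|b'] [j|c'] Ca Cb; [|exact: hw'|exact/esym/hw'|].
    case: Ca Cb => [ik xi] [jk xj]; rewrite /=.
    have [ij|ij|/val_inj -> //] := ltngtP i j.
      exact: horn_overlap hc ik jk ij xi xj.
    by apply: esym; exact: horn_overlap hc jk ik ij xj xi.
  by case: Ca Cb => [_ Ca] [_ Cb]; rewrite (ww _ _ _ Ca Cb).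
have cov x : exists a, C a (horn_retr k flag x).
  case: (horn_retr_cover k flag x) => [[j jk xj]|[f [xu|xu]]]; first by exists (inl j).
    by exists (inr false).
  by exists (inr true).
have [e ec eg] := glue_closed_exists Cc gc (@horn_retr_continuous R n k flag) gg cov.
exists (exist _ e ec); split=> [j jk|b t u f bu].
  apply: sing_eq => -[t u] /=.
  have x0 : bary (simplex_push (coface j) t) j = 0 by exact: bary_coface0.
  have rx : horn_retr k flag (simplex_push (coface j) t, u) = (simplex_push (coface j) t, u).
    exact: horn_retr_horn jk _.
  by rewrite (eg (inl j)) rx //= retrK.
have rx : horn_retr k flag (t, u) = (t, u).
  by apply: horn_retr_rim => //; case: b bu => /= ?; [right|left].
by rewrite /= (eg (inr b)) rx.
Qed.

End SingFill.

(** * Continuous maps out of a realization *)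

Section RealizationMaps.
Variables (R : realType) (Y : sset) (Z : topologicalType).

Lemma cells_continuous (T : topologicalType) (f : cells R Y -> T) :
  (forall n (x : Y n), continuous (fun t => f (cell x t))) -> continuous f.
Proof.
by move=> fc [[n x] t] U nU; exact: (fc n x t U nU).
Qed.

Definition real_pt n (x : Y n) (t : std_simplex R n) : realization R Y :=
  realize_pi (cell x t).

Lemma real_ptP (P : realization R Y -> Prop) :
  (forall n (x : Y n) t, P (real_pt x t)) -> forall q, P q.
Proof. by move=> h; apply: gen_quotW => -[[n x] t]; exact: h. Qed.

Lemma real_pt_face n i (x : Y n.+1) t :
  real_pt (face i x) t = real_pt x (simplex_push (coface i) t).
Proof. by apply/gen_piP/rst_step; exact: GlueFace. Qed.

Lemma real_pt_degen n i (x : Y n) t :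
  real_pt (degen i x) t = real_pt x (simplex_push (codegen i) t).
Proof. by apply/gen_piP/rst_step; exact: GlueDegen. Qed.

Lemma real_continuous (f : realization R Y -> Z) :
  (forall n (x : Y n), continuous (fun t => f (real_pt x t))) -> continuous f.
Proof.
by move=> fc; apply/quotient_continuous; apply: cells_continuous => n x; exact: fc.
Qed.

Lemma real_pt_continuous n (x : Y n) : continuous (real_pt x).
Proof.
move=> t; apply: (@continuous_comp _ _ _ (cell x) (@realize_pi R Y)); last exact: pi_continuous.
exact: (@existT_continuous _ (fun s : {n : nat & {classic Y n}} => std_simplex R (tag s))
  (existT _ n x)).
Qed.

(* The exponential law for the locally compact factor [R] replaces the statement
   that the product of a quotient map with [R] is a quotient map. *)
Lemma sing_to_real (F : smap Y (sing R Z)) :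
  exists2 Phi : realization R Y * R -> Z, continuous Phi &
    forall n (x : Y n) t u, Phi (real_pt x t, u) = sval (F n x) (t, u).
Proof.
pose Psi : realization R Y -> R -> Z :=
  gen_lift (fun c : cells R Y => fun u =>
    sval (F (tag (tag c)) (tagged (tag c))) (tagged c, u)).
have PsiE n (x : Y n) t u : Psi (real_pt x t) u = sval (F n x) (t, u).
  rewrite /Psi [gen_lift _ _]gen_lift_pi // => _ _ [m i y s|m i y s];
    by apply/funext => v; rewrite /cell /= ?smap_face ?smap_degen.
exists (uncurry Psi); last by move=> n x t u; exact: PsiE.
have Pc n (x : Y n) : continuous (fun y : std_simplex R n * R => Psi (real_pt x y.1) y.2).
  rewrite (_ : (fun _ => _) = sval (F n x)); first exact: (svalP (F n x)).
  by apply/funext => -[t u]; exact: PsiE.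
apply: continuous_uncurry; [exact: locally_compactR|exact: Rhausdorff| |].
- apply/(@quotient_continuous _ _ {compact-open, R -> Z}).
  apply: (@cells_continuous {compact-open, R -> Z}) => n x.
  exact: (continuous_curry (Pc n x)).1.
- apply: real_ptP => n x t; exact: ((continuous_curry (Pc n x)).2 t).
Qed.

End RealizationMaps.

(** * Extension along a matching *)

Section WfChoice.
Variables (T : Type) (E : T -> Type) (r : T -> T -> Prop).
Hypothesis r_wf : well_founded r.
Variable dflt : forall x, E x.
Variable good : forall y, (forall x, E x) -> E y -> Prop.
Hypothesis good_local : forall y F F', (forall x, r x y -> F x = F' x) ->
  forall e : E y, good F e -> good F' e.

(** Separates the definition of F from the proof that good values exist: a good value is taken if
    there is one, and [dflt] otherwise. The predicate [good] speaks of total families, so the values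
    known so far are completed by [dflt], which locality makes harmless. *)
Lemma wf_choice :
  exists F : forall x, E x, forall y, (exists e : E y, good F e) -> good F (F y).
Proof.
pose ext y (rec : forall x, r x y -> E x) x : E x :=
  if pselect (r x y) is left h then rec x h else dflt x.
pose body y (rec : forall x, r x y -> E x) : E y :=
  if pselect (exists e, good (ext y rec) e) is left h then sval (cid h) else dflt y.
pose F := Fix r_wf _ body.
have FE y : F y = body y (fun x _ => F x).
  apply: (Fix_eq r_wf _ body) => x f g fg.
  by congr body; apply/functional_extensionality_dep => z; apply/funext => h; exact: fg.
have extE y x : r x y -> ext y (fun x _ => F x) x = F x.
  by rewrite /ext; case: pselect.
exists F => y [e ge]; rewrite FE /body; case: pselect => [h|[]].
  apply: (good_local (F := ext y (fun x _ => F x))) => [x|]; first exact: extE.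
  by case: (cid h).
by exists e; apply: good_local ge => x /extE.
Qed.

End WfChoice.

Definition dface (X : sset) n (i : nat) (x : X n.+1) : X n := face (inord i) x.
Definition ddegen (X : sset) n (i : nat) (x : X n) : X n.+1 := degen (inord i) x.

Definition degenerate (X : sset) n : X n -> Prop :=
  match n return X n -> Prop with
  | 0 => fun=> False
  | m.+1 => fun x => exists i w, (i <= m)%N /\ x = @ddegen X m i w
  end.

Section SsetIds.
Variable X : sset.

Lemma dface_dface n i j (x : X n.+2) : (i <= j <= n.+1)%N ->
  dface i (dface j.+1 x) = dface j (dface i x).
Proof. by case: (sset_ids X) => h _ _ _ _; exact: h. Qed.

Lemma dface_degen_lt n i j (x : X n.+1) : (i <= j <= n)%N ->
  dface i (ddegen j.+1 x) = ddegen j (dface i x).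
Proof. by case: (sset_ids X) => _ h _ _ _; exact: h. Qed.

Lemma dface_degen_id n j (x : X n) : (j <= n)%N -> dface j (ddegen j x) = x.
Proof. by have [_ _ h _ _] := sset_ids X; move=> /(h n j x)[]. Qed.

Lemma dface_degen_idS n j (x : X n) : (j <= n)%N -> dface j.+1 (ddegen j x) = x.
Proof. by have [_ _ h _ _] := sset_ids X; move=> /(h n j x)[]. Qed.

Lemma dface_degen_gt n i j (x : X n.+1) : (j < i <= n.+1)%N ->
  dface i.+1 (ddegen j x) = ddegen j (dface i x).
Proof. by case: (sset_ids X) => _ _ _ h _; exact: h. Qed.

Lemma ddegen_degen n i j (x : X n) : (i <= j <= n)%N ->
  ddegen i (ddegen j x) = ddegen j.+1 (ddegen i x).
Proof. by case: (sset_ids X) => _ _ _ _ h; exact: h. Qed.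

Lemma face_dface n (i : 'I_n.+2) (x : X n.+1) : face i x = dface i x.
Proof. by rewrite /dface inord_val. Qed.

Lemma degen_ddegen n (i : 'I_n.+1) (x : X n) : degen i x = ddegen i x.
Proof. by rewrite /ddegen inord_val. Qed.

(** A simplex degenerate in two directions is doubly degenerate. This is what makes a value defined
    through one presentation as a degeneracy independent of the presentation. *)
Lemma ddegen_eq n i j (w w' : X n.+1) : (i < j <= n.+1)%N ->
  ddegen i w = ddegen j w' ->
  exists v, w = ddegen j.-1 v /\ w' = ddegen i v.
Proof.
case: j => // j /andP[ij jn] e.
have e1 : w = ddegen j (dface i w').
  by rewrite -dface_degen_lt; [rewrite -e dface_degen_id //|]; lia.
have e2 : w' = ddegen i (dface j.+1 w).
  rewrite -dface_degen_gt; last lia.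
  by rewrite e dface_degen_idS.
exists (dface i w'); split => //.
rewrite [LHS]e2 {1}e1; congr ddegen.
by rewrite dface_degen_idS.
Qed.

End SsetIds.

(* A matching in the style of discrete Morse theory: outside [A], the nondegenerate
   simplices are paired off as [z] with [dface k z] for [tau z k], and [z] can be
   attached along the horn missing its [k]-th face once all simplices of smaller rank
   [(c z, dimension, k)] are present. *)
Section Extension.
Variables (Y E : sset) (A : subsset Y).
Variable tau : forall n, Y n -> nat -> Prop.
Variable c : forall n, Y n -> nat.
Hypothesis c_face : forall n i (y : Y n.+1), (i <= n.+1)%N -> (c (dface i y) <= c y)%N.
Hypothesis tau0 : forall (y : Y 0%N) k, ~ tau y k.
Hypothesis tau_le : forall n (z : Y n.+1) k, tau z k -> (k <= n.+1)%N.
Hypothesis tau_notA : forall n (z : Y n) k, tau z k -> ~ A n z.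
Hypothesis tau_nondeg : forall n (z : Y n) k, tau z k -> ~ degenerate z.
Hypothesis tau_index : forall n (z : Y n) k k', tau z k -> tau z k' -> k = k'.
Hypothesis tau_face_notA : forall n (z : Y n.+1) k, tau z k -> ~ A n (dface k z).
Hypothesis tau_face_nondeg : forall n (z : Y n.+1) k, tau z k -> ~ degenerate (dface k z).
Hypothesis tau_face_tau : forall n (z : Y n.+1) k k', tau z k -> ~ tau (dface k z) k'.
Hypothesis tau_inj : forall n (z z' : Y n.+1) k k', tau z k -> tau z' k' ->
  dface k z = dface k' z' -> z = z' /\ k = k'.
Hypothesis tau_cover : forall n (y : Y n), ~ A n y -> ~ degenerate y ->
  (exists k, tau y k) \/ (exists z k, @tau n.+1 z k /\ y = dface k z).
Hypothesis c_tau : forall n (z : Y n.+1) k, tau z k -> (c z <= c (dface k z))%N.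
Hypothesis tau_face : forall n (z : Y n.+1) k j, tau z k -> (j <= n.+1)%N -> j <> k ->
  A n (dface j z) \/ (c (dface j z) < c z)%N \/ degenerate (dface j z) \/
  (exists k', tau (dface j z) k') \/
  exists z' k', [/\ @tau n.+1 z' k', dface j z = dface k' z' & (k' < k)%N].

Variable f : forall n, Y n -> E n.
Hypothesis f_face : forall n i (y : Y n.+1), A n.+1 y -> f (dface i y) = dface i (f y).
Hypothesis f_degen : forall n i (y : Y n), A n y -> f (ddegen i y) = ddegen i (f y).

Variable G : forall n, Y n -> E n -> Prop.
Hypothesis G_face : forall n i (y : Y n.+1) e, G y e -> G (dface i y) (dface i e).
Hypothesis G_degen : forall n i (y : Y n) e, G y e -> G (ddegen i y) (ddegen i e).
Hypothesis G_f : forall n (y : Y n), A n y -> G y (f y).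
Hypothesis fill : forall n (y : Y n.+1) (k : 'I_n.+2) (h : 'I_n.+2 -> E n),
  horn_compat k h -> (forall j, j != k -> G (face j y) (h j)) ->
  exists e : E n.+1, G y e /\ forall j, j != k -> face j e = h j.

Let T := {n : nat & Y n}.
Let mkT n (y : Y n) : T := existT _ n y.

Let A_face n i (w : Y n.+1) : A n.+1 w -> A n (dface i w).
Proof. exact: subsset_face. Qed.

Let A_degenV n i (w : Y n) : (i <= n)%N -> A n.+1 (ddegen i w) -> A n w.
Proof. by move=> h /(@A_face _ i); rewrite dface_degen_id. Qed.

(* [calls x y]: the value of the extension at [y] is defined from its value at [x]. *)
Inductive calls : T -> T -> Prop :=
  | CallDegen n i (w : Y n) : (i <= n)%N -> ~ A n.+1 (ddegen i w) ->
      calls (mkT w) (mkT (ddegen i w))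
  | CallTau n (z : Y n.+1) k j : tau z k -> (j <= n.+1)%N -> j <> k ->
      calls (mkT (dface j z)) (mkT z)
  | CallSigma n (z : Y n.+1) k : tau z k -> calls (mkT z) (mkT (dface k z)).

Let callsP (x y : T) : calls x y ->
  [\/ exists n i (w : Y n), [/\ (i <= n)%N, ~ A n.+1 (ddegen i w), x = mkT w
                              & y = mkT (ddegen i w)],
      exists n (z : Y n.+1) k j, [/\ tau z k, (j <= n.+1)%N, j <> k &
                              x = mkT (dface j z) /\ y = mkT z] |
      exists n (z : Y n.+1) k, [/\ tau z k, x = mkT z & y = mkT (dface k z)]].
Proof.
case=> {x y} [n i w iw nA|n z k j zk jn jk|n z k zk]; [apply: Or31|apply: Or32|apply: Or33].
- by exists n, i, w.
- by exists n, z, k, j.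
- by exists n, z, k.
Qed.

Let mkT_inj n (y y' : Y n) : mkT y = mkT y' -> y = y'.
Proof. exact: (inj_pair2_eq_dec _ (fun m n => decP (m =P n))). Qed.

Let degT n (y : Y n) m i (w : Y m) : (i <= m)%N ->
  mkT y = mkT (ddegen i w) -> degenerate y.
Proof.
move=> im e; have en : n = m.+1 := f_equal (@projT1 _ _) e; subst n.
by rewrite (mkT_inj e); exists i, w.
Qed.

Let tauT n (y : Y n) m (z : Y m) k : mkT y = mkT z -> tau z k -> tau y k.
Proof.
by move=> e zk; have en : n = m := f_equal (@projT1 _ _) e; subst n; rewrite (mkT_inj e).
Qed.

Let acc_A n (y : Y n) : A n y -> Acc calls (mkT y).
Proof.
move=> Ay; constructor=> x /callsP[[m [i [w [im nA _ e]]]]|[m [z [k [j [zk _ _ [_ e]]]]]]|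
  [m [z [k [zk _ e]]]]].
- have en : n = m.+1 := f_equal (@projT1 _ _) e; subst n.
  by case: nA; rewrite -(mkT_inj e).
- by have /tau_notA := tauT e zk; case.
- have en : n = m := f_equal (@projT1 _ _) e; subst n.
  by case: (tau_face_notA zk); rewrite -(mkT_inj e).
Qed.

Let acc_nondeg n (y : Y n) : ~ degenerate y ->
  (forall k, tau y k -> Acc calls (mkT y)) ->
  (forall (z : Y n.+1) k, tau z k -> y = dface k z -> Acc calls (mkT z)) ->
  Acc calls (mkT y).
Proof.
move=> nd ht hs; have [[k /ht //]|nt] := pselect (exists k, tau y k).
constructor=> x /callsP[[m [i [w [im _ _ e]]]]|[m [z [k [j [zk _ _ [_ e]]]]]]|
  [m [z [k [zk -> e]]]]].
- by case: nd; exact: degT im e.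
- by case: nt; exists k; exact: tauT e zk.
- have en : n = m := f_equal (@projT1 _ _) e; subst n.
  exact: hs zk (mkT_inj e).
Qed.

Let acc_deg n (y : Y n) : degenerate y ->
  (forall m i (w : Y m), n = m.+1 -> (i <= m)%N -> mkT y = mkT (ddegen i w) ->
     Acc calls (mkT w)) ->
  Acc calls (mkT y).
Proof.
move=> yd hw.
constructor=> x /callsP[[m [i [w [im _ -> e]]]]|[m [z [k [j [zk _ _ [_ e]]]]]]|
  [m [z [k [zk _ e]]]]].
- exact: hw (f_equal (@projT1 _ _) e) im e.
- by have /tau_nondeg := tauT e zk; case.
- have en : n = m := f_equal (@projT1 _ _) e; subst m.
  by case: (tau_face_nondeg zk); rewrite -(mkT_inj e).
Qed.

Let c_degen n i (w : Y n) (y : Y n.+1) : (i <= n)%N -> mkT y = mkT (ddegen i w) ->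
  (c w <= c y)%N.
Proof.
by move=> iw /mkT_inj ->; rewrite -{1}(dface_degen_id w iw); apply/c_face/leqW.
Qed.

(** Unmatched simplices call only simplices of smaller dimension or the [z] of which they are the
    missing face, so accessibility needs checking on matched simplices only. These may exceed the
    dimension of y by one, but not its cost. *)
Let acc_of_tau n (y : Y n) :
  (forall m (z : Y m.+1) k, tau z k -> (m <= n)%N -> (c z <= c y)%N -> Acc calls (mkT z)) ->
  Acc calls (mkT y).
Proof.
elim: n y => [|n ih] y hz; (have [Ay|nA] := pselect (A _ y); first exact: acc_A).
  apply: acc_nondeg => [[]|k yk|z k zk e]; first by case: (tau0 yk).
  by apply: (hz _ _ _ zk); [exact: leqnn|rewrite e; exact: (c_tau zk)].
have [yd|nd] := pselect (degenerate y).
  apply: (acc_deg yd) => m i w [en] iw e; subst m; apply: ih => m z k zk mn cz.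
  apply: (hz _ _ _ zk); first exact: leqW.
  exact: leq_trans cz (c_degen iw e).
apply: (acc_nondeg nd) => [k yk|z k zk e]; first exact: (hz _ _ _ yk (leqnSn _) (leqnn _)).
by apply: (hz _ _ _ zk); [exact: leqnn|rewrite e; exact: (c_tau zk)].
Qed.

(** Lexicographic induction following [tau_face]: a cheaper face lowers the cost, a degenerate or
    matched face lowers the dimension, and a face that is itself the missing face of some z' lowers
    k. *)
Let acc_tau C n (z : Y n.+1) k : tau z k -> (c z <= C)%N -> Acc calls (mkT z).
Proof.
elim/ltn_ind: C n z k => C ihC; elim/ltn_ind => n ihn z k; move: k z.
elim/ltn_ind => k ihk z zk czC.
have low m (y : Y m) : (c y < c z)%N -> Acc calls (mkT y).
  move=> cy; apply: acc_of_tau => m' z' k' zk' _ cz'.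
  apply: (ihC (c z') _ _ z' k') => //; exact: leq_ltn_trans cz' (leq_trans cy czC).
constructor=> x /callsP[[m [i [w [im _ _ e]]]]|[m [z0 [k0 [j [zk0 jm jk [-> e]]]]]]|
  [m [z0 [k0 [zk0 _ e]]]]].
- by case: (tau_nondeg zk); exact: degT im e.
- have en : n = m by have := f_equal (@projT1 _ _) e => /= -[].
  subst m; move/mkT_inj: e => e; subst z0.
  have ek := tau_index zk zk0; subst k0.
  have cj := c_face z jm.
  case: (tau_face zk jm jk) => [Aj|[cl|[dj|[[k' jk']|[z' [k' [zk' e' k'k]]]]]]].
  + exact: acc_A.
  + exact: low.
  + apply: (acc_deg dj) => p i w en iw e; subst n.
    apply: acc_of_tau => m' z' k' zk' mn cz'.
    apply: (ihn m' _ z' k' zk'); first exact: mn.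
    exact: leq_trans cz' (leq_trans (c_degen iw e) (leq_trans cj czC)).
  + have [n0|[p en]] : n = 0%N \/ exists p, n = p.+1 by case: (n) => [|p]; [left|right; exists p].
      by subst n; case: (tau0 jk').
    by subst n; apply: (ihn p (ltnSn _) _ k' jk'); apply: leq_trans cj czC.
  + rewrite e'; apply: acc_nondeg; first exact: tau_face_nondeg zk'.
      by move=> k'' /(tau_face_tau zk').
    move=> z'' k'' zk'' e''; have [<- _] := tau_inj zk' zk'' e''.
    apply: (ihk k') => //; apply: leq_trans (c_tau zk') _; rewrite -e'.
    exact: leq_trans cj czC.
- by have := tauT (esym e) zk; move/(tau_face_tau zk0).
Qed.

Lemma calls_wf : well_founded calls.
Proof.
by case=> n y; apply: acc_of_tau => m z k zk _ _; exact: acc_tau zk (leqnn _).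
Qed.

(** Every clause refers only to values at simplices that [calls] puts before y, as [wf_choice]
    requires. *)
Let goodn (F : forall n, Y n -> E n) n (y : Y n) (e : E n) : Prop :=
  (A n y -> e = f y) /\
  (~ A n y ->
    (forall (z : Y n.+1) k, tau z k -> y = dface k z -> e = dface k (F _ z)) /\
    match n return Y n -> E n -> Prop with
    | 0 => fun _ _ => True
    | m.+1 => fun y e =>
       (forall i (w : Y m), (i <= m)%N -> y = ddegen i w -> e = ddegen i (F _ w)) /\
       (forall k, tau y k -> G y e /\
          forall j, (j <= m.+1)%N -> j <> k -> dface j e = F _ (dface j y))
    end y e).

Let goodn_local (x : T) (F F' : forall x : T, E (tag x)) :
  (forall z, calls z x -> F z = F' z) -> forall e : E (tag x),
  goodn (fun n y => F (mkT y)) (tagged x) e ->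
  goodn (fun n y => F' (mkT y)) (tagged x) e.
Proof.
case: x => n y FF e [/= gA gN]; split=> // nA; have [gs gd] := gN nA; split=> [z k zk e'|].
  have cz : calls (mkT z) (mkT y) by rewrite e'; exact: CallSigma.
  by rewrite -(FF _ cz); exact: gs zk e'.
case: n y FF e gA {gN} nA gs gd => // n y FF e gA nA gs [gd gt]; split=> [i w iw e'|k yk].
  have cw : calls (mkT w) (mkT y) by rewrite e'; apply: CallDegen => //; rewrite -e'.
  by rewrite -(FF _ cw); exact: gd iw e'.
have [gG gf] := gt k yk; split=> // j jn jk.
by rewrite -(FF _ (CallTau yk jn jk)); exact: gf.
Qed.

Lemma extension_exists :
  exists F : smap Y E, (forall n (y : Y n), A n y -> F n y = f y) /\
    (forall n (y : Y n), G y (F n y)).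
Proof.
have [F0 hF0] := wf_choice calls_wf (fun x => f (tagged x)) goodn_local.
pose F n (y : Y n) : E n := F0 (mkT y).
have {hF0}good n (y : Y n) e : goodn F y e -> goodn F y (F n y).
  by move=> ge; apply: (hF0 (mkT y)); exists e.
have FA n (y : Y n) : A n y -> F n y = f y.
  by move=> Ay; have [/(_ Ay)] : goodn F y (F n y); first by apply: (good _ _ (f y)); split.
(* A good value at a degenerate simplex exists once all its presentations as a degeneracy give the
   same value. *)
have Fdeg1 n i (w : Y n) : (i <= n)%N ->
    (forall j w', (j <= n)%N -> ddegen i w = ddegen j w' ->
       ddegen i (F _ w) = ddegen j (F _ w')) ->
    F _ (ddegen i w) = ddegen i (F _ w).
  move=> iw key; have [Aw|nA] := pselect (A _ (ddegen i w)).
    by have Aw' := A_degenV iw Aw; rewrite !FA // f_degen.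
  have dw : degenerate (ddegen i w) by exists i, w.
  have [_ /(_ nA)[_ [h _]]] : goodn F (ddegen i w) (F _ (ddegen i w)); last exact: (h _ _ iw erefl).
  apply: (good _ _ (ddegen i (F _ w))); split=> // _.
  split=> [z k zk e|]; first by case: (tau_face_nondeg zk); rewrite -e.
  by split=> [j w' jw e|k /tau_nondeg[]]; first exact: key.
have key0 n i (w w' : Y n) : (i <= n)%N -> ddegen i w = ddegen i w' -> w = w'.
  by move=> iw e; rewrite -(dface_degen_id w iw) e dface_degen_id.
have Fdeg n i (w : Y n) : (i <= n)%N -> F _ (ddegen i w) = ddegen i (F _ w).
  elim: n i w => [|n ih] i w iw; apply: Fdeg1 => // j w' jw.
    have [-> ->] : i = 0%N /\ j = 0%N by lia.
    by move=> e; rewrite (key0 _ _ _ _ _ e).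
  have key i' j' (u u' : Y n.+1) : (i' < j' <= n.+1)%N -> ddegen i' u = ddegen j' u' ->
      ddegen i' (F _ u) = ddegen j' (F _ u').
    move=> ij e; have [v [-> ->]] := ddegen_eq ij e.
    have h1 : (j'.-1 <= n)%N by lia.
    have h2 : (i' <= n)%N by lia.
    have h3 : (i' <= j'.-1 <= n)%N by lia.
    have h4 : (0 < j')%N by lia.
    by rewrite !ih // ddegen_degen // prednK.
  have [ij|ij|ij] := ltngtP i j => e.
  - by apply: key e; rewrite ij.
  - by apply: esym; apply: key (esym e); rewrite ij.
  - by subst j; rewrite (key0 _ _ _ _ iw e).
have Fsig n (z : Y n.+1) k : tau z k -> F _ (dface k z) = dface k (F _ z).
  move=> zk; have nA := tau_face_notA zk; have nd := tau_face_nondeg zk.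
  have [_ /(_ nA)[h _]] : goodn F (dface k z) (F _ (dface k z)); last exact: h zk erefl.
  apply: (good _ _ (dface k (F _ z))); split=> // _; split=> [z' k' zk' e|].
    by have [-> ->] := tau_inj zk zk' e.
  have nt k' := tau_face_tau (k' := k') zk.
  case: n z {zk nA} nd nt => // n z nd nt; split=> [i w iw e|k' /nt //].
  by case: nd; exists i, w.
pose Qf n : Y n -> Prop := match n return Y n -> Prop with
  | 0 => fun=> True
  | m.+1 => fun y => forall j, (j <= m.+1)%N -> F m (dface j y) = dface j (F _ y) end.
pose Q (x : T) := G (tagged x) (F _ (tagged x)) /\ Qf _ (tagged x).
(* The induction looks two levels down: at the missing face of z it needs the other faces of z,
   which are reached only through z. *)
have hQ : forall x, Q x /\ forall x', calls x' x -> Q x'.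
  apply: (well_founded_ind calls_wf) => x ih; split; last by move=> x' /ih[].
  case: x ih => n y ih; rewrite /Q /=.
  have [Ay|nA] := pselect (A _ y).
    rewrite FA //; split; first exact: G_f.
    case: n y Ay {ih} => // n y Ay j jn; rewrite FA ?f_face // ?FA //; exact: A_face.
  have [yd|nd] := pselect (degenerate y).
    case: n y yd nA ih => // m y [i [w [iw e]]] nA ih.
    have [Gw Qw] : Q (mkT w).
      by apply: (ih (mkT w) _).1; rewrite e; apply: CallDegen => //; rewrite -e.
    rewrite e Fdeg //; split; first exact: G_degen.
    move=> j jm; rewrite Fdeg //.
    have [ji|ij|->] := ltngtP j i; last by rewrite !dface_degen_id.
      case: m w {y e nA ih} iw jm Gw Qw => [|m] w iw jm Gw Qw; first by lia.
      case: i iw ji => // i iw ji.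
      by rewrite !dface_degen_lt ?Fdeg ?Qw //; lia.
    case: j jm ij => // j jm; rewrite ltnS leq_eqVlt => /orP[/eqP <-|ij].
      by rewrite !dface_degen_idS.
    case: m w {y e nA ih} iw jm Gw Qw => [|m] w iw jm Gw Qw; first by lia.
    by rewrite !dface_degen_gt ?Fdeg ?Qw //; lia.
  have [[k yk]|[z [k [zk e]]]] := tau_cover nA nd.
    case: n y yk nA nd ih => [y /tau0 //|m] y yk nA nd ih.
    have km := tau_le yk.
    have Qy j : (j <= m.+1)%N -> j <> k -> Q (mkT (dface j y)).
      by move=> jm jk; exact: (ih _ (CallTau yk jm jk)).1.
    pose k' : 'I_m.+2 := inord k.
    have vk : k' = k :> nat by rewrite inordK.
    (* A filler makes the value at y good. The horn is compatible because [F] already commutes with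
       the faces of the faces of y other than the k-th. *)
    have [||e [Ge fe]] := @fill m y k' (fun j => F _ (face j y)).
    - case: m y k' vk km Qy {yk nA nd ih} => // m y k' vk km Qy i j ij ik jk.
      have ik' : i <> k.
        by move=> ik'; case/eqP: ik; apply: val_inj; rewrite /= vk inordK //; lia.
      have jk' : j.+1 <> k.
        by move=> jk'; case/eqP: jk; apply: val_inj; rewrite /= vk inordK //; lia.
      have im : (i <= m.+2)%N by lia.
      have jm : (j.+1 <= m.+2)%N by lia.
      have [_ Q1] := Qy i im ik'; have [_ Q2] := Qy j.+1 jm jk'.
      rewrite -/(dface i (F _ (dface j.+1 y))) -/(dface j (F _ (dface i y))).
      have [ij' jm'] := andP ij.
      by rewrite -Q2 ?(leq_trans ij' jm') // -Q1 // dface_dface.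
    - move=> j jk; rewrite face_dface.
      have jk' : nat_of_ord j <> k by move=> jk'; case/eqP: jk; apply: val_inj; rewrite /= vk.
      by have [] := Qy j (ltn_ord j) jk'.
    have [_ /(_ nA)[_ [_ /(_ k yk)[GF fF]]]] : goodn F y (F _ y).
      apply: (good _ _ e); split=> // _; split=> [z k0 zk ez|].
        by case: (tau_face_tau (k' := k) zk); rewrite -ez.
      split=> [i w iw ew|k0 yk0]; first by case: nd; exists i, w.
      rewrite -(tau_index yk yk0); split=> // j jm jk.
      have jk' : inord j != k' :> 'I_m.+2.
        by apply/eqP => /(f_equal val); rewrite /= vk inordK.
      exact: fe jk'.
    split=> // j jm; have [->|/eqP jk] := eqVneq j k; first exact: Fsig.
    by rewrite fF.
  have [[Gz Qz] Qzf] := ih (mkT z) (ltac:(rewrite e; exact: CallSigma zk)).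
  rewrite e Fsig //; split; first exact: G_face.
  case: n y z nA nd ih zk e Gz Qz Qzf => // n y z _ _ _ zk _ Gz Qz Qzf j jn.
  rewrite (Fsig _ _ _ zk).
  have kn := tau_le zk.
  have Qzj i : (i <= n.+2)%N -> i <> k -> Q (mkT (dface i z)).
    by move=> im ik; exact: Qzf (CallTau zk im ik).
  (* A face of the missing face is also a face of another face of z, where [F] is known to commute
     with faces. *)
  have [kj|jk] := leqP k j.
    have jn' : (j.+1 <= n.+2)%N by lia.
    have jk : j.+1 <> k by lia.
    have h : (k <= j <= n.+1)%N by lia.
    have [_ Qj] := Qzj j.+1 jn' jk.
    have hk : (k <= n.+1)%N by lia.
    by rewrite -(dface_dface z h) -(dface_dface (F _ z) h) Qj // Qz.
  case: k zk kn jk Qzj => // k zk kn jk Qzj.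
  have jn' : (j <= n.+2)%N by lia.
  have jk' : j <> k.+1 by lia.
  have h : (j <= k <= n.+1)%N by lia.
  have [_ Qj] := Qzj j jn' jk'.
  by rewrite (dface_dface z h) (dface_dface (F _ z) h) Qj ?Qz //; lia.
have Fface n i (y : Y n.+1) : F n (face i y) = face i (F _ y).
  rewrite !face_dface; have [[_ h] _] := hQ (mkT y); apply: h.
  by rewrite -ltnS.
have Fdegen n i (y : Y n) : F n.+1 (degen i y) = degen i (F _ y).
  by rewrite !degen_ddegen Fdeg // -ltnS.
exists (SMap Fface Fdegen); split=> [n y|n y]; first exact: FA.
by have [[]] := hQ (mkT y).
Qed.

End Extension.

(* [A] behaves towards horn-fillable targets like an anodyne inclusion; [G] records
   boundary conditions that the extension has to satisfy. *)
Definition extends_from (Y : sset) (A : subsset Y) : Prop :=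
  forall (E : sset) (f : forall n, Y n -> E n),
  (forall n i (y : Y n.+1), A n.+1 y -> f n (dface i y) = dface i (f n.+1 y)) ->
  (forall n i (y : Y n), A n y -> f n.+1 (ddegen i y) = ddegen i (f n y)) ->
  forall G : forall n, Y n -> E n -> Prop,
  (forall n i (y : Y n.+1) e, G _ y e -> G _ (dface i y) (dface i e)) ->
  (forall n i (y : Y n) e, G _ y e -> G _ (ddegen i y) (ddegen i e)) ->
  (forall n (y : Y n), A n y -> G _ y (f n y)) ->
  (forall n (y : Y n.+1) (k : 'I_n.+2) (h : 'I_n.+2 -> E n),
    horn_compat k h -> (forall j, j != k -> G _ (face j y) (h j)) ->
    exists e : E n.+1, G _ y e /\ forall j, j != k -> face j e = h j) ->
  exists F : smap Y E, (forall n (y : Y n), A n y -> F n y = f n y) /\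
    (forall n (y : Y n), G _ y (F n y)).

(** * Entries of bar simplices *)

Section Entries.
Variable H : groupType.
Local Notation C := (onecat H).

(* Entries beyond the last one are 1 by convention. *)
Fixpoint tail_entry (n : nat) : forall v : C, tail n v -> nat -> H :=
  match n return forall v : C, tail n v -> nat -> H with
  | 0 => fun _ _ _ => 1%g
  | m.+1 => fun v p i =>
      let: existT w (a, q) := p in if i is j.+1 then tail_entry q j else a
  end.

Definition entry n (x : Wgroup H n) (i : nat) : H := tail_entry (projT2 x) i.

Fixpoint tail_of (n : nat) (e : nat -> H) : tail (C := C) n tt :=
  match n return tail (C := C) n tt with
  | 0 => tt
  | m.+1 => @tcons C m tt tt (e 0%N) (tail_of m (e \o S))
  end.

Definition bar n (e : nat -> H) : Wgroup H n := existT _ (tt : C) (tail_of n e).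

Lemma entry_bar n e i : (i < n)%N -> entry (bar n e) i = e i.
Proof. by rewrite /entry /=; elim: n e i => // n ih e [|i] //= h; rewrite ih. Qed.

Lemma entry_inj n (x y : Wgroup H n) :
  (forall i, (i < n)%N -> entry x i = entry y i) -> x = y.
Proof.
case: x y => [[] p] [[] q] /= e; congr existT.
have {}e : forall i, (i < n)%N -> tail_entry p i = tail_entry q i by [].
elim: n p q e => [[] []//|n ih] [[] [a p]] [[] [b q]] e.
have /= ab := e 0%N isT; subst b; congr existT; congr pair.
by apply: ih => i h; exact: (e i.+1).
Qed.

(* The nerve composes from right to left, whence the order of the merged entries. *)
Definition vface (k : nat) (e : nat -> H) (i : nat) : H :=
  if (i.+1 < k)%N then e i else if i.+1 == k then (e i.+1 * e i)%g else e i.+1.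

Definition vdegen (k : nat) (e : nat -> H) (i : nat) : H :=
  if (i < k)%N then e i else if i == k then 1%g else e i.-1.

Lemma tail_entry_face n k (v : C) (p : tail n.+1 v) i : (k <= n)%N -> (i < n)%N ->
  tail_entry (tail_face k p) i = vface k.+1 (tail_entry p) i.
Proof.
elim: n k v p i => // n ih [|k] v [w [a q]] [|i] hk hi //; try by case: q => w' [b q].
by rewrite [LHS](ih k w q i hk hi).
Qed.

Lemma tail_entry_degen n k (v : C) (p : tail n v) i : (k <= n)%N -> (i <= n)%N ->
  tail_entry (tail_degen k p) i = vdegen k (tail_entry p) i.
Proof.
elim: n k v p i => [|n ih] [|k] v p [|i] // hk hi; case: p => w [a q] //.
rewrite [LHS](ih k w q i hk hi) /vdegen ltnS eqSS.
by case: ltngtP => //; case: i {hi}.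
Qed.

Lemma entry_face n k (x : Wgroup H n.+1) i : (k <= n.+1)%N -> (i < n)%N ->
  entry (dface k x) i = vface k (entry x) i.
Proof.
move=> hk hi; case: x => v p; rewrite /dface /= /nerve_face inordK //.
case: k hk => [|k] hk; last exact: tail_entry_face.
by case: p => w [a q].
Qed.

Lemma entry_degen n k (x : Wgroup H n) i : (k <= n)%N -> (i <= n)%N ->
  entry (ddegen k x) i = vdegen k (entry x) i.
Proof.
move=> hk hi; case: x => v p; rewrite /ddegen /= /nerve_degen inordK //.
exact: tail_entry_degen.
Qed.

End Entries.

Lemma entry_map (H K : groupType) (f : {multiplicative H -> K}) n (x : Wgroup H n) i :
  (i < n)%N -> entry (Wgroup_map f n x) i = f (entry x i).
Proof.
case: x => v p; rewrite /entry /=.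
by elim: n v p i => // n ih v [w [a q]] [|i] //= h; exact: ih.
Qed.

Section WbarEntries.
Variable F : sgroup.

Definition sgd n (i : nat) (g : F n.+1) : F n := sg_face F (inord i) g.
Definition sgs n (i : nat) (g : F n) : F n.+1 := sg_degen F (inord i) g.

Lemma sgdM n i : {morph @sgd n i : g h / (g * h)%g}.
Proof. by move=> g h; rewrite /sgd gmulfM. Qed.

Lemma sgsM n i : {morph @sgs n i : g h / (g * h)%g}.
Proof. by move=> g h; rewrite /sgs gmulfM. Qed.

Lemma sgs1 n i : sgs i 1%g = 1%g :> F n.+1.
Proof. exact: mulhom1. Qed.

Lemma sgd1 n i : sgd i 1%g = 1%g :> F n.
Proof. exact: mulhom1. Qed.

Lemma sgd_sgs n j (g : F n) : (j <= n)%N -> sgd j (sgs j g) = g.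
Proof. exact: (@dface_degen_id (sg_sset F)). Qed.

Lemma sgd_sgsS n j (g : F n) : (j <= n)%N -> sgd j.+1 (sgs j g) = g.
Proof. exact: (@dface_degen_idS (sg_sset F)). Qed.

Lemma sgd_sgs_lt n i j (g : F n.+1) : (i <= j <= n)%N ->
  sgd i (sgs j.+1 g) = sgs j (sgd i g).
Proof. exact: (@dface_degen_lt (sg_sset F)). Qed.

Lemma sgd_sgs_gt n i j (g : F n.+1) : (j < i <= n.+1)%N ->
  sgd i.+1 (sgs j g) = sgs j (sgd i g).
Proof. exact: (@dface_degen_gt (sg_sset F)). Qed.

Lemma sgs_sgs n i j (g : F n) : (i <= j <= n)%N ->
  sgs i (sgs j g) = sgs j.+1 (sgs i g).
Proof. exact: (@ddegen_degen (sg_sset F)). Qed.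

Lemma sgs_inj n i : (i <= n)%N -> injective (@sgs n i).
Proof. by move=> h g g' e; rewrite -(sgd_sgs g h) e sgd_sgs. Qed.

Definition wentry n (y : Wbar F n) (i : nat) : F n := entry (y : Wgroup (F n) n) i.

Definition wbar n (e : nat -> F n) : Wbar F n := bar n e.

Lemma wentry_bar n e i : (i < n)%N -> wentry (@wbar n e) i = e i.
Proof. exact: entry_bar. Qed.

Lemma wentry_inj n (x y : Wbar F n) :
  (forall i, (i < n)%N -> wentry x i = wentry y i) -> x = y.
Proof. exact: entry_inj. Qed.

Lemma wentry_face n k (y : Wbar F n.+1) i : (k <= n.+1)%N -> (i < n)%N ->
  wentry (dface k y) i = sgd k (vface k (wentry y) i).
Proof.
move=> hk hi; rewrite /wentry.
apply: (etrans (@entry_face _ _ k (Wgroup_map (sg_face F (inord k)) n.+1 y) i hk hi)).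
have em j : (j < n.+1)%N ->
    entry (Wgroup_map (sg_face F (inord k)) n.+1 y) j = sgd k (entry (y : Wgroup _ _) j).
  exact: entry_map.
by rewrite /vface; case: ltngtP => h; rewrite ?sgdM !em //; lia.
Qed.

Lemma wentry_degen n k (y : Wbar F n) i : (k <= n)%N -> (i <= n)%N ->
  wentry (ddegen k y) i = sgs k (vdegen k (wentry y) i).
Proof.
move=> hk hi; rewrite /wentry.
apply: (etrans (@entry_degen _ _ k (Wgroup_map (sg_degen F (inord k)) n y) i hk hi)).
have em j : (j < n)%N ->
    entry (Wgroup_map (sg_degen F (inord k)) n y) j = sgs k (entry (y : Wgroup _ _) j).
  exact: entry_map.
by rewrite /vdegen; case: ltngtP => h; rewrite ?sgs1 ?em //; lia.
Qed.

End WbarEntries.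

(** * Reduced words in free products *)

(* Words are read from right to left: the head of a word is its rightmost letter. *)
Section NormalForm.
Variables (G : groupType) (X : Type) (x0 : X).
Local Open Scope group_scope.
Local Notation FP := (free_prod G x0).
Local Notation letter x g := (fp_in x0 x g).
Local Notation word := (seq (G * X)).
Implicit Types (w : word) (p : G * X) (f : FP).

(** Van der Waerden's method: letters act on reduced words by right multiplication and the action
    satisfies the defining relations, so uniqueness of normal forms needs no confluence argument. *)
Definition rmul w p : word :=
  if `[< p.1 = 1 \/ p.2 = x0 >] then w else
  if w is q :: w' then
    if `[< q.2 = p.2 >] then
      if `[< q.1 * p.1 = 1 >] then w' else (q.1 * p.1, q.2) :: w'
    else p :: w
  else [:: p].

Definition headN w (x : X) : Prop := if w is q :: _ then q.2 <> x else True.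

Fixpoint reduced w : Prop :=
  if w is p :: w' then [/\ p.1 <> 1, p.2 <> x0, headN w' p.2 & reduced w'] else True.

Lemma rmul_triv w g x : g = 1 \/ x = x0 -> rmul w (g, x) = w.
Proof. by move=> h; rewrite /rmul /= asboolT. Qed.

Lemma rmul_headN w g x : g <> 1 -> x <> x0 -> headN w x -> rmul w (g, x) = (g, x) :: w.
Proof.
move=> g1 xx; rewrite /rmul /= asboolF; last by case.
by case: w => // q w qp; rewrite asboolF.
Qed.

Lemma rmul_same w g h x : h <> 1 -> x <> x0 ->
  rmul ((g, x) :: w) (h, x) = if `[< g * h = 1 >] then w else (g * h, x) :: w.
Proof. by move=> h1 xx; rewrite /rmul /= asboolF ?(asboolT (erefl x)) //; case. Qed.

Lemma rmul_reduced w p : reduced w -> reduced (rmul w p).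
Proof.
case: p => g x rw; have [h|/not_orP[g1 xx]] := pselect (g = 1 \/ x = x0).
  by rewrite rmul_triv.
have [hw|] := pselect (headN w x); first by rewrite rmul_headN.
case: w rw => // -[q y] w [/= q1 _ wy rw] /contrapT yx; subst y.
by rewrite rmul_same //; case: asboolP.
Qed.

Lemma rmul_mul w x g h : reduced w ->
  rmul (rmul w (g, x)) (h, x) = rmul w (g * h, x).
Proof.
move=> rw; have [xx|xx] := pselect (x = x0); first by rewrite !rmul_triv; try right.
have triv1 u : rmul u (1, x) = u by rewrite rmul_triv //; left.
have [-> |g1] := pselect (g = 1); first by rewrite mul1g triv1.
have [-> |h1] := pselect (h = 1); first by rewrite mulg1 triv1.
have [hw|] := pselect (headN w x).
  rewrite (rmul_headN g1 xx hw) rmul_same //; case: asboolP => gh; last by rewrite rmul_headN.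
  by rewrite gh triv1.
case: w rw => // -[q y] w [/= q1 _ wy rw] /contrapT yx; subst y.
rewrite (rmul_same _ _ g1) //; case: asboolP => qg.
  have qe : q = g^-1 by rewrite -[LHS]mulg1 -(mulgV g) mulgA qg mul1g.
  rewrite rmul_headN //; have [gh|gh] := pselect (g * h = 1).
    by rewrite gh triv1 qe -[in RHS](mulg1 g^-1) -gh mulgA mulVg mul1g.
  by rewrite rmul_same // qe mulgA mulVg mul1g asboolF.
have [gh|gh] := pselect (g * h = 1).
  by rewrite rmul_same // gh triv1 -mulgA gh mulg1 asboolF.
by rewrite !rmul_same // mulgA.
Qed.

Lemma rmul_size w p : (size (rmul w p) <= (size w).+1)%N.
Proof. by rewrite /rmul; case: ifP => // _; case: w => // q w; do 2 case: ifP => //=; lia. Qed.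

Lemma rmul_sizeE w p : size (rmul w p) = (size w).+1 -> rmul w p = p :: w.
Proof.
rewrite /rmul; case: ifP => _; first by lia.
by case: w => // q w; do 2 case: ifP => //= _; lia.
Qed.

Definition nfw w (u : word) : word := foldl rmul w u.

Lemma nfw_reduced w u : reduced w -> reduced (nfw w u).
Proof. by elim: u w => //= p u ih w rw; apply/ih/rmul_reduced. Qed.

Lemma nfw_step w u v : reduced w -> fp_step x0 u v -> nfw w u = nfw w v.
Proof.
move=> rw; case=> {u v} [u v g h x|u v x|u v g]; rewrite /nfw !foldl_cat /=.
- by rewrite rmul_mul //; exact: nfw_reduced.
- by rewrite rmul_triv //; left.
- by rewrite rmul_triv //; right.
Qed.

Definition nf f : word := gen_lift (fun u : fp_word G X => nfw [::] u) f.

Definition fp_of (u : word) : FP := gen_pi (@fp_step G X x0) u.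

Lemma nf_of (u : word) : nf (fp_of u) = nfw [::] u.
Proof. by apply: gen_lift_pi => a b; exact: nfw_step. Qed.

Lemma nf_reduced f : reduced (nf f).
Proof. by move: f; apply: gen_quotW => u; rewrite nf_of; exact: nfw_reduced. Qed.

Fixpoint val_word w : FP := if w is p :: w' then val_word w' * letter p.2 p.1 else 1.

Lemma val_rmul w p : val_word (rmul w p) = val_word w * letter p.2 p.1.
Proof.
rewrite /rmul; case: asboolP => [[->|->]|_] /=.
- by rewrite mulhom1 mulg1.
- by rewrite fp_in_pt mulg1.
case: w => [|q w] //=; case: asboolP => //= e; rewrite -e -mulgA -gmulfM.
by case: asboolP => //= ->; rewrite mulhom1 mulg1.
Qed.

Lemma fp_of_cons p (u : word) : fp_of (p :: u) = letter p.2 p.1 * fp_of u.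
Proof. by rewrite [RHS]fp_mulE; case: p. Qed.

Lemma val_nfw w u : val_word (nfw w u) = val_word w * fp_of u.
Proof.
elim: u w => [|p u ih] w /=; first by rewrite [fp_of _]/(1 : FP) mulg1.
by rewrite ih val_rmul -mulgA fp_of_cons.
Qed.

Lemma nfK : cancel nf val_word.
Proof. by apply: gen_quotW => u; rewrite nf_of val_nfw mul1g. Qed.

Lemma nf_mulr f x g : nf (f * letter x g) = rmul (nf f) (g, x).
Proof.
move: f; apply: gen_quotW => u; rewrite [_ * _]fp_mulE !nf_of.
by rewrite /nfw foldl_cat.
Qed.

Lemma nf1 : nf 1 = [::].
Proof. exact: (nf_of [::]). Qed.

Lemma nf_val w : reduced w -> nf (val_word w) = w.
Proof.
elim: w => [|[g x] w ih] /=; first by rewrite nf1.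
by case=> g1 xx wx /ih e; rewrite nf_mulr e rmul_headN.
Qed.

Definition len f : nat := size (nf f).

Definition hd f : option X := ohead [seq p.2 | p <- nf f].

Lemma len_eq0 f : len f = 0%N -> f = 1.
Proof. by move=> /size0nil e; rewrite -(nfK f) e. Qed.

Lemma len1 : len 1 = 0%N.
Proof. by rewrite /len nf1. Qed.

(** Appending the letters of g one by one adds at most one to the length each time. If nothing is
    lost, the last letter is appended without merging and remains last. *)
Lemma lenM_hd f g : (len (f * g)%g <= len f + len g)%N /\
  (len (f * g) = (len f + len g)%N -> g <> 1 -> hd (f * g) = hd g).
Proof.
rewrite -(nfK g); move: (nf g) (nf_reduced g) => w {g}.
elim: w => [|p w ih] rw; first by rewrite mulg1 len1 addn0.
have [_ _ _ rw'] := rw; have [le _] := ih rw'; move: le.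
rewrite [len (val_word (p :: w))]/len nf_val // [len (val_word w)]/len nf_val //= => le.
rewrite mulgA /len nf_mulr -surjective_pairing addnS; split.
  by apply: leq_trans (rmul_size _ _) _; rewrite ltnS.
move=> e _; have h := rmul_size (nf (f * val_word w)) p.
have en : nf (f * val_word w * letter p.2 p.1) = p :: nf (f * val_word w).
  by rewrite nf_mulr -surjective_pairing; apply: rmul_sizeE; move: h le; rewrite e /len; lia.
by rewrite /hd en -[val_word w * _]/(val_word (p :: w)) nf_val.
Qed.

Lemma lenM f g : (len (f * g)%g <= len f + len g)%N.
Proof. exact: (lenM_hd f g).1. Qed.

Lemma hdM f g : len (f * g) = (len f + len g)%N -> g <> 1 -> hd (f * g) = hd g.
Proof. exact: (lenM_hd f g).2. Qed.

Lemma len_letter f : len f = 1%N ->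
  exists g x, [/\ f = letter x g, g <> 1, x <> x0, nf f = [:: (g, x)] & hd f = Some x].
Proof.
rewrite /hd /len; move: (nfK f) (nf_reduced f).
case: (nf f) => [|[g x] [|]] //= <- [g1 xx _ _] _; exists g, x.
by rewrite mul1g; split.
Qed.

Lemma nf_letter x g : g <> 1 -> x <> x0 -> nf (letter x g) = [:: (g, x)].
Proof. by move=> g1 xx; rewrite -[letter x g]mul1g nf_mulr nf1 rmul_headN. Qed.

Lemma nf_snoc f l : len l = 1%N -> f = 1 \/ hd f <> hd l -> nf (f * l) = nf l ++ nf f.
Proof.
case/len_letter=> g [x [-> g1 xx -> ->]] fl; rewrite nf_mulr rmul_headN //.
case: fl => [->|]; first by rewrite nf1.
by rewrite /hd; case: (nf f) => // q w /= ne e; apply: ne; rewrite e.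
Qed.

Lemma len_snoc f l : len l = 1%N -> f = 1 \/ hd f <> hd l -> len (f * l) = (len f).+1.
Proof. by move=> l1 fl; rewrite /len nf_snoc // size_cat addnC -/(len l) l1 addn1. Qed.

Lemma snoc_inj f l f' l' : len l = 1%N -> f = 1 \/ hd f <> hd l ->
  len l' = 1%N -> f' = 1 \/ hd f' <> hd l' -> f * l = f' * l' -> f = f' /\ l = l'.
Proof.
move=> l1 fl l1' fl' e; have := f_equal nf e; rewrite !nf_snoc //.
case: (len_letter l1) => g [x [-> _ _ -> _]]; case: (len_letter l1') => g' [x' [-> _ _ -> _]].
by move=> [-> -> /(can_inj nfK) ->].
Qed.

Lemma split_last f : f <> 1 ->
  exists f' l, [/\ f = f' * l, len l = 1%N, hd l = hd f & f' = 1 \/ hd f' <> hd l].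
Proof.
move=> f1; move: (nfK f) (nf_reduced f); rewrite /hd.
case: (nf f) => [/esym //|[g x] w] /= <- [g1 xx wx rw].
exists (val_word w), (letter x g); split=> //; rewrite /len /hd ?nf_letter // nf_val //.
by case: w wx {rw} => [|q w] /= ne; [left|right => -[]].
Qed.

Lemma len_same f g : len f = 1%N -> len g = 1%N -> hd f = hd g ->
  (len (f * g)%g <= 1)%N /\ (f * g <> 1 -> hd (f * g) = hd f).
Proof.
move=> /len_letter[a [x [-> a1 xx e1 ->]]] /len_letter[b [y [-> b1 yy e2 ->]]] [e]; subst y.
rewrite /len /hd nf_mulr e1 rmul_same //; case: asboolP => // ab; split=> // n1.
by case: n1; rewrite -[LHS]nfK nf_mulr e1 rmul_same // asboolT.
Qed.

End NormalForm.

Section NormalFormMap.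
Variables (G G' : groupType) (X X' : Type) (x0 : X) (x0' : X').
Variable phi : {multiplicative free_prod G x0 -> free_prod G' x0'}.
Variables (a : X -> G -> G') (b : X -> X').
Hypothesis phi_in : forall x g, phi (fp_in x0 x g) = fp_in x0' (b x) (a x g).

Lemma len_map f : (len (phi f) <= len f)%N.
Proof.
suff h w : (size (nf (phi (val_word x0 w))) <= size w)%N.
  by have := h (nf f); rewrite nfK.
elim: w => [|[g x] w ih] /=; first by rewrite mulhom1 nf1.
rewrite gmulfM phi_in nf_mulr; exact: leq_trans (rmul_size _ _ _) _.
Qed.

Hypothesis b_inj : injective b.
Hypothesis b_pt : b x0 = x0'.
Hypothesis a_inj : forall x g, a x g = 1%g -> g = 1%g.

(** Distinct factors stay distinct and no letter becomes trivial, so letters that did not interact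
    still do not. Degeneracies are of this kind; faces in general satisfy only [len_map]. *)
Lemma nf_map f : nf (phi f) = [seq (a p.2 p.1, b p.2) | p <- nf f].
Proof.
rewrite -{1}(nfK f); move: (nf_reduced f); elim: (nf f) => [|[g x] w ih] /=.
  by rewrite mulhom1 nf1.
case=> g1 xx wx rw; rewrite gmulfM phi_in nf_mulr ih // rmul_headN //.
- by move/a_inj.
- by rewrite -b_pt => /b_inj.
- by case: w wx {ih rw} => //= q w qx /b_inj.
Qed.

End NormalFormMap.

(** * Counting and degenerate directions on the diagonal *)

Section Sums.
Local Open Scope nat_scope.

(** The additive counterpart of [vface]: an inner face adds two neighbouring weights, an outer face
    drops one. *)
Definition fsum (j : nat) (w : nat -> nat) (i : nat) : nat :=
  if i.+1 < j then w i else if i.+1 == j then w i.+1 + w i else w i.+1.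

Lemma sum_fsum n j (w : nat -> nat) : j <= n.+1 ->
  \sum_(i < n.+1) w i =
  \sum_(i < n) fsum j w i + (if j == 0 then w 0 else 0) + (if j == n.+1 then w n else 0).
Proof.
elim: n j => [|n ih] j hj.
  by rewrite big_ord_recl !big_ord0; case: j hj => [|[|]] //= _; rewrite ?addn0 ?add0n.
rewrite big_ord_recr /=; have [->|ne] := eqVneq j n.+2.
  rewrite /= addn0; congr (_ + _); apply: eq_bigr => i _.
  by rewrite /fsum ltnS ltn_ord.
have {}hj : j <= n.+1 by lia.
rewrite (ih j hj) [in RHS]big_ord_recr /= /fsum; move: (\sum_(i < n) _) => s.
have [->|_] := eqVneq j n.+1; first by rewrite ltnn /=; lia.
have -> : (n.+1 < j)%N = false by lia.
by case: ifP => _; lia.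
Qed.

Lemma eq_sum_le n (a b : nat -> nat) : (forall i, i < n -> a i <= b i) ->
  \sum_(i < n) b i <= \sum_(i < n) a i -> forall i, i < n -> a i = b i.
Proof.
elim: n => // n ih ab.
have h1 : \sum_(i < n) a i <= \sum_(i < n) b i.
  by apply: leq_sum => j _; apply: ab; exact: leqW.
rewrite !big_ord_recr /= => le i; have h2 := ab n (ltnSn n).
have {}ih : \sum_(i < n) b i <= \sum_(i < n) a i -> forall i, i < n -> a i = b i.
  by apply: ih => k kn; apply: ab; exact: leqW.
move: h1 le ih; set s := \sum_(i < n) a i; set t := \sum_(i < n) b i => h1 le ih.
rewrite ltnS leq_eqVlt => /orP[/eqP ->|]; first by lia.
by apply: ih; lia.
Qed.

End Sums.

Section Fixs.
Variable F : sgroup.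

(* [g] lies in the image of the [i]-th degeneracy. *)
Definition fixs n i (g : F n.+1) : Prop := sgs i (sgd i g) = g.

Lemma fixs_sgs n i (g : F n) : (i <= n)%N -> fixs i (sgs i g).
Proof. by move=> h; rewrite /fixs sgd_sgs. Qed.

Lemma fixsP n i (g : F n.+1) : fixs i g -> exists h, g = sgs i h.
Proof. by move=> e; exists (sgd i g). Qed.

Lemma fixs_sgdS n i (g : F n.+1) : (i <= n)%N -> fixs i g -> sgd i.+1 g = sgd i g.
Proof. by move=> h /fixsP[u ->]; rewrite sgd_sgsS // sgd_sgs. Qed.

Lemma fixsM n i (g h : F n.+1) : fixs i g -> fixs i h -> fixs i (g * h)%g.
Proof. by rewrite /fixs sgdM sgsM => -> ->. Qed.

Lemma fixs1 n i : fixs i (1%g : F n.+1).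
Proof. by rewrite /fixs sgd1 sgs1. Qed.

Lemma fixs_up_lt n i b (g : F n.+1) : (i < b <= n.+1)%N -> fixs i g -> fixs i (sgs b g).
Proof.
case: b => // b /andP[ib bn] /fixsP[u ->].
have h1 : (i <= b <= n)%N by apply/andP; split.
have h2 : (i <= n.+1)%N by lia.
by rewrite -(sgs_sgs u h1); exact: fixs_sgs.
Qed.

Lemma fixs_up_ge n i b (g : F n.+1) : (b <= i <= n)%N -> fixs i g -> fixs i.+1 (sgs b g).
Proof. by move=> h /fixsP[u ->]; rewrite sgs_sgs //; apply: fixs_sgs; lia. Qed.

Lemma fixs_down_lt n i b (g : F n.+1) : (i < b <= n.+1)%N -> fixs i (sgs b g) -> fixs i g.
Proof.
move=> ib /fixsP[u e].
have [v [_ ->]] := @ddegen_eq (sg_sset F) n i b u g ib (esym e).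
by apply: (@fixs_sgs n i v); lia.
Qed.

Lemma fixs_down_gt n i b (g : F n.+1) : (b < i <= n.+1)%N -> fixs i (sgs b g) -> fixs i.-1 g.
Proof.
move=> ib /fixsP[u e].
have [v [-> _]] := @ddegen_eq (sg_sset F) n b i g u ib e.
by apply: (@fixs_sgs n i.-1 v); lia.
Qed.

Lemma fixs_face_lt n i j (g : F n.+2) : (i.+1 < j <= n.+2)%N -> fixs i g -> fixs i (sgd j g).
Proof.
case: j => [|j] // /andP[ij jn] /fixsP[u ->].
rewrite sgd_sgs_gt; last by apply/andP; split.
by apply: fixs_sgs; lia.
Qed.

Lemma fixs_face_gt n i j (g : F n.+2) : (j <= i <= n)%N -> fixs i.+1 g -> fixs i (sgd j g).
Proof. by move=> h /fixsP[u ->]; rewrite sgd_sgs_lt //; apply: fixs_sgs; lia. Qed.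

Lemma fixs_face_both n i (g : F n.+2) : (i <= n)%N -> fixs i g -> fixs i.+1 g ->
  fixs i (sgd i.+1 g).
Proof.
move=> h fi /fixsP[u e].
rewrite e in fi *; rewrite sgd_sgs //.
by apply: fixs_down_lt fi; rewrite leqnn.
Qed.

(** A diagonal simplex behaves like a path in a product: step i moves in the nerve if entry i is
    nontrivial, and in the group unless [hdeg y i]. *)
Definition hdeg n : Wbar F n -> nat -> Prop :=
  match n return Wbar F n -> nat -> Prop with
  | 0 => fun _ _ => False
  | m.+1 => fun y i => (i <= m)%N /\ forall q, (q <= m)%N -> fixs i (wentry y q)
  end.

(** A diagonal degeneracy repeats in both directions at once, so degenerate means that some step
    moves in neither. In the converse, face i multiplies by a trivial entry and is undone by
    [fixs]. *)
Lemma degenerateP n (y : Wbar F n.+1) :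
  degenerate y <-> exists i, hdeg y i /\ wentry y i = 1%g.
Proof.
split=> [[i [w [iw ->]]]|[i [[iN fi] e1]]].
  exists i; split; last by rewrite wentry_degen // /vdegen ltnn eqxx sgs1.
  by split=> // q qn; rewrite wentry_degen //; exact: fixs_sgs.
exists i, (dface i y); split=> //; apply: wentry_inj => q qn.
rewrite wentry_degen // /vdegen; case: ltngtP => [qi|iq|->]; last by rewrite sgs1.
  rewrite wentry_face ?leqW //; last lia.
  rewrite /vface; case: ltngtP => [_|h|h]; [by rewrite fi|lia|].
  by rewrite h e1 mul1g fi.
rewrite wentry_face ?leqW //; last lia.
rewrite /vface; case: ltngtP => [h|_|h]; [lia| |lia].
by rewrite prednK ?fi //; lia.
Qed.

Lemma fixs_vface n i j (e : nat -> F n.+1) q :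
  fixs i (e q) -> fixs i (e q.+1) -> fixs i (vface j e q).
Proof. by move=> h h'; rewrite /vface; case: ltngtP => _ //; exact: fixsM. Qed.

Lemma hdeg_face_lt n i j (y : Wbar F n.+2) : (i.+1 < j <= n.+2)%N ->
  hdeg y i -> hdeg (dface j y) i.
Proof.
move=> h [iN fi]; split=> [|q qn]; first lia.
rewrite wentry_face //; last lia.
by apply: fixs_face_lt => //; apply: fixs_vface; apply: fi; lia.
Qed.

Lemma hdeg_face_gt n i j (y : Wbar F n.+2) : (j <= i)%N ->
  hdeg y i.+1 -> hdeg (dface j y) i.
Proof.
move=> h [iN fi]; split=> [|q qn]; first lia.
rewrite wentry_face //; try lia.
by apply: fixs_face_gt; [lia|apply: fixs_vface; apply: fi; lia].
Qed.

Lemma hdeg_face_both n i (y : Wbar F n.+2) :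
  hdeg y i -> hdeg y i.+1 -> hdeg (dface i.+1 y) i.
Proof.
move=> [iN fi] [iN' fi']; split=> [|q qn]; first lia.
rewrite wentry_face //; try lia.
by apply: fixs_face_both; [lia|apply: fixs_vface; apply: fi; lia|
  apply: fixs_vface; apply: fi'; lia].
Qed.

Definition nonh n (y : Wbar F n) (i : nat) : nat := ~~ `[< hdeg y i >].

Lemma nonh_le n (y : Wbar F n) i m (z : Wbar F m) j :
  (hdeg z j -> hdeg y i) -> (nonh y i <= nonh z j)%N.
Proof. by move=> h; rewrite /nonh; case: asboolP => //; case: asboolP => // /h. Qed.

Lemma nonh0 n (y : Wbar F n) i : nonh y i = 0%N <-> hdeg y i.
Proof. by rewrite /nonh; case: asboolP. Qed.

Lemma nonh_face n j (y : Wbar F n.+1) i : (j <= n.+1)%N -> (i < n)%N ->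
  (nonh (dface j y) i <= fsum j (nonh y) i)%N.
Proof.
case: n y => // n y hj hi; rewrite /fsum; case: ltngtP => [ij|ij|ij].
- by apply: nonh_le; apply: hdeg_face_lt; rewrite ij.
- by apply: nonh_le; exact: hdeg_face_gt.
- subst j; rewrite /nonh; case: asboolP => //= nd; case: asboolP => h1 //=.
  by case: asboolP => h2 //; case: nd; exact: hdeg_face_both.
Qed.

End Fixs.

(** * The matching on the bar construction *)

Section Regions.
Variable H : groupType.
Implicit Types e : nat -> H.
Local Open Scope group_scope.

Lemma vface_lt j e i : (i.+1 < j)%N -> vface j e i = e i.
Proof. by rewrite /vface => ->. Qed.

Lemma vface_eq e i : vface i.+1 e i = e i.+1 * e i.
Proof. by rewrite /vface ltnn eqxx. Qed.

Lemma vface_gt j e i : (j <= i)%N -> vface j e i = e i.+1.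
Proof. by rewrite /vface; case: ltngtP => // h; lia. Qed.

Lemma vdegen_lt k e i : (i < k)%N -> vdegen k e i = e i.
Proof. by rewrite /vdegen => ->. Qed.

Lemma vdegen_eq k e : vdegen k e k = 1.
Proof. by rewrite /vdegen ltnn eqxx. Qed.

Lemma vdegen_gt k e i : (k <= i)%N -> vdegen k e i.+1 = e i.
Proof. by rewrite /vdegen; case: ltngtP => // h; lia. Qed.

(** The last letter l comes first because [vface] puts the later entry on the left, so that merging
    restores w * l. *)
Definition vins e (m : nat) (w l : H) (i : nat) : H :=
  if (i < m)%N then e i else if i == m then l else if i == m.+1 then w else e i.-1.

Lemma vins_lt e m w l i : (i < m)%N -> vins e m w l i = e i.
Proof. by rewrite /vins => ->. Qed.

Lemma vins_eq e m w l : vins e m w l m = l.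
Proof. by rewrite /vins ltnn eqxx. Qed.

Lemma vins_eqS e m w l : vins e m w l m.+1 = w.
Proof.
rewrite /vins; have [-> ->] : (m.+1 < m)%N = false /\ (m.+1 == m) = false by lia.
by rewrite eqxx.
Qed.

Lemma vins_gt e m w l i : (m < i)%N -> vins e m w l i.+1 = e i.
Proof.
move=> h; rewrite /vins; have [-> [-> ->]] // : (i.+1 < m)%N = false /\
  (i.+1 == m) = false /\ (i.+1 == m.+1) = false by lia.
Qed.

End Regions.

(* [len] is the length of reduced words and [hd] the factor containing the last letter. *)
Section Pairing.
Variables (F : sgroup) (X : nat -> Type).
Variables (len : forall n, F n -> nat) (hd : forall n, F n -> option (X n)).
Local Open Scope group_scope.

Hypothesis len1 : forall n, len (1 : F n) = 0%N.
Hypothesis len_eq0 : forall n (f : F n), len f = 0%N -> f = 1.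
Hypothesis lenM : forall n (f g : F n), (len (f * g)%g <= len f + len g)%N.
Hypothesis hdM : forall n (f g : F n),
  len (f * g) = (len f + len g)%N -> g <> 1 -> hd (f * g) = hd g.
Hypothesis len_snoc : forall n (f l : F n), len l = 1%N -> f = 1 \/ hd f <> hd l ->
  len (f * l) = (len f).+1.
Hypothesis snoc_inj : forall n (f l f' l' : F n),
  len l = 1%N -> f = 1 \/ hd f <> hd l ->
  len l' = 1%N -> f' = 1 \/ hd f' <> hd l' -> f * l = f' * l' -> f = f' /\ l = l'.
Hypothesis split_last : forall n (f : F n), f <> 1 ->
  exists f' l, [/\ f = f' * l, len l = 1%N, hd l = hd f & f' = 1 \/ hd f' <> hd l].
Hypothesis len_same : forall n (f g : F n), len f = 1%N -> len g = 1%N -> hd f = hd g ->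
  (len (f * g)%g <= 1)%N.
Hypothesis len_sgd : forall n i (f : F n.+1), (len (sgd i f) <= len f)%N.
Hypothesis len_sgs : forall n i (f : F n), (i <= n)%N -> len (sgs i f) = len f.
Hypothesis hd_sgs : forall n i (f g : F n), (i <= n)%N ->
  hd (sgs i f) = hd (sgs i g) <-> hd f = hd g.

Definition one_factor n (e : nat -> F n) (m : nat) : Prop :=
  (forall i, (i < m)%N -> (len (e i) <= 1)%N) /\
  (forall i j, (i < m)%N -> (j < m)%N -> e i <> 1 -> e j <> 1 -> hd (e i) = hd (e j)).

Definition pre n (e : nat -> F n) (N b m : nat) : Prop :=
  [/\ (b < m < N)%N, one_factor e m, e b <> 1 & 
    [/\ forall i, (b < i < m)%N -> e i = 1, e m <> 1 & hd (e m) <> hd (e b)]].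

(* Let [e m] be the first entry such that [e 0], ..., [e m] do not lie in one free
   factor.  If [e m] ends in the factor of the preceding entries, the simplex is paired
   with the one where the last letter of [e m] is split off ([typeB], [insB]).
   Otherwise let [e b] be the last nontrivial entry before [e m]: either the [b]-th step
   is constant in the simplicial direction of the group ([hdeg y b]) and the simplex is
   paired with its face [b.+1] ([tau]), or the simplex is paired with the one where this
   step is split into a step of the nerve and a step of the group ([typeA], [insA]). *)
Definition tau n (y : Wbar F n) (k : nat) : Prop :=
  ~ degenerate y /\ exists b m, [/\ k = b.+1, pre (wentry y) n b m & hdeg y b].

Definition typeA n (y : Wbar F n) (k : nat) : Prop :=
  ~ degenerate y /\ exists b m, [/\ k = b.+1, pre (wentry y) n b m & ~ hdeg y b].

(** The last clause is vacuous if all entries before m are trivial; then [e m] leaves every factor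
    by its length alone. *)
Definition full n (e : nat -> F n) (N m : nat) : Prop :=
  [/\ (m < N)%N, one_factor e m, (1 < len (e m))%N &
    forall i, (i < m)%N -> e i <> 1 -> hd (e i) = hd (e m)].

Definition typeB n (y : Wbar F n) (k : nat) : Prop :=
  ~ degenerate y /\ exists m, k = m.+1 /\ full (wentry y) n m.

Lemma len_gt1 n (f : F n) : (0 < len f)%N -> f <> 1.
Proof. by move=> h e; rewrite e len1 in h. Qed.

Lemma len_gt0 n (f : F n) : f <> 1 -> (0 < len f)%N.
Proof. by move=> f1; rewrite lt0n; apply/eqP => /len_eq0. Qed.

Lemma pre_not_one_factor n (e : nat -> F n) N b m p : pre e N b m -> (m < p)%N -> ~ one_factor e p.
Proof.
case=> /andP[bm _] _ b1 [_ m1 ne] mp [_ h].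
by case: ne; apply: h => //; exact: ltn_trans mp.
Qed.

Lemma full_not_one_factor n (e : nat -> F n) N m p : full e N m -> (m < p)%N -> ~ one_factor e p.
Proof. by case=> _ _ l _ mp [/(_ m mp)]; lia. Qed.

Lemma pre_inj n (e : nat -> F n) N b m b' m' : pre e N b m -> pre e N b' m' ->
  b = b' /\ m = m'.
Proof.
move=> h h'; have em : m = m'.
  case: (ltngtP m m') => // mm; [case: (pre_not_one_factor h mm)|case: (pre_not_one_factor h' mm)].
    by case: h'.
  by case: h.
subst m'; split=> //; case: h => /andP[bm _] _ b1 [z _ _].
case: h' => /andP[bm' _] _ b1' [z' _ _].
by case: (ltngtP b b') => // bb; [case: b1'; apply: z|case: b1; apply: z']; rewrite bb.
Qed.

Lemma full_inj n (e : nat -> F n) N m m' : full e N m -> full e N m' -> m = m'.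
Proof.
move=> h h'; case: (ltngtP m m') => // mm;
  [case: (full_not_one_factor h mm)|case: (full_not_one_factor h' mm)].
  by case: h'.
by case: h.
Qed.

Lemma pre_full n (e : nat -> F n) N b m m' : pre e N b m -> ~ full e N m'.
Proof.
move=> h h'; have em : m = m'.
  case: (ltngtP m m') => // mm; [case: (pre_not_one_factor h mm)|case: (full_not_one_factor h' mm)].
    by case: h'.
  by case: h.
subst m'; case: h => /andP[bm _] _ b1 [_ _ ne]; case: h' => _ _ _ h.
by case: ne; rewrite h.
Qed.

Lemma eq_one_factor n (e e' : nat -> F n) m : (forall i, (i < m)%N -> e i = e' i) ->
  one_factor e m -> one_factor e' m.
Proof. by move=> ee [h1 h2]; split=> [i im|i j im jm]; rewrite -!ee //; [exact: h1|exact: h2]. Qed.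

Lemma eq_pre n (e e' : nat -> F n) N b m : (forall i, (i < N)%N -> e i = e' i) ->
  pre e N b m -> pre e' N b m.
Proof.
move=> ee [bm g b1 [z m1 ne]]; have bN : (b < N)%N by lia.
have mN : (m < N)%N by lia.
split; rewrite -?ee //; first by apply: eq_one_factor g => i im; apply: ee; lia.
by split=> // i bi; rewrite -ee; [exact: z|lia].
Qed.

Lemma sgs_neq1 n i (f : F n) : (i <= n)%N -> f <> 1 -> sgs i f <> 1.
Proof. by move=> h f1 e; apply: f1; apply: (sgs_inj h); rewrite sgs1. Qed.

Lemma one_factor_sgs n (e : nat -> F n) b m : (b <= n)%N ->
  one_factor (fun i => sgs b (e i)) m <-> one_factor e m.
Proof.
move=> bn; split=> -[h1 h2]; split=> [i im|i j im jm i1 j1].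
- by rewrite -(len_sgs (e i) bn); exact: h1.
- by apply/(hd_sgs _ _ bn); apply: h2 => //; exact: sgs_neq1.
- by rewrite (len_sgs (e i) bn); exact: h1.
- by apply/(hd_sgs _ _ bn); apply: h2 => // e1; [apply: i1|apply: j1]; rewrite e1 sgs1.
Qed.

Lemma pre_sgs n (e : nat -> F n) N k b m : (k <= n)%N ->
  pre (fun i => sgs k (e i)) N b m <-> pre e N b m.
Proof.
move=> kn; split=> -[bm g b1 [z m1 ne]]; split => //.
- exact/(one_factor_sgs _ _ kn).
- by move=> e1; apply: b1; rewrite e1 sgs1.
- split=> [i /z|e1|]; first by rewrite -(sgs1 F n k) => /(sgs_inj kn).
    by apply: m1; rewrite e1 sgs1.
  by move/(hd_sgs _ _ kn).
- exact/(one_factor_sgs _ _ kn).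
- exact: sgs_neq1.
- split=> [i /z ->||]; [exact: sgs1|exact: sgs_neq1|].
  by move/(hd_sgs _ _ kn).
Qed.

(** The nerve is degenerated at b + 1 and the group at b. This offset makes step b move only in the
    nerve and step b + 1 only in the group. *)
Definition insA n (y : Wbar F n) (b : nat) : Wbar F n.+1 :=
  wbar (fun i => sgs b (vdegen b.+1 (wentry y) i)).

Definition insB n (y : Wbar F n) (m : nat) (w l : F n) : Wbar F n.+1 :=
  wbar (fun i => sgs m (vins (wentry y) m w l i)).

Lemma hdeg_sgs n (z : Wbar F n.+1) k (v : nat -> F n) : (k <= n)%N ->
  (forall i, (i <= n)%N -> wentry z i = sgs k (v i)) -> hdeg z k.
Proof. by move=> kn zv; split=> // q qn; rewrite zv //; exact: fixs_sgs. Qed.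

Lemma dface_sgs n (y : Wbar F n) (z : Wbar F n.+1) k (v : nat -> F n) : (k <= n)%N ->
  (forall i, (i <= n)%N -> wentry z i = sgs k (v i)) ->
  (forall i, (i < n)%N -> wentry y i = vface k.+1 v i) -> dface k.+1 z = y.
Proof.
move=> kn zv yv; apply: wentry_inj => i im; rewrite wentry_face // yv //.
have im' : (i <= n)%N by lia.
by rewrite /vface; case: ltngtP => _; rewrite ?sgdM !zv ?sgd_sgsS //.
Qed.

Lemma wentry_insA n (y : Wbar F n) b i : (i <= n)%N ->
  wentry (insA y b) i = sgs b (vdegen b.+1 (wentry y) i).
Proof. by move=> h; rewrite wentry_bar. Qed.

Lemma wentry_insB n (y : Wbar F n) m w l i : (i <= n)%N ->
  wentry (insB y m w l) i = sgs m (vins (wentry y) m w l i).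
Proof. by move=> h; rewrite wentry_bar. Qed.

Lemma dface_insA n (y : Wbar F n) b : (b < n)%N -> dface b.+1 (insA y b) = y.
Proof.
move=> bn; apply: (@dface_sgs _ _ _ _ (vdegen b.+1 (wentry y))); first exact: ltnW.
  by move=> i; exact: wentry_insA.
move=> i im; have [ib|bi|->] := ltngtP i b.
- by rewrite vface_lt ?vdegen_lt //; lia.
- by rewrite vface_gt // vdegen_gt.
- by rewrite vface_eq vdegen_eq vdegen_lt // mul1g.
Qed.

Lemma dface_insB n (y : Wbar F n) m w l : (m < n)%N -> wentry y m = w * l ->
  dface m.+1 (insB y m w l) = y.
Proof.
move=> mn e; apply: (@dface_sgs _ _ _ _ (vins (wentry y) m w l)); first exact: ltnW.
  by move=> i; exact: wentry_insB.
move=> i im; have [ib|bi|->] := ltngtP i m.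
- by rewrite vface_lt ?vins_lt //; lia.
- by rewrite vface_gt // vins_gt.
- by rewrite vface_eq vins_eqS vins_eq.
Qed.

Lemma pre_insA n (e : nat -> F n) N b m : pre e N b m -> pre (vdegen b.+1 e) N.+1 b m.+1.
Proof.
case=> bm [g1 g2] b1 [z m1 ne].
have vb : vdegen b.+1 e b = e b by rewrite vdegen_lt.
have vm : vdegen b.+1 e m.+1 = e m by rewrite vdegen_gt //; lia.
have vi i : (i < m.+1)%N -> vdegen b.+1 e i = 1 \/ exists2 j, (j < m)%N & vdegen b.+1 e i = e j.
  case: (ltngtP i b.+1) => [h|h|->] im; [right; exists i; [lia|exact: vdegen_lt]| |].
    by right; exists i.-1; [lia|case: i h im => // i h im; rewrite vdegen_gt //; lia].
  by left; rewrite vdegen_eq.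
split; rewrite ?vb ?vm //; first by lia.
  split=> [i /vi[->|[j jm ->]]|i j /vi[-> //|[i' im ->]] /vi[-> //|[j' jm ->]]].
  - by rewrite len1.
  - exact: g1.
  - exact: g2.
split=> // i bi; case: (ltngtP i b.+1) => [h|h|->]; [lia| |exact: vdegen_eq].
by case: i h bi => // i h bi; rewrite vdegen_gt ?z //; lia.
Qed.

Lemma tau_insA n (y : Wbar F n.+1) b m : ~ degenerate y ->
  pre (wentry y) n.+1 b m -> ~ hdeg y b -> tau (insA y b) b.+1.
Proof.
move=> nd py nb; have [/andP[bm mn] _ b1 _] := py.
have bn : (b <= n.+1)%N by lia.
have up q : (q <= n)%N -> exists2 q', (q' <= n.+1)%N & wentry (insA y b) q' = sgs b (wentry y q).
  move=> qn; have [qb|bq] := leqP q b.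
    by exists q; [lia|rewrite wentry_insA ?vdegen_lt //; lia].
  by exists q.+1; [lia|rewrite wentry_insA ?vdegen_gt //; lia].
split; last first.
  exists b, m.+1; split=> //.
    have := pre_insA py; rewrite -(pre_sgs _ _ _ _ bn); apply: eq_pre => i im.
    by rewrite wentry_insA.
  exact: (hdeg_sgs bn (fun i => @wentry_insA _ y b i)).
move=> /degenerateP[i [[iN hi]]]; rewrite wentry_insA // -(sgs1 F n.+1 b) => /(sgs_inj bn) vi.
have [ib|bi|ib] := ltngtP i b.
- apply: nd; apply/degenerateP; exists i; split; last by rewrite vdegen_lt // in vi; lia.
  split=> [|q /up[q' /hi h e]]; first lia.
  by rewrite e in h; apply: fixs_down_lt h; rewrite ib.
- case: i bi vi iN hi => // i bi vi iN hi.
  have hy : hdeg y i.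
    split=> // q /up[q' /hi h e]; rewrite e in h.
    by apply: (fixs_down_gt (i := i.+1)) h; rewrite bi.
  (* At the inserted step b + 1, degeneracy would mean [hdeg y b], contrary to type A; every other
     degenerate step comes from one of y. *)
  have [e|ne] := eqVneq i b; first by subst i.
  apply: nd; apply/degenerateP; exists i; split=> //.
  by rewrite vdegen_gt // in vi; lia.
- by subst i; rewrite vdegen_lt in vi.
Qed.

Lemma len_neq1 n (f : F n) : len f = 1%N -> f <> 1.
Proof. by move=> h; apply: len_gt1; rewrite h. Qed.

Lemma full_pre n (e : nat -> F n) N m w l : full e N m -> e m = w * l ->
  len l = 1%N -> w = 1 \/ hd w <> hd l -> pre (vins e m w l) N.+1 m m.+1.
Proof.
move=> [mN [g1 g2] em h] ew l1 wl; have w1 : w <> 1.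
  by move=> w1; rewrite ew w1 mul1g l1 in em.
have hl : hd (e m) = hd l.
  by rewrite ew; apply: hdM; [rewrite len_snoc // l1 addn1|exact: len_neq1].
split; rewrite ?vins_eq ?vins_eqS //; first by rewrite ltnSn.
- split=> [i|i j].
    by rewrite ltnS leq_eqVlt => /orP[/eqP ->|im]; rewrite ?vins_eq ?l1 ?vins_lt //; exact: g1.
  rewrite 2!ltnS (leq_eqVlt i) (leq_eqVlt j) => /orP[/eqP ->|im] /orP[/eqP ->|jm];
    rewrite ?vins_eq ?vins_lt //.
  + by move=> _ j1; rewrite h.
  + by move=> i1 _; rewrite h.
  + exact: g2.
- exact: len_neq1.
- by split=> // [i|]; [lia|case: wl].
Qed.

Lemma tau_insB n (y : Wbar F n.+1) m w l : ~ degenerate y ->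
  full (wentry y) n.+1 m -> wentry y m = w * l -> len l = 1%N ->
  w = 1 \/ hd w <> hd l -> tau (insB y m w l) m.+1.
Proof.
move=> nd fy ew l1 wl; have [mn' _ _ _] := fy.
have mn : (m <= n.+1)%N by exact: ltnW.
have w1 : w <> 1 by case: fy => _ _ + _ w1; rewrite ew w1 mul1g l1.
split; last first.
  exists m, m.+1; split=> //.
    have := full_pre fy ew l1 wl; rewrite -(pre_sgs _ _ _ _ mn); apply: eq_pre => i im.
    by rewrite wentry_insB.
  exact: (hdeg_sgs mn (fun i => @wentry_insB _ y m w l i)).
move=> /degenerateP[i [[iN hi]]]; rewrite wentry_insB // -(sgs1 F n.+1 m) => /(sgs_inj mn) vi.
have up (P : F n.+1 -> Prop) : (forall f g, P f -> P g -> P (f * g)) ->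
    (forall q, (q <= n.+1)%N -> P (vins (wentry y) m w l q)) ->
    forall q, (q <= n)%N -> P (wentry y q).
  move=> PM Pv q qn; have [qm|mq|->] := ltngtP q m.
  - by rewrite -(vins_lt _ w l qm); apply: Pv; lia.
  - by rewrite -(vins_gt _ w l mq); exact: Pv.
  - rewrite ew; apply: PM; first by rewrite -(vins_eqS (wentry y) m w l); exact: Pv.
    by rewrite -(vins_eq (wentry y) m w l); exact: Pv.
have [im|mi|im] := ltngtP i m.
- apply: nd; apply/degenerateP; exists i; split; last by rewrite vins_lt in vi.
  split; first lia.
  apply: up => [f g|q qn]; first exact: fixsM.
  have := hi q qn; rewrite wentry_insB //.
  by apply: fixs_down_lt; rewrite im.
- case: i mi vi iN hi => // i mi vi iN hi.
  have [e|ne] := eqVneq i m; first by subst i; rewrite vins_eqS in vi.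
  have mi' : (m < i)%N by lia.
  apply: nd; apply/degenerateP; exists i; split; last by rewrite vins_gt in vi.
  split=> //; apply: up => [f g|q qn]; first exact: fixsM.
  have := hi q qn; rewrite wentry_insB // => h.
  by apply: (fixs_down_gt (i := i.+1)) h; rewrite mi.
- by subst i; rewrite vins_eq in vi; case: (len_neq1 l1).
Qed.

(** The product is [s_i] of some t. Degeneracies keep lengths and the distinction of factors, so
    splitting the last letter off t and degenerating gives the unique such splitting of the
    product. *)
Lemma fixs_snoc n i (f l : F n.+1) : (i <= n)%N -> len l = 1%N ->
  f = 1 \/ hd f <> hd l -> fixs i (f * l) -> fixs i f /\ fixs i l.
Proof.
move=> iN l1 fl /fixsP[t e].
have t1 : t <> 1.
  move=> t1; have := len_snoc l1 fl; rewrite e t1 sgs1 len1; lia.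
have [f' [l' [et l1' hl' fl']]] := split_last t1.
have [] := @snoc_inj _ f l (sgs i f') (sgs i l') l1 fl _ _ _.
- by rewrite len_sgs.
- case: fl' => [->|ne]; [by left; rewrite sgs1|right].
  by move/(hd_sgs _ _ iN).
- by rewrite -sgsM -et.
- by move=> -> ->; split; exact: fixs_sgs.
Qed.

(** A matched simplex is determined by its missing face: face b + 1 either absorbs a trivial entry,
    when b + 1 < m, or multiplies [e m] with the letter [e b], when m = b + 1. Both can be
    undone. *)
Lemma tauP n (z : Wbar F n.+1) k : tau z k ->
  (exists b, [/\ k = b.+1, typeA (dface k z) k & z = insA (dface k z) b]) \/
  (exists m w l, [/\ k = m.+1, typeB (dface k z) k, z = insB (dface k z) m w l,
     wentry (dface k z) m = w * l & len l = 1%N /\ (w = 1 \/ hd w <> hd l)]).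
Proof.
case: n z => [|n] z [nd [b [m [-> pz [_ hz]]]]]; first by case: pz => /andP[]; lia.
have [/andP[bm mn] _ _ _] := pz.
have bn : (b <= n.+1)%N by lia.
pose u q := sgd b (wentry z q).
have zu q : (q <= n.+1)%N -> wentry z q = sgs b (u q) by move=> /hz.
have pu : pre u n.+2 b m by rewrite -(pre_sgs _ _ _ _ bn); apply: eq_pre pz => i; exact: zu.
set y := dface b.+1 z.
have yE q : (q <= n)%N -> wentry y q = vface b.+1 u q.
  move=> qn; rewrite wentry_face //.
  have q1 : (q <= n.+1)%N by lia.
  by rewrite /vface; case: ltngtP => _; rewrite ?sgdM !zu // !sgd_sgsS.
have [_ [g1 g2] b1 [zz m1 ne]] := pu.
(* A degenerate step i of the face would lift to z, at i or i + 1 according to the side of b,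
   against the nondegeneracy of z. *)
have lift i (w : nat -> F n.+1) : hdeg y i -> wentry y i = 1 -> i <> b ->
    (forall q, (q <= n.+1)%N -> fixs i (u q)) -> False.
  move=> [iN hi] y1 ib fu; apply: nd; apply/degenerateP; have [lt|gt|//] := ltngtP i b.
    exists i; split; last first.
      by rewrite zu ?leqW // -(vface_lt _ (j := b.+1)) // -yE // y1 sgs1.
    by split=> [|q qn]; [lia|rewrite zu //; apply: fixs_up_lt; [rewrite lt|exact: fu]].
  exists i.+1; split; last first.
    by rewrite zu // -(vface_gt _ gt) // -yE // y1 sgs1.
  by split=> // q qn; rewrite zu //; apply: fixs_up_ge; [rewrite ltnW|exact: fu].
have [bm1|] := ltnP b.+1 m.
  left; exists b; have ub1 : u b.+1 = 1 by apply: zz; rewrite ltnSn.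
  have yu q : (q <= n.+1)%N -> u q = vdegen b.+1 (wentry y) q.
    move=> qn; have [qb|bq|->] := ltngtP q b.+1; last by rewrite vdegen_eq.
      rewrite vdegen_lt // yE; last lia.
      have [->|qb'] := eqVneq q b; first by rewrite vface_eq ub1 mul1g.
      by rewrite vface_lt //; lia.
    case: q bq qn => // q bq qn; rewrite vdegen_gt ?yE ?vface_gt //; lia.
  have zA : z = insA y b.
    by apply: wentry_inj => q qn; rewrite wentry_insA // zu // yu.
  have nb : ~ hdeg y b.
    move=> [bn' hb]; apply: nd; apply/degenerateP; exists b.+1.
    split; last by rewrite zu ?ub1 ?sgs1.
    split=> // q qn; rewrite zu // yu //; apply: fixs_up_ge; first by rewrite leqnn.
    have [qb|bq|->] := ltngtP q b.+1; last by rewrite vdegen_eq; exact: fixs1.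
      by rewrite vdegen_lt //; apply: hb; lia.
    by case: q bq qn => // q bq qn; rewrite vdegen_gt //; exact: hb.
  have py : pre (wentry y) n.+1 b m.-1.
    have yl q : (q <= b)%N -> wentry y q = u q by move=> qb; rewrite yu ?vdegen_lt //; lia.
    have yg q : (b < q <= n)%N -> wentry y q = u q.+1.
      by move=> bq; rewrite yu ?vdegen_gt //; lia.
    have ex q : (q < m.-1)%N -> exists2 q', (q' < m)%N & wentry y q = u q'.
      move=> qm; have [qb|bq] := leqP q b; first by exists q; [lia|exact: yl].
      by exists q.+1; [lia|apply: yg; lia].
    have ym : wentry y m.-1 = u m by rewrite yg ?prednK //; lia.
    split; rewrite ?ym ?yl //; first lia.
      split=> [i /ex[i' im ->]|i j /ex[i' im ->] /ex[j' jm ->]]; [exact: g1|exact: g2].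
    by split=> // i bi; rewrite yg ?zz //; lia.
  split=> //; split; last by exists b, m.-1.
  move=> /degenerateP[i [hi y1]].
  have ib : i <> b by move=> ib; case: nb; rewrite -ib.
  apply: (lift i u hi y1 ib) => q qn; rewrite yu //; case: hi => iN hi.
  have [qb|bq|->] := ltngtP q b.+1; last by rewrite vdegen_eq; exact: fixs1.
    by rewrite vdegen_lt //; apply: hi; lia.
  by case: q bq qn => // q bq qn; rewrite vdegen_gt //; exact: hi.
(* The exit follows step b directly, so the merged entry ends in the factor of its predecessors and
   has at least two letters. *)
move=> mb; have {mb} em : m = b.+1 by lia.
subst m; right; exists b, (u b.+1), (u b).
have yb : wentry y b = u b.+1 * u b by rewrite yE ?vface_eq //; lia.
have lb : len (u b) = 1%N by have := g1 b (ltnSn b); have := len_gt0 b1; lia.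
have wl : u b.+1 = 1 \/ hd (u b.+1) <> hd (u b) by right.
have yu q : (q <= n.+1)%N -> u q = vins (wentry y) b (u b.+1) (u b) q.
  move=> qn; have [qb|bq|->] := ltngtP q b; last by rewrite vins_eq.
    by rewrite vins_lt // yE ?vface_lt //; lia.
  have [->|qb'] := eqVneq q b.+1; first by rewrite vins_eqS.
  by case: q bq qn qb' => // q bq qn qb'; rewrite vins_gt ?yE ?vface_gt //; lia.
have lyb : len (wentry y b) = (len (u b.+1)).+1 by rewrite yb len_snoc.
have hyb : hd (wentry y b) = hd (u b).
  by rewrite yb hdM // -yb lyb lb addn1.
split=> //; last first.
  by apply: wentry_inj => q qn; rewrite wentry_insB // zu // yu.
split.
  move=> /degenerateP[i [hi y1]].
  have ib : i <> b by move=> ib; rewrite ib in y1; rewrite y1 len1 in lyb.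
  apply: (lift i u hi y1 ib) => q qn; case: hi => iN hi.
  have [f1 f2] : fixs i (u b.+1) /\ fixs i (u b).
    by apply: fixs_snoc => //; rewrite -yb; apply: hi; lia.
  rewrite yu //; have [qb|bq|->] := ltngtP q b; last by rewrite vins_eq.
    by rewrite vins_lt //; apply: hi; lia.
  have [->|qb'] := eqVneq q b.+1; first by rewrite vins_eqS.
  by case: q bq qn qb' => // q bq qn qb'; rewrite vins_gt; [exact: hi|lia].
exists b; split=> //; have yl q : (q < b)%N -> wentry y q = u q.
  by move=> qb; rewrite yE ?vface_lt //; lia.
split; [lia| |by have := len_gt0 m1; lia|].
  by split=> [i ib|i j ib jb]; rewrite !yl //; [apply: g1; lia|apply: g2; lia].
by move=> i ib; rewrite yl // hyb => i1; apply: g2 => //; lia.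
Qed.

(* The cost counts the steps in the simplicial direction of the group and the letters;
   both numbers can only drop under faces. *)
Definition weight n (y : Wbar F n) (i : nat) : nat := (nonh y i + len (wentry y i))%N.

Definition cost n (y : Wbar F n) : nat := (\sum_(i < n) weight y i)%N.

Lemma fsumD j (a b : nat -> nat) i :
  fsum j (fun i => a i + b i)%N i = (fsum j a i + fsum j b i)%N.
Proof. by rewrite /fsum; case: ltngtP => // _; rewrite addnACA. Qed.

Lemma len_face n j (y : Wbar F n.+1) i : (j <= n.+1)%N -> (i < n)%N ->
  (len (wentry (dface j y) i) <= fsum j (fun i => len (wentry y i)) i)%N.
Proof.
move=> jn im; rewrite wentry_face //; apply: leq_trans (len_sgd _ _) _.
by rewrite /vface /fsum; case: ltngtP => // _; exact: lenM.
Qed.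

Lemma weight_face n j (y : Wbar F n.+1) i : (j <= n.+1)%N -> (i < n)%N ->
  (weight (dface j y) i <= fsum j (weight y) i)%N.
Proof. by move=> jn im; rewrite fsumD leq_add ?nonh_face ?len_face. Qed.

Lemma cost_face n j (y : Wbar F n.+1) : (j <= n.+1)%N -> (cost (dface j y) <= cost y)%N.
Proof.
move=> jn; rewrite /cost (sum_fsum _ jn) -addnA; apply: leq_trans (leq_addr _ _).
by apply: leq_sum => i _; exact: weight_face.
Qed.

Lemma weight0 n (y : Wbar F n) i : weight y i = 0%N -> hdeg y i /\ wentry y i = 1.
Proof.
by move/eqP; rewrite addn_eq0 => /andP[/eqP /nonh0 h /eqP /len_eq0].
Qed.

(** Both parts of the weight are subadditive, so equal totals force equality term by term, and a
    step dropped by an outer face must have weight 0. *)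
Lemma cost_face_eq n j (y : Wbar F n.+1) : (j <= n.+1)%N -> cost (dface j y) = cost y ->
  [/\ forall i, (i < n)%N -> nonh (dface j y) i = fsum j (nonh y) i,
      forall i, (i < n)%N ->
        len (wentry (dface j y) i) = fsum j (fun i => len (wentry y i)) i,
      j = 0%N -> hdeg y 0 /\ wentry y 0 = 1 &
      j = n.+1 -> hdeg y n /\ wentry y n = 1].
Proof.
move=> jn; rewrite /cost (sum_fsum _ jn) => e.
have h i : (i < n)%N -> weight (dface j y) i = fsum j (weight y) i.
  apply: (eq_sum_le (a := weight _)) => [k kn|]; first exact: weight_face.
  by rewrite e -addnA leq_addr.
have e0 : ((if j == 0 then weight y 0 else 0) + (if j == n.+1 then weight y n else 0) = 0)%N.
  move: e; rewrite (eq_bigr (fun i : 'I_n => fsum j (weight y) i)); last first.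
    by move=> i _; exact: h.
  by move: (\sum_(i < n) _)%N => s; lia.
split=> [i im|i im|j0|jn1].
- have := h i im; rewrite fsumD /weight.
  by have := nonh_face y jn im; have := len_face y jn im; lia.
- have := h i im; rewrite fsumD /weight.
  by have := nonh_face y jn im; have := len_face y jn im; lia.
- by apply: weight0; move: e0; rewrite j0 /=; lia.
- by apply: weight0; move: e0; rewrite jn1 eqxx; lia.
Qed.

(** If both merged steps moved in the group, the face would replace two moving steps by at most one
    and lower the cost. *)
Lemma cost_face_hdeg n j (y : Wbar F n.+1) : (j <= n.+1)%N -> cost (dface j y) = cost y ->
  exists i, hdeg y i /\ (i = j \/ i.+1 = j).
Proof.
move=> jn /(cost_face_eq jn)[hn _ h0 h1].
case: j jn hn h0 h1 => [|j] jn hn h0 h1.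
  by exists 0%N; split; [have [] := h0 erefl|left].
move: jn; rewrite ltnS leq_eqVlt => /orP[/eqP e|jn].
  by subst j; exists n; split; [have [] := h1 erefl|right].
have := hn j jn; rewrite /fsum ltnn eqxx /nonh.
have [h|nh] := pselect (hdeg y j); first by exists j; split=> //; right.
have [h|nh'] := pselect (hdeg y j.+1); first by exists j.+1; split=> //; left.
by rewrite (asboolF nh) (asboolF nh'); case: asboolP.
Qed.

Lemma typeA_inj n (y : Wbar F n) k k' : typeA y k -> typeA y k' -> k = k'.
Proof. by move=> [_ [b [m [-> p _]]]] [_ [b' [m' [-> p' _]]]]; have [->] := pre_inj p p'. Qed.

Lemma typeB_inj n (y : Wbar F n) k k' : typeB y k -> typeB y k' -> k = k'.
Proof. by move=> [_ [m [-> p]]] [_ [m' [-> p']]]; have -> := full_inj p p'. Qed.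

Lemma typeAB n (y : Wbar F n) k k' : typeA y k -> ~ typeB y k'.
Proof. by move=> [_ [b [m [_ p _]]]] [_ [m' [_ p']]]; exact: pre_full p p'. Qed.

Lemma tau_index n (y : Wbar F n) k k' : tau y k -> tau y k' -> k = k'.
Proof. by move=> [_ [b [m [-> p _]]]] [_ [b' [m' [-> p' _]]]]; have [->] := pre_inj p p'. Qed.

Lemma tau_inj n (z z' : Wbar F n.+1) k k' : tau z k -> tau z' k' ->
  dface k z = dface k' z' -> z = z' /\ k = k'.
Proof.
move=> zk zk' e.
case: (tauP zk) => [[b [kb A zA]]|[m [w [l [km B zB ew [l1 wl]]]]]];
case: (tauP zk') => [[b' [kb' A' zA']]|[m' [w' [l' [km' B' zB' ew' [l1' wl']]]]]].
- rewrite e in A zA; have ek := typeA_inj A A'; split=> //.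
  have eb : b = b' by lia.
  by subst b'; exact: etrans zA (esym zA').
- by rewrite e in A; case: (typeAB A B').
- by rewrite e in B; case: (typeAB A' B).
- rewrite e in B zB ew; have ek := typeB_inj B B'; split=> //.
  have em : m = m' by lia.
  subst m'; have [ww ll] : w = w' /\ l = l' by apply: snoc_inj; rewrite // -ew -ew'.
  by subst w' l'; exact: etrans zB (esym zB').
Qed.

Lemma tau_face_tau n (z : Wbar F n.+1) k k' : tau z k -> ~ tau (dface k z) k'.
Proof.
move=> /tauP[[b [_ [_ [b' [m [_ p nh]]]] _]]|[m [w [l [_ [_ [m' [_ p]]] _ _ _]]]]]
  [_ [b'' [m'' [_ p' h]]]].
  by have [e _] := pre_inj p p'; case: nh; rewrite e.
exact: pre_full p' p.
Qed.

Lemma tau_face_nondeg n (z : Wbar F n.+1) k : tau z k -> ~ degenerate (dface k z).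
Proof. by move/tauP => [[b [_ [] //]]|[m [w [l [_ [] //]]]]]. Qed.

Lemma tau_not_one_factor n (z : Wbar F n) k : tau z k -> ~ one_factor (wentry z) n.
Proof. by move=> [_ [b [m [_ p _]]]]; apply: (pre_not_one_factor p); case: p => /andP[]. Qed.

Lemma tau_face_not_one_factor n (z : Wbar F n.+1) k :
  tau z k -> ~ one_factor (wentry (dface k z)) n.
Proof.
move/tauP => [[b [_ [_ [b' [m [_ p _]]]] _]]|[m [w [l [_ [_ [m' [_ p]]] _ _ _]]]]].
  by apply: (pre_not_one_factor p); case: p => /andP[].
by apply: (full_not_one_factor p); case: p.
Qed.

Lemma tau_cover n (y : Wbar F n) : ~ one_factor (wentry y) n -> ~ degenerate y ->
  (exists k, tau y k) \/ (exists z k, @tau n.+1 z k /\ y = dface k z).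
Proof.
case: n y => [|n] y ng nd.
  by case: ng; split.
have [m [mn gm ngm]] : exists m,
    [/\ (m <= n)%N, one_factor (wentry y) m & ~ one_factor (wentry y) m.+1].
  have g0 : one_factor (wentry y) 0 by split.
  have hex : exists p, `[< ~ one_factor (wentry y) p >] by exists n.+1; apply/asboolP.
  (* The least p for which the first p entries leave one factor; the exit is the entry of index p -
     1. *)
  case: (ex_minnP hex) => -[|p] /asboolP np minp; first by case: np.
  exists p; split=> //; first by apply: (minp n.+1); apply/asboolP.
  by apply: contrapT => ngp; have /asboolP/minp := ngp; rewrite ltnn.
have em1 : wentry y m <> 1.
  move=> e1; apply: ngm; case: gm => g1 g2; split=> [i|i j].
    by rewrite ltnS leq_eqVlt => /orP[/eqP ->|/g1 //]; rewrite e1 len1.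
  rewrite 2!ltnS (leq_eqVlt i) (leq_eqVlt j) => /orP[/eqP ->|im] /orP[/eqP ->|jm] //.
  exact: g2.
have hb : (exists b, [/\ (b < m)%N, wentry y b <> 1 &
      forall i, (b < i < m)%N -> wentry y i = 1]) \/
    (forall i, (i < m)%N -> wentry y i = 1).
  move: m {mn gm ngm em1} => m; elim: m => [|m [[b [bm b1 z]]|z]]; first by right.
    left; have [e1|ne] := pselect (wentry y m = 1); last first.
      by exists m; split=> // i; lia.
    exists b; split=> // [|i /andP[bi]]; first exact: leqW.
    by rewrite ltnS leq_eqVlt => /orP[/eqP ->//|im]; apply: z; rewrite bi.
  have [e1|ne] := pselect (wentry y m = 1); last first.
    by left; exists m; split=> // i; lia.
  by right=> i; rewrite ltnS leq_eqVlt => /orP[/eqP ->//|/z].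
have fulltau : full (wentry y) n.+1 m -> exists z k, @tau n.+2 z k /\ y = dface k z.
  move=> fy; have [w [l [ew l1 hl wl]]] := split_last em1.
  exists (insB y m w l), m.+1; split; first exact: tau_insB.
  by rewrite dface_insB.
have [g1 g2] := gm.
case: hb => [[b [bm b1 z]]|z]; last first.
  right; apply: fulltau; split=> // [|i im]; last by rewrite (z i im).
  rewrite ltnNge; apply/negP => le1; apply: ngm; split=> [i|i j].
    by rewrite ltnS leq_eqVlt => /orP[/eqP ->//|/g1].
  rewrite 2!ltnS (leq_eqVlt i) (leq_eqVlt j) => /orP[/eqP ->|im] /orP[/eqP ->|jm] // i1 j1.
  - by case: j1; exact: z.
  - by case: i1; exact: z.
  - exact: g2.
have [eh|neh] := pselect (hd (wentry y m) = hd (wentry y b)); last first.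
  have p : pre (wentry y) n.+1 b m by split=> //; rewrite bm.
  have [hy|nh] := pselect (hdeg y b).
    by left; exists b.+1; split=> //; exists b, m.
  right; exists (insA y b), b.+1; split; first exact: tau_insA p nh.
  by rewrite dface_insA //; lia.
right; apply: fulltau; split=> // [|i im i1]; last by rewrite eh; apply: g2.
rewrite ltnNge; apply/negP => le1; apply: ngm; split=> [i|i j].
  by rewrite ltnS leq_eqVlt => /orP[/eqP ->//|/g1].
rewrite 2!ltnS (leq_eqVlt i) (leq_eqVlt j) => /orP[/eqP ->|im] /orP[/eqP ->|jm] // i1 j1.
- by rewrite eh; apply: g2.
- by rewrite eh; apply: g2.
- exact: g2.
Qed.

(** A common description of [insA] and [insB]: z is [s_b] of a sequence u that inherits the constant
    directions of the missing face, and whose lengths add up without loss. *)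
Lemma tau_unfold n (z : Wbar F n.+2) k : tau z k -> exists b u,
  [/\ k = b.+1, (b <= n)%N,
     forall q, (q <= n.+1)%N -> wentry z q = sgs b (u q),
     forall i, hdeg (dface k z) i -> forall q, (q <= n.+1)%N -> fixs i (u q) &
     forall i, (i <= n)%N -> fsum k (fun q => len (u q)) i = len (wentry (dface k z) i)].
Proof.
move=> zk; case: (tauP zk) => [[b [kb A zA]]|[m [w [l [km B zB ew [l1 wl]]]]]].
  exists b, (vdegen b.+1 (wentry (dface k z))); have bn : (b <= n)%N.
    by case: A => _ [b' [m [e [/andP[]]]]]; lia.
  split=> //.
  - by move=> q qn; rewrite {1}zA wentry_insA.
  - move=> i [iN hi] q qn; have [qb|bq|->] := ltngtP q b.+1.
    + by rewrite vdegen_lt //; apply: hi; lia.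
    + by case: q bq qn => // q bq qn; rewrite vdegen_gt //; exact: hi.
    + by rewrite vdegen_eq; exact: fixs1.
  - move=> i im; rewrite kb /fsum; case: ltngtP => h.
    + by rewrite vdegen_lt //; lia.
    + by rewrite vdegen_gt //; lia.
    + by case: h => ->; rewrite vdegen_eq vdegen_lt // len1.
exists m, (vins (wentry (dface k z)) m w l); have mn : (m <= n)%N.
  by case: B => _ [m' [e []]]; lia.
split=> //.
- by move=> q qn; rewrite {1}zB wentry_insB.
- move=> i [iN hi] q qn; have [f1 f2] : fixs i w /\ fixs i l.
    by apply: fixs_snoc => //; rewrite -ew; apply: hi.
  have [qm|mq|->] := ltngtP q m; last by rewrite vins_eq.
    by rewrite vins_lt //; apply: hi; lia.
  have [->|ne] := eqVneq q m.+1; first by rewrite vins_eqS.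
  by case: q mq qn ne => // q mq qn ne; rewrite vins_gt; [exact: hi|lia].
- move=> i im; rewrite km /fsum; case: ltngtP => h.
  + by rewrite vins_lt //; lia.
  + by rewrite vins_gt //; lia.
  + by case: h => ->; rewrite vins_eq vins_eqS -km ew len_snoc // l1 addn1.
Qed.

(** Splitting a step or a reduced word creates no cost: the new step b is constant in the group and
    the lengths of the parts add up. With [cost_face] the two members of a pair have equal cost. *)
Lemma cost_tau n (z : Wbar F n.+1) k : tau z k -> (cost z <= cost (dface k z))%N.
Proof.
case: n z => [|n] z zk; first by case: zk => _ [b [m [_ [/andP[]]]]]; lia.
have [b [u [kb bn zu fu lu]]] := tau_unfold zk.
have kn : (k <= n.+2)%N by lia.
rewrite /cost (sum_fsum _ kn) kb /= (_ : (b.+1 == n.+2) = false) ?addn0; last lia.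
apply: leq_sum => -[i im] _ /=; rewrite fsumD /weight -kb.
have -> : fsum k (fun i => len (wentry z i)) i = len (wentry (dface k z) i).
  rewrite -lu // /fsum; have im' : (i <= n.+1)%N by lia.
  by case: ltngtP => _; rewrite ?zu // ?len_sgs //; lia.
rewrite leq_add2r.
have up_lt j : (j < b)%N -> hdeg (dface k z) j -> hdeg z j.
  move=> jb h; split=> [|q qn]; first lia.
  by rewrite zu //; apply: fixs_up_lt; [lia|exact: fu].
have up_ge j : (b <= j)%N -> hdeg (dface k z) j -> hdeg z j.+1.
  move=> jb h; have [jn _] := h; split=> [|q qn]; first lia.
  by rewrite zu //; apply: fixs_up_ge; [lia|exact: fu].
rewrite /fsum kb; case: ltngtP => h; rewrite -kb.
- by apply: nonh_le; exact: up_lt.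
- by apply: nonh_le; apply: up_ge; lia.
- have -> : nonh z i = 0%N.
    by case: h => ->; apply/nonh0; apply: (hdeg_sgs (v := u)) => //; lia.
  by rewrite addn0; apply: nonh_le; apply: up_ge; lia.
Qed.

(** Two nontrivial letters of one factor merge into at most one letter, so their lengths could not
    add up. *)
Lemma one_factor_mul n (u : nat -> F n) m i : one_factor u m -> (i.+1 < m)%N ->
  len (u i.+1 * u i) = (len (u i.+1) + len (u i))%N -> u i = 1 \/ u i.+1 = 1.
Proof.
move=> [g1 g2] im e; apply: contrapT => /not_orP[i1 j1].
have im' := ltnW im.
have li : len (u i) = 1%N by have := g1 i im'; have := len_gt0 i1; lia.
have lj : len (u i.+1) = 1%N by have := g1 _ im; have := len_gt0 j1; lia.
by have := len_same lj li (g2 _ _ im im' j1 i1); rewrite e; lia.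
Qed.

(** Without loss of letters, a face inside the one-factor part can only absorb a trivial entry, and
    a later face keeps the last factor of [u m]. So the pattern survives, and b moves down exactly
    when j lies at or below it. *)
Lemma pre_vface n (u : nat -> F n) N j b m :
  pre u N.+1 b m -> (j <= N.+1)%N -> j <> b.+1 ->
  (forall i, (i < N)%N -> len (vface j u i) = fsum j (fun i => len (u i)) i) ->
  (j = 0%N -> u 0%N = 1) -> (j = N.+1 -> u N = 1) ->
  exists m', pre (vface j u) N (if (j <= b)%N then b.-1 else b) m'.
Proof.
move=> [/andP[bm mN] g b1 [z m1 ne]] jN jb lu u0 uN.
have lm i : j = i.+1 -> (i < N)%N -> len (u i.+1 * u i) = (len (u i.+1) + len (u i))%N.
  by move=> ji iN; have := lu i iN; rewrite ji vface_eq /fsum ltnn eqxx.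
have [g1 g2] := g.
have one_factor_of (e : nat -> F n) p :
    (forall i, (i < p)%N -> exists2 i', (i' < m)%N & e i = u i') -> one_factor e p.
  move=> ex; split=> [i /ex[i' im ->]|i i' /ex[p1 h1 ->] /ex[p2 h2 ->]]; [exact: g1|exact: g2].
have [jlb|blj] := leqP j b.
  have bp : (0 < b)%N.
    by rewrite lt0n; apply/eqP => b0; case: b1; rewrite b0; apply: u0; lia.
  have ex i : (i < m.-1)%N -> exists2 i', (i' < m)%N & vface j u i = u i'.
    move=> im; have [ij|ji|ij] := ltngtP i.+1 j.
    - by exists i; [lia|rewrite vface_lt].
    - by exists i.+1; [lia|rewrite vface_gt].
    - have iN : (i < N)%N by lia.
      have im' : (i.+1 < m)%N by lia.
      have := lm i (esym ij) iN; rewrite -ij vface_eq => /(one_factor_mul g im')[->|->].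
        by exists i.+1; rewrite ?mulg1.
      by exists i; [lia|rewrite mul1g].
  have vb : vface j u b.-1 = u b.
    have [jb'|jb'] := ltnP j b; first by rewrite vface_gt ?prednK //; lia.
    have -> : j = b.-1.+1 by lia.
    have iN : (b.-1 < N)%N by lia.
    have im' : (b.-1.+1 < m)%N by lia.
    have ej : j = b.-1.+1 by lia.
    rewrite vface_eq; have := lm b.-1 ej iN => /(one_factor_mul g im').
    by rewrite prednK // => -[->|//]; rewrite mulg1.
  have vm : vface j u m.-1 = u m by rewrite vface_gt ?prednK //; lia.
  exists m.-1; split; rewrite ?vb ?vm //; [lia|exact: one_factor_of|].
  by split=> // i bi; rewrite vface_gt ?z //; lia.
have [jm|mj] := leqP j m.
  have vlo i : (i <= b)%N -> vface j u i = u i by move=> ib; rewrite vface_lt //; lia.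
  have vmid i : (b < i < m.-1)%N -> vface j u i = 1.
    move=> bi; have [ij|ji|ij] := ltngtP i.+1 j.
    - by rewrite vface_lt ?z //; lia.
    - by rewrite vface_gt ?z //; lia.
    - by rewrite -ij vface_eq !z ?mulg1 //; lia.
  have vm : vface j u m.-1 = u m.
    have [jm'|jm'] := ltnP j m; first by rewrite vface_gt ?prednK //; lia.
    have -> : j = m.-1.+1 by lia.
    by rewrite vface_eq (z m.-1) ?mulg1 ?prednK //; lia.
  exists m.-1; split; rewrite ?(vlo b (leqnn b)) ?vm //; first lia.
    apply: one_factor_of => i im; have [ib|bi] := leqP i b; first by exists i; [lia|exact: vlo].
    by exists m.-1; [lia|rewrite vmid ?(z m.-1) //; lia].
have mN' : (m < N)%N.
  have [//|Nm] := ltnP m N; have em : m = N by lia.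
  by case: m1; rewrite em; apply: uN; lia.
have vlo i : (i < m)%N -> vface j u i = u i by move=> im; rewrite vface_lt //; lia.
(* For j = m + 1 the later factor stands on the left of the product, so the last letter is that of
   [u m]. *)
have vm : vface j u m <> 1 /\ hd (vface j u m) = hd (u m).
  have [mj'|jm'] := ltnP m.+1 j; first by rewrite vface_lt.
  have ej : j = m.+1 by lia.
  rewrite ej vface_eq; have e := lm m ej mN'; split; last exact: hdM.
  by apply: len_gt1; rewrite e; have := len_gt0 m1; lia.
exists m; split; rewrite ?(vlo b bm) //; first lia.
  by apply: one_factor_of => i im; exists i; rewrite ?vlo.
split; [|exact: vm.1|by rewrite vm.2].
by move=> i bi; rewrite vlo ?z //; lia.
Qed.

(** A face of equal cost keeps the pattern of [pre]. If it is neither degenerate nor matched it is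
    of type A, which happens only for j <= b; then its index is b - 1 and its partner has k' = b,
    below k = b + 1. *)
Lemma tau_faces n (z : Wbar F n.+1) k j : tau z k -> (j <= n.+1)%N -> j <> k ->
  one_factor (wentry (dface j z)) n \/ (cost (dface j z) < cost z)%N \/
  degenerate (dface j z) \/ (exists k', tau (dface j z) k') \/
  exists z' k', [/\ @tau n.+1 z' k', dface j z = dface k' z' & (k' < k)%N].
Proof.
move=> zk jn jk; have cj := cost_face z jn.
have [ce|cn] := eqVneq (cost (dface j z)) (cost z); last first.
  by right; left; rewrite ltn_neqAle cn.
right; right; have [dz|ndz] := pselect (degenerate (dface j z)); first by left.
right; case: zk => nd [b [m [kb pz hz]]].
have [_ le h0 hn] := cost_face_eq jn ce.
have [i [[iN hi] ij]] := cost_face_hdeg jn ce.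
case: n z jn cj ce ndz nd pz hz le h0 hn iN hi
  => [|n] z jn cj ce ndz nd pz hz le h0 hn iN hi; first by case: pz => /andP[]; lia.
(* Since i is j or j - 1, the face [d_j] undoes [s_i], so u has the same words as z up to the
   degeneracy [s_i]. *)
pose u q := sgd j (wentry z q).
have zu q : (q <= n.+1)%N -> wentry z q = sgs i (u q).
  move=> qn; have fz := hi q qn; rewrite /u.
  by case: ij => e; subst j; rewrite ?fixs_sgdS // fz.
have dE q : (q < n.+1)%N -> wentry (dface j z) q = vface j u q.
  by move=> qn; rewrite wentry_face // /vface /u; case: ltngtP => _ //; rewrite sgdM.
have pu : pre u n.+2 b m.
  by rewrite -(pre_sgs _ _ _ _ iN); apply: eq_pre pz => q; exact: zu.
have lz q : (q <= n.+1)%N -> len (u q) = len (wentry z q).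
  by move=> qn; rewrite zu // len_sgs.
have [m' pm] : exists m', pre (vface j u) n.+1 (if (j <= b)%N then b.-1 else b) m'.
  apply: (pre_vface pu) => //.
  - by rewrite -kb.
  - move=> q qn; rewrite -dE // le // /fsum.
    by case: ltngtP => _; rewrite ?lz //; lia.
  - by move=> j0; rewrite /u (h0 j0).2 sgd1.
  - by move=> j1; rewrite /u (hn j1).2 sgd1.
have {}pm : pre (wentry (dface j z)) n.+1 (if (j <= b)%N then b.-1 else b) m'.
  by apply: eq_pre pm => q qn; rewrite dE.
have [hb|nb] := pselect (hdeg (dface j z) (if (j <= b)%N then b.-1 else b)).
  by left; eexists; split=> //; exists (if (j <= b)%N then b.-1 else b), m'.
(* For j > b + 1 the constant direction b of z survives the face, so the face would be matched. *)
right; move: pm nb; have [jb|bj] := leqP j b => pm nb; last first.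
  case: nb; apply: hdeg_face_lt hz; lia.
have [_ _ ub _] := pu.
have bp : (0 < b)%N.
  rewrite lt0n; apply/eqP => b0; case: ub; have j0 : j = 0%N by lia.
  by rewrite b0 /u (h0 j0).2 sgd1.
exists (insA (dface j z) b.-1), b.-1.+1; split; first exact: tau_insA pm nb.
  by rewrite dface_insA //; case: pm => /andP[]; lia.
lia.
Qed.

Theorem one_factor_extends (A : subsset (Wbar F)) :
  (forall n (y : Wbar F n), A n y <-> one_factor (wentry y) n) -> extends_from A.
Proof.
move=> Ag E f ff fd G G1 G2 G3 fill.
have tau_k n (z : Wbar F n) k : tau z k -> exists b m, k = b.+1 /\ (b < m < n)%N.
  by case=> _ [b [m [kb [bm _ _ _] _]]]; exists b, m.
apply: (@extension_exists _ _ A tau cost) ff fd G G1 G2 G3 fill.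
- by move=> n i y; exact: cost_face.
- by move=> y k /tau_k[b [m [_]]]; lia.
- by move=> n z k /tau_k[b [m [-> ]]]; lia.
- by move=> n z k zk /Ag; exact: tau_not_one_factor zk.
- by move=> n z k [].
- exact: tau_index.
- by move=> n z k zk /Ag; exact: tau_face_not_one_factor zk.
- by move=> n z k; exact: tau_face_nondeg.
- by move=> n z k k'; exact: tau_face_tau.
- by move=> n z z' k k'; exact: tau_inj.
- by move=> n y nA nd; apply: tau_cover => // /Ag.
- by move=> n z k; exact: cost_tau.
- move=> n z k j zk jn jk; have [g|h] := tau_faces zk jn jk; last by right.
  by left; apply/Ag.
Qed.

End Pairing.

(** * Homotopy equivalences from extensions *)

Section Image.
Variables (X Y : sset) (i : smap X Y).

Definition image_mem n (y : Y n) : Prop := exists x, i n x = y.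

Lemma image_face n k (y : Y n.+1) : image_mem y -> image_mem (face k y).
Proof. by case=> x <-; exists (face k x); rewrite smap_face. Qed.

Lemma image_degen n k (y : Y n) : image_mem y -> image_mem (degen k y).
Proof. by case=> x <-; exists (degen k x); rewrite smap_degen. Qed.

Definition image_subsset : subsset Y := SubSSet image_face image_degen.

End Image.

Section RealizeMap.
Variables (R : realType) (X Y : sset) (i : smap X Y).

Lemma realization_map_pt n (x : X n) t :
  realization_map R i (real_pt x t) = real_pt (i n x) t.
Proof. exact: realization_mapE. Qed.

Lemma realization_map_continuous : continuous (realization_map R i).
Proof.
apply: real_continuous => n x; under eq_fun do rewrite realization_map_pt.
exact: real_pt_continuous.
Qed.

End RealizeMap.

Section SingOf.
Variables (R : realType) (Y : sset) (Z : topologicalType) (g : realization R Y -> Z).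
Hypothesis gc : continuous g.

Lemma sing_of_subproof n (y : Y n) :
  continuous (fun x : std_simplex R n * R => g (real_pt y x.1)).
Proof.
have yc : continuous (fun t : std_simplex R n => real_pt y t) by exact: real_pt_continuous.
move=> x; apply: (@continuous_comp _ _ _ fst (fun t => g (real_pt y t))); first exact: cvg_fst.
by apply: (@continuous_comp _ _ _ (fun t : std_simplex R n => real_pt y t) g);
  [exact: yc|exact: gc].
Qed.

Definition sing_of_fun n (y : Y n) : sing R Z n := exist _ _ (@sing_of_subproof n y).

Lemma sing_of_face n k (y : Y n.+1) : sing_of_fun (face k y) = face k (sing_of_fun y).
Proof. by apply: sing_eq => x /=; rewrite real_pt_face. Qed.

Lemma sing_of_degen n k (y : Y n) : sing_of_fun (degen k y) = degen k (sing_of_fun y).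
Proof. by apply: sing_eq => x /=; rewrite real_pt_degen. Qed.

Definition sing_of : smap Y (sing R Z) := SMap sing_of_face sing_of_degen.

End SingOf.

Lemma homotopic_refl (R : realType) (X : topologicalType) (f : X -> X) :
  f =1 id -> homotopic R f idfun.
Proof.
move=> e; exists fst; split=> //.
by apply: continuous_subspaceT => x; exact: cvg_fst.
Qed.

Section ExtensionEquivalence.
Variables (R : realType) (X Y : sset) (i : smap X Y).
Hypothesis i_inj : forall n, injective (i n).
Variable x0 : forall n, X n.
Hypothesis i_ext : extends_from (image_subsset i).

Lemma real_retraction : exists2 r : realization R Y -> realization R X, continuous r &
  forall q, r (realization_map R i q) = q.
Proof.
have idc : continuous (@id (realization R X)) by move=> x; exact: cvg_id.
pose can := sing_of idc.
(* The inverse of i on its image, extended by the default [x0]; the extension property consults it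
   only on the image. *)
pose pre n (y : Y n) : X n := if pselect (image_mem i y) is left h then sval (cid h) else x0 n.
have preK n (x : X n) : pre n (i n x) = x.
  rewrite /pre; case: pselect => [h|[]]; last by exists x.
  by apply: i_inj; case: (cid h).
have pre_face n k (y : Y n.+1) : image_mem i y -> pre n (dface k y) = dface k (pre _ y).
  by case=> x <-; rewrite /dface -(smap_face i) !preK.
have pre_degen n k (y : Y n) : image_mem i y -> pre _ (ddegen k y) = ddegen k (pre _ y).
  by case=> x <-; rewrite /ddegen -(smap_degen i) !preK.
have [|||||| F [FA _]] := i_ext (f := fun n y => can n (pre n y)) _ _
    (G := fun n y e => True).
- by move=> n k y /pre_face ->; rewrite /dface smap_face.
- by move=> n k y /pre_degen ->; rewrite /ddegen smap_degen.
- by [].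
- by [].
- by [].
- move=> n y k h hc _.
  (* With [flag = false] the ends impose no condition, so any simplex serves as [w]. *)
  have [//|e [he _]] := @sing_fill R _ n k false h (fun=> can _ (x0 n.+1)) hc.
  by exists e.
have [Phi Phic PhiE] := sing_to_real F.
exists (fun q => Phi (q, 0)).
  move=> q; apply: (@continuous_comp _ _ _ (fun q => (q, 0 : R)) Phi); last exact: Phic.
  apply: (@cvg_pair _ _ _ _ (nbhs _) (nbhs _)); try exact: nbhs_filter.
    by move=> B nB; exact: nB.
  exact: (@cvg_cst _ _ _ (nbhs q) (nbhs_filter q)).
apply: real_ptP => n x t; rewrite realization_map_pt PhiE FA; last by exists x.
by rewrite preK.
Qed.

Lemma extension_equivalence : homotopy_equivalence R (realization_map R i).
Proof.
have [r rc rK] := real_retraction.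
have ic := @realization_map_continuous R _ _ i.
split=> //; exists r; split=> //; first exact: homotopic_refl.
have irc : continuous (realization_map R i \o r).
  by move=> q; apply: continuous_comp; [exact: rc|exact: ic].
have idc : continuous (@id (realization R Y)) by move=> x; exact: cvg_id.
pose w (b : bool) : smap Y (sing R (realization R Y)) :=
  if b then sing_of idc else sing_of irc.
(* Here [G] prescribes the composite of r and i for u <= 0 and the identity for 1 <= u. The constant
   homotopy on the image fulfils both, because r is a retraction. *)
have [|||||| F [_ FG]] := i_ext (f := fun n y => w true n y) _ _
    (G := fun n y e => forall b t u, ends b u -> sval e (t, u) = sval (w b n y) (t, 0)).
- by move=> n k y _; rewrite /dface smap_face.
- by move=> n k y _; rewrite /ddegen smap_degen.
- by move=> n k y e Ge b t u bu; rewrite /dface smap_face /= (Ge b).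
- by move=> n k y e Ge b t u bu; rewrite /ddegen smap_degen /= (Ge b).
- move=> n _ [x <-] [] t u _ //=.
  by rewrite -realization_map_pt rK.
- move=> n y k h hc Gh.
  have [|e [he eb]] := @sing_fill R _ n k true h (fun b => w b _ y) hc.
    by move=> b j t u _ jk bu; rewrite (Gh j jk b t u bu) smap_face.
  by exists e; split=> // b t u; exact: eb.
have [Phi Phic PhiE] := sing_to_real F.
exists Phi; split; first exact: continuous_subspaceT.
- apply: real_ptP => n y t; rewrite PhiE.
  by rewrite (FG n y false t 0) //; exact: lexx.
- apply: real_ptP => n y t; rewrite PhiE.
  by rewrite (FG n y true t 1) //; exact: lexx.
Qed.

End ExtensionEquivalence.

(** * The map theta *)

Section CollapseLift.
Variables (X Z : sset) (A : subsset X) (f : smap X Z).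
Hypothesis fA : forall n (x x' : X n), A n x -> A n x' -> f n x = f n x'.

Definition collapse_lift_fun n : collapse A n -> Z n :=
  gen_lift (fun x : {classic X n} => f n x).

Lemma collapse_lift_funE n (x : X n) : collapse_lift_fun (collapse_pi A x) = f n x.
Proof. by rewrite [LHS]gen_lift_pi // => a b [ha hb]; exact: fA. Qed.

Lemma collapse_lift_face n i (x : collapse A n.+1) :
  collapse_lift_fun (face i x) = face i (collapse_lift_fun x).
Proof.
move: x; apply: gen_quotW => x; rewrite -/(collapse_pi _ _).
by rewrite /= collapse_faceE !collapse_lift_funE smap_face.
Qed.

Lemma collapse_lift_degen n i (x : collapse A n) :
  collapse_lift_fun (degen i x) = degen i (collapse_lift_fun x).
Proof.
move: x; apply: gen_quotW => x; rewrite -/(collapse_pi _ _).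
by rewrite /= collapse_degenE !collapse_lift_funE smap_degen.
Qed.

Definition collapse_lift : smap (collapse A) Z := SMap collapse_lift_face collapse_lift_degen.

End CollapseLift.

Lemma wentry_map (G H : sgroup) (f : sghom G H) n (y : Wbar G n) i : (i < n)%N ->
  wentry (Wbar_map f n y) i = f n (wentry y i).
Proof. exact: entry_map. Qed.

Lemma vface_hom (H K : groupType) (f : {multiplicative H -> K}) k (e : nat -> H) i :
  vface k (fun j => f (e j)) i = f (vface k e i).
Proof. by rewrite /vface; case: ltngtP => _ //; rewrite gmulfM. Qed.

Lemma vdegen_hom (H K : groupType) (f : {multiplicative H -> K}) k (e : nat -> H) i :
  vdegen k (fun j => f (e j)) i = f (vdegen k e i).
Proof. by rewrite /vdegen; case: ltngtP => _ //; rewrite mulhom1. Qed.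

Lemma eq_vface (H : groupType) k (e e' : nat -> H) n i : (k <= n.+1)%N -> (i < n)%N ->
  (forall j, (j <= n)%N -> e j = e' j) -> vface k e i = vface k e' i.
Proof.
move=> kn im ee; have im' := ltnW im.
by rewrite /vface; case: ltngtP => _; rewrite !ee.
Qed.

Lemma eq_vdegen (H : groupType) k (e e' : nat -> H) n i : (k <= n)%N -> (i <= n)%N ->
  (forall j, (j < n)%N -> e j = e' j) -> vdegen k e i = vdegen k e' i.
Proof.
move=> kn im ee.
by rewrite /vdegen; case: ltngtP => h //; rewrite ee //; lia.
Qed.

Lemma wentry_pt (G : sgroup) n i : (i < n)%N -> wentry (pt (Wbar G) n) i = 1%g.
Proof.
elim: n i => // n ih i im.
have -> : pt (Wbar G) n.+1 = ddegen 0 (pt (Wbar G) n) by rewrite /ddegen degen_pt.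
rewrite wentry_degen // /vdegen.
by case: i im => [|i] im; rewrite ?sgs1 //= ih // sgs1.
Qed.

Section Theta.
Variable D : datum.
Local Notation G := (dgrp D).
Local Notation S := (sset_of (dbase D)).
Local Notation P n := (pt (psset_of (dpt D)) n).
Let TD := tw_times (Wbar_nonsingular (dns (d := D))).
Local Open Scope group_scope.

Definition fg n (x : S n) : {multiplicative G n -> dFG D n} := FG_in (dpt D) G x.

Definition theta_pre n (p : TD n) : WF D n := Wgroup_map (fg p.2) n p.1.

Lemma wentry_theta_pre n (p : TD n) i : (i < n)%N ->
  wentry (theta_pre p) i = fg p.2 (wentry (p.1 : Wbar G n) i).
Proof. exact: entry_map. Qed.

Lemma sgd_fg n k (x : S n.+1) g : (k <= n.+1)%N ->
  sgd k (fg x g) = fg (dface k x) (dtwist D (vertex x (inord k)) n (sgd k g)).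
Proof. by move=> kn; exact: FG_face_in. Qed.

Lemma sgs_fg n k (x : S n) g :
  sgs k (fg x g) = fg (ddegen k x) (tw_inv (dns (d := D)) (vertex x (inord k)) n.+1 (sgs k g)).
Proof. exact: FG_degen_in. Qed.

(** The twisted product and the faces of [dFG] apply the same endomorphism, that of vertex i, entry
    by entry. *)
Lemma theta_pre_face n i (p : TD n.+1) : theta_pre (face i p) = face i (theta_pre p).
Proof.
have ki : (i <= n.+1)%N by rewrite -ltnS.
rewrite face_dface [in RHS]face_dface; apply: wentry_inj => j jn.
rewrite wentry_theta_pre // wentry_face //.
rewrite (@eq_vface _ _ _ (fun q => fg p.2 (wentry (p.1 : Wbar G n.+1) q)) n) //; last first.
  by move=> q qn; exact: wentry_theta_pre.
rewrite vface_hom sgd_fg //; congr (fg _ _).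
by rewrite /= wentry_map // -/(dface i p.1) wentry_face.
Qed.

(** The inverses on both sides are chosen independently; uniqueness of inverses identifies them. *)
Let ptw_invE v n (y : Wbar G n) :
  ptw_inv (Wbar_nonsingular (dns (d := D))) v n y = Wbar_map (tw_inv (dns (d := D)) v) n y.
Proof.
apply: (can_inj (@ptw_invK _ _ _ (Wbar_nonsingular (dns (d := D))) v n)).
rewrite ptw_invVK; apply: wentry_inj => i im.
by rewrite wentry_map // wentry_map // tw_invVK.
Qed.

Lemma theta_pre_degen n i (p : TD n) : theta_pre (degen i p) = degen i (theta_pre p).
Proof.
have ki : (i <= n)%N by rewrite -ltnS.
rewrite degen_ddegen [in RHS]degen_ddegen; apply: wentry_inj => j jn.
rewrite wentry_theta_pre // wentry_degen //.
rewrite (@eq_vdegen _ _ _ (fun q => fg p.2 (wentry (p.1 : Wbar G n) q)) n) //; last first.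
  by move=> q qn; exact: wentry_theta_pre.
rewrite vdegen_hom sgs_fg; congr (fg _ _).
by rewrite /= ptw_invE wentry_map // -/(ddegen i p.1) wentry_degen.
Qed.

Definition theta_times : smap TD (WF D) := SMap theta_pre_face theta_pre_degen.

Lemma fg_pt n g : fg (P n) g = 1.
Proof. exact: FG_in_pt. Qed.

Lemma theta_sub n (p : TD n) : smash_sub (dpt D) (Wbar_nonsingular (dns (d := D))) n p ->
  theta_times n p = pt (WF D) n.
Proof.
move=> sp; apply: wentry_inj => i im; rewrite wentry_theta_pre // wentry_pt //.
case: p sp => y x [/= ->|/= ->]; first exact: fg_pt.
by rewrite wentry_pt // mulhom1.
Qed.

Lemma theta_sub2 n (p p' : TD n) :
  smash_sub (dpt D) (Wbar_nonsingular (dns (d := D))) n p ->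
  smash_sub (dpt D) (Wbar_nonsingular (dns (d := D))) n p' ->
  theta_times n p = theta_times n p'.
Proof. by move=> sp sp'; rewrite !theta_sub. Qed.

Definition theta : smap (Wsmash D) (WF D) := collapse_lift theta_sub2.

Definition wsmash_pi n (y : Wbar G n) (x : S n) : Wsmash D n :=
  collapse_pi (smash_sub (dpt D) (Wbar_nonsingular (dns (d := D)))) ((y, x) : TD n).

Lemma wsmash_piP n (Q : Wsmash D n -> Prop) : (forall y x, Q (wsmash_pi y x)) -> forall q, Q q.
Proof. by move=> h; apply: gen_quotW => -[y x]; exact: h. Qed.

Lemma thetaE n (y : Wbar G n) (x : S n) : theta n (wsmash_pi y x) = theta_pre ((y, x) : TD n).
Proof. exact: (collapse_lift_funE theta_sub2). Qed.

Lemma wentry_theta n (y : Wbar G n) (x : S n) i : (i < n)%N ->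
  wentry (theta n (wsmash_pi y x)) i = fg x (wentry y i).
Proof. by move=> im; rewrite thetaE wentry_theta_pre. Qed.

Definition flen n (f : dFG D n) : nat := @len (G n) (S n) (P n) f.
Definition fhd n (f : dFG D n) : option (S n) := @hd (G n) (S n) (P n) f.

Lemma fg_cases n (x : S n) g : fg x g = 1 /\ (x = P n \/ g = 1) \/
  [/\ x <> P n, g <> 1 & nf (fg x g : free_prod (G n) (P n)) = [:: (g, x)]].
Proof.
have [->|xp] := pselect (x = P n); first by left; split; [exact: fg_pt|left].
have [->|g1] := pselect (g = 1); first by left; split; [exact: mulhom1|right].
by right; split=> //; exact: nf_letter.
Qed.

Lemma flen_fg n (x : S n) g : (flen (fg x g) <= 1)%N.
Proof. 
rewrite /flen; case: (fg_cases x g) => [[-> _]|[_ _ e]]; first by rewrite len1.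
by rewrite /len e.
Qed.

Lemma fhd_fg n (x : S n) g : fg x g <> 1 -> fhd (fg x g) = Some x.
Proof. by case: (fg_cases x g) => [[-> _]//|[_ _ e]] _; rewrite /fhd /hd e. Qed.

Lemma fg_inj n (x x' : S n) g g' : fg x g <> 1 -> fg x g = fg x' g' -> x = x' /\ g = g'.
Proof.
move=> n1 e; case: (fg_cases x g) => [[//]|[_ _ e1]].
rewrite e in n1 e1; case: (fg_cases x' g') => [[//]|[_ _ e2]].
by move: e1; rewrite e2 => -[-> ->].
Qed.

(** A nontrivial entry of the image reveals x, and then every entry of y. If all entries are
    trivial, x is the basepoint or y is, so the class is the collapsed one. *)
Lemma theta_inj n : injective (theta n).
Proof.
apply: wsmash_piP => y x; apply: wsmash_piP => y' x' e.
have ee i : (i < n)%N -> fg x (wentry y i) = fg x' (wentry y' i).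
  by move=> im; rewrite -!wentry_theta // e.
have [[i [im i1]]|all1] := pselect (exists i, (i < n)%N /\ fg x (wentry y i) <> 1).
  have [ex _] := fg_inj i1 (ee i im); subst x'.
  congr wsmash_pi; apply: wentry_inj => j jn.
  have [j1|jn1] := pselect (fg x (wentry y j) = 1); last exact: (fg_inj jn1 (ee j jn)).2.
  have xp : x <> P n by move=> xp; case: i1; rewrite xp fg_pt.
  have g1 g : fg x g = 1 -> g = 1.
    move=> e1; case: (fg_cases x g) => [[_ [//|//]]|[_ _]].
    by rewrite e1 nf1.
  by rewrite (g1 _ j1) (g1 (wentry y' j)) // -ee.
have sub z (w : Wbar G n) : (forall i, (i < n)%N -> fg z (wentry w i) = 1) ->
    smash_sub (dpt D) (Wbar_nonsingular (dns (d := D))) n ((w, z) : TD n).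
  move=> h; have [->|zp] := pselect (z = P n); first by left.
  right; apply: wentry_inj => i im; rewrite wentry_pt //.
  by case: (fg_cases z (wentry w i)) => [[_ [//|//]]|[_ _]]; rewrite h // nf1.
have one i : (i < n)%N -> fg x (wentry y i) = 1.
  by move=> im; apply: contrapT => i1; apply: all1; exists i.
by apply: collapse_piE; apply: sub => i im; rewrite -?ee // one.
Qed.

(** For the converse, any nontrivial entry [i0] names the simplex x of the factor; if there is none,
    the basepoint is a preimage. *)
Lemma theta_image n (y : WF D n) :
  image_subsset theta n y <-> one_factor (F := dFG D) flen fhd (wentry y) n.
Proof.
split=> [[q <-]|[g1 g2]].
  move: q; apply: wsmash_piP => w x; split=> [i im|i j im jm].
    by rewrite wentry_theta //; exact: flen_fg.
  by rewrite !wentry_theta // => i1 j1; rewrite !fhd_fg.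
have [[i0 [im0 i1]]|all1] := pselect (exists i, (i < n)%N /\ wentry y i <> 1); last first.
  exists (wsmash_pi (pt (Wbar G) n) (P n)); apply: wentry_inj => i im.
  rewrite wentry_theta // fg_pt; apply: esym; apply: contrapT => i1.
  by apply: all1; exists i.
have letter (f : dFG D n) : (flen f <= 1)%N -> f <> 1 -> exists g x, f = fg x g /\ fhd f = Some x.
  move=> l1 f1; have e1 : flen f = 1%N.
    apply/eqP; rewrite eqn_leq l1 lt0n; apply/eqP => l0; apply: f1.
    exact: (@len_eq0 (G n) (S n) (P n) f l0).
  by have [g [x [ef _ _ _ hx]]] := len_letter e1; exists g, x; rewrite {1}ef.
have [g0 [x [e0 h0]]] := letter _ (g1 i0 im0) i1.
have /choice[a ha] i : exists g, (i < n)%N -> wentry y i = fg x g.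
  have [im|] := ltnP i n; last by exists 1.
  have [e|ne] := pselect (wentry y i = 1); first by exists 1; rewrite e mulhom1.
  have [g [x' [eg hx]]] := letter _ (g1 i im) ne; exists g => _.
  by have := g2 i i0 im im0 ne i1; rewrite h0 hx => -[<-].
exists (wsmash_pi (wbar a) x); apply: wentry_inj => i im.
by rewrite wentry_theta // wentry_bar // -ha.
Qed.

Lemma theta_extends : extends_from (image_subsset theta).
Proof.
have sd n i (f : dFG D n.+1) : (flen (sgd i f) <= flen f)%N.
  exact: (len_map (phi := FG_face (dpt D) (dtwist D) (inord i))
    (fun x g => FG_face_in (dpt D) (dtwist D) (inord i) x g)).
have degen_inj n i : (i <= n)%N -> injective (@degen S n (inord i)).
  by move=> im x x' e; rewrite -(dface_degen_id x im) -(dface_degen_id x' im) /ddegen e.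
(* Non-singularity enters here: the inverse twist after [s_i] kills no letter, so degeneracies act
   letterwise on normal forms. *)
have ai n i (x : S n) (g : G n) : (i <= n)%N ->
    tw_inv (dns (d := D)) (vertex x (inord i)) n.+1 (sg_degen G (inord i) g) = 1 -> g = 1.
  move=> im /(f_equal (dtwist D (vertex x (inord i)) n.+1)); rewrite tw_invVK mulhom1 => e.
  by rewrite -(sgd_sgs g im) /sgs e sgd1.
have nm n i (f : dFG D n) (im : (i <= n)%N) := @nf_map _ _ _ _ _ _
    (FG_degen (dpt D) (dns (d := D)) (inord i)) _ _
    (fun x g => FG_degen_in (dpt D) (dns (d := D)) (inord i) x g)
    (degen_inj n i im) (@degen_pt (psset_of (dpt D)) n (inord i)) (fun x g => @ai n i x g im) f.
apply: (@one_factor_extends (dFG D) S flen fhd).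
- by move=> n; exact: len1.
- by move=> n f; exact: len_eq0.
- by move=> n f g; exact: lenM.
- by move=> n f g; exact: hdM.
- by move=> n f l; exact: len_snoc.
- by move=> n f l f' l'; exact: snoc_inj.
- by move=> n f; exact: split_last.
- by move=> n f g lf lg fg; exact: (len_same lf lg fg).1.
- exact: sd.
- by move=> n i f im; rewrite /flen /len; have := nm n i f im => /(f_equal size); rewrite size_map.
- move=> n i f g im; have hm h : fhd (sgs i h) = omap (@degen S n (inord i)) (fhd h).
    by rewrite /fhd /hd; have := nm n i h im => ->; case: (nf _).
  rewrite !hm; split=> [|-> //].
  by case: (fhd f) (fhd g) => [x|] [x'|] //= [/(degen_inj n i im) ->].
- exact: theta_image.
Qed.

End Theta.

Lemma theta_natural (D D' : datum) (m : datum_map D D') n (q : Wsmash D n) :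
  theta D' n (Wsmash_map m n q) = WF_map m n (theta D n q).
Proof.
move: q; apply: wsmash_piP => y x.
have -> : Wsmash_map m n (wsmash_pi y x) =
    wsmash_pi (Wbar_map (dm_grp m) n y) (sset_of_map (dm_base m) n x).
  exact: (@collapse_funE _ _ _ _ (dm_times m) (@dm_times_sub _ _ m)).
apply: wentry_inj => i im; rewrite wentry_theta //.
rewrite [RHS]wentry_map // wentry_theta // wentry_map //.
exact/esym/dFG_fun_in.
Qed.

Theorem theorem4p5 (R : realType) :
  exists theta : forall D : datum, smap (Wsmash D) (WF D),
    (forall (D D' : datum) (m : datum_map D D') (n : nat) (x : Wsmash D n),
        theta D' n (Wsmash_map m n x) = WF_map m n (theta D n x)) /\
    (forall D : datum,
        homotopy_equivalence R (realization_map R (theta D))).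
Proof.
exists theta; split; first exact: theta_natural.
move=> D; apply: extension_equivalence; [exact: theta_inj| |exact: theta_extends].
move=> n; exact: (wsmash_pi (pt (Wbar (dgrp D)) n) (pt (psset_of (dpt D)) n)).
Qed.
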